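(* Let $m \in \mathbb{N}$. The theories $\text{CSA}_{m,\text{rcf}}$ and $\text{CSA-I}_{m,\text{rcf}}$ are model-complete in the languages $L_R$ and $L_{\text{CSA-I}}$, respectively. More precisely, if $\mathscr{M}$, $\mathscr{N}$ are models of $\text{CSA}_{m,\text{rcf}}$ (respectively $\text{CSA-I}_{m,\text{rcf}}$) and $\mathscr{M} \subseteq \mathscr{N}$ is a substructure in $L_R$ (respectively $L_{\text{CSA-I}}$), then $\mathscr{M} \prec \mathscr{N}$ in $L_R \cup \{\underline{P}, \underline{\mathrm{Trd}}\}$ (respectively $L_{\text{CSA-I}} \cup \{\underline{P}, \underline{\mathrm{Trd}}\}$), where in all models $\underline{P}$ is interpreted by the unique ordering on the real closed field in question (the centre for models of $\text{CSA}_{m,\text{rcf}}$, the interpretation of $\underline{F}$ for models of $\text{CSA-I}_{m,\text{rcf}}$) and $\underline{\mathrm{Trd}}$ is interpreted by the reduced trace map.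
   Context: $L_R$ is the first-order language of (unital) rings, and $L_{\text{CSA-I}} := L_R \cup \{\underline{F}, \underline{\sigma}\}$ with $\underline{F}$ a unary relation symbol and $\underline{\sigma}$ a unary function symbol. $\underline{P}$ is a unary relation symbol and $\underline{\mathrm{Trd}}$ a unary function symbol. $\text{CSA}_m$ is the $L_R$-theory stating: the structure is a von Neumann regular ring (for every $x$ there is $y$ with $xyx = x$), its centre is a field, and its dimension over its centre is $m$. $\text{CSA}_{m,\text{rcf}} := \text{CSA}_m \cup \{\text{the centre is real closed}\}$. $\text{CSA-I}_m$ is the $L_{\text{CSA-I}}$-theory stating: the structure is a von Neumann regular ring, its centre is a field, $\underline{\sigma}$ is an involution (an additive anti-automorphism of order at most 2), $\underline{F}$ is the field of all elements of the centre that are fixed by $\underline{\sigma}$, and the dimension over $\underline{F}$ is $m$. $\text{CSA-I}_{m,\text{rcf}} := \text{CSA-I}_m \cup \{\underline{F} \text{ is real closed}\}$. The models of these theories are (finite-dimensional) central simple algebras over their centres. For a central simple algebra $A$ over $K = Z(A)$, the reduced trace $\mathrm{Trd}_A : A \to K$ is defined by $\mathrm{Trd}_A(a) = \mathrm{tr}(f(a \otimes 1))$, where $L \supseteq K$ is a splitting field and $f : A \otimes_K L \to M_r(L)$ is an $L$-algebra isomorphism (the result is independent of the choices and lies in $K$). *)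

(* Defs.v *)
From HB Require Import structures.
From mathcomp Require Import all_boot all_order all_algebra.

Set Implicit Arguments.
Unset Strict Implicit.
Unset Printing Implicit Defensive.

Import GRing.Theory.
Local Open Scope ring_scope.

Record language := Language {
  fsym : Type;  farity : fsym -> nat;
  rsym : Type;  rarity : rsym -> nat }.

Inductive term (L : language) : Type :=
| Var (i : nat)
| App (f : fsym L) (args : 'I_(farity f) -> term L).

(* Variables are named by natural numbers. *)
Inductive formula (L : language) : Type :=
| Bot
| Eq (s t : term L)
| Rel (r : rsym L) (args : 'I_(rarity r) -> term L)
| And (p q : formula L)
| Or (p q : formula L)
| Imp (p q : formula L)
| Forall (i : nat) (p : formula L)
| Exists (i : nat) (p : formula L).

Arguments Var {L} i.
Arguments App {L} f args.
Arguments Bot {L}.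
Arguments Eq {L} s t.
Arguments Rel {L} r args.

Definition Not L (p : formula L) := Imp p Bot.
Definition Top {L} : formula L := Not Bot.
Definition Iff L (p q : formula L) := And (Imp p q) (Imp q p).

(* Quantification over the block of variables i, i + 1, ..., i + n - 1. *)
Definition Forall_block L (i n : nat) (p : formula L) :=
  foldr (@Forall L) p (iota i n).
Definition Exists_block L (i n : nat) (p : formula L) :=
  foldr (@Exists L) p (iota i n).

Record structure (L : language) := Structure {
  carrier :> Type;
  finterp : forall f : fsym L, ('I_(farity f) -> carrier) -> carrier;
  rinterp : forall r : rsym L, ('I_(rarity r) -> carrier) -> Prop }.

Arguments finterp {L} s f args.
Arguments rinterp {L} s r args.

Fixpoint eval L (M : structure L) (v : nat -> M) (t : term L) : M :=
  match t with
  | Var i => v i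
  | App f args => finterp M f (fun k => eval v (args k))
  end.

Definition update T (v : nat -> T) (i : nat) (a : T) : nat -> T :=
  fun j => if j == i then a else v j.

Fixpoint sat L (M : structure L) (v : nat -> M) (p : formula L) : Prop :=
  match p with
  | Bot => False
  | Eq s t => eval v s = eval v t
  | Rel r args => rinterp M r (fun k => eval v (args k))
  | And p q => sat v p /\ sat v q
  | Or p q => sat v p \/ sat v q
  | Imp p q => sat v p -> sat v q
  | Forall i p => forall a : M, sat (update v i a) p
  | Exists i p => exists a : M, sat (update v i a) p
  end.

(* All theories below consist of formulas without free variables, so that the
   valuation in [models] is irrelevant. *)
Definition theory (L : language) := formula L -> Prop.

Definition models L (T : theory L) (M : structure L) : Prop :=
  forall p, T p -> forall v : nat -> M, sat v p.

(* M is a substructure of N, viewed along the map iota. *)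
Definition embedding L (M N : structure L) (iota : M -> N) : Prop :=
  [/\ injective iota,
      forall f args, iota (finterp M f args) = finterp N f (iota \o args)
    & forall r args, rinterp M r args <-> rinterp N r (iota \o args)].

Definition elementary L (M N : structure L) (iota : M -> N) : Prop :=
  forall (p : formula L) (v : nat -> M), sat v p <-> sat (iota \o v) p.

Definition model_complete L (T : theory L) : Prop :=
  forall (M N : structure L) (iota : M -> N),
    models T M -> models T N -> embedding iota -> elementary iota.

Definition args0 T (k : 'I_0) : T := False_rect T (notF (ltn_ord k)).
Definition args1 T (a : T) (k : 'I_1) : T := a.
Definition args2 T (a b : T) (k : 'I_2) : T := if k == ord0 then a else b.

Inductive ring_symbol := SZero | SOne | SOpp | SAdd | SMul.

Definition ring_arity (s : ring_symbol) : nat :=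
  match s with SZero | SOne => 0 | SOpp => 1 | SAdd | SMul => 2 end.

(* The language of unital rings together with the symbols of X. *)
Definition ring_language (X : language) : language :=
  @Language (ring_symbol + fsym X)
    (fun s => match s with inl s => ring_arity s | inr s => farity s end)
    (rsym X) (@rarity X).

Definition L_empty : language :=
  @Language Empty_set (fun _ => 0%N) Empty_set (fun _ => 0%N).

(* The function symbol sigma and the relation symbol F. *)
Definition L_inv : language :=
  @Language unit (fun _ => 1%N) unit (fun _ => 1%N).

Definition L_R : language := ring_language L_empty.
Definition L_CSAI : language := ring_language L_inv.

(* The language L together with the relation symbol P and the function symbol
   Trd, and the expansion of an L-structure by interpretations of these. *)
Definition add_P_Trd (L : language) : language :=
  @Language (fsym L + unit)
    (fun s => match s with inl s => farity s | inr _ => 1%N end)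
    (rsym L + unit)
    (fun r => match r with inl r => rarity r | inr _ => 1%N end).

Definition expand_P_Trd L (M : structure L) (P : M -> Prop) (trd : M -> M) :
    structure (add_P_Trd L) :=
  @Structure (add_P_Trd L) M
    (fun f => match f with
              | inl f => fun args => finterp M f args
              | inr _ => fun args => trd (args ord0)
              end)
    (fun r => match r with
              | inl r => fun args => rinterp M r args
              | inr _ => fun args => P (args ord0)
              end).

Declare Scope fo_scope.
Delimit Scope fo_scope with fo.
Bind Scope fo_scope with term formula.

Section RingTerms.
Variable X : language.
Let L := ring_language X.
Definition tzero : term L := @App L (inl SZero) (@args0 _).
Definition tone : term L := @App L (inl SOne) (@args0 _).
Definition topp (t : term L) : term L := @App L (inl SOpp) (args1 t).
Definition tadd (s t : term L) : term L := @App L (inl SAdd) (args2 s t).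
Definition tmul (s t : term L) : term L := @App L (inl SMul) (args2 s t).
Definition texp (t : term L) (n : nat) : term L := iter n (tmul t) tone.
End RingTerms.
Arguments tzero {X}.
Arguments tone {X}.

Local Notation "''X_' i" := (Var i) : fo_scope.
Local Notation "0" := tzero : fo_scope.
Local Notation "1" := tone : fo_scope.
Local Notation "- t" := (topp t) : fo_scope.
Local Notation "s + t" := (tadd s t) : fo_scope.
Local Notation "s * t" := (tmul s t) : fo_scope.
Local Notation "t ^+ n" := (texp t n) : fo_scope.
Local Notation "\sum_ ( i < n ) t" :=
  (\big[@tadd _/tzero]_(i < n) t%fo) : fo_scope.
Local Notation "s == t" := (Eq s t) : fo_scope.
Local Notation "p /\ q" := (And p q) : fo_scope.
Local Notation "p \/ q" := (Or p q) : fo_scope.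
Local Notation "p -> q" := (Imp p q) : fo_scope.
Local Notation "p <-> q" := (Iff p q) : fo_scope.
Local Notation "~ p" := (Not p) : fo_scope.
Local Notation "''forall' ''X_' i , p" := (Forall i p) : fo_scope.
Local Notation "''exists' ''X_' i , p" := (Exists i p) : fo_scope.
Local Notation "\conj_ ( i < n ) p" := (\big[@And _/Top]_(i < n) p%fo)
  (at level 41, i at level 0, n at level 50, p at level 41) : fo_scope.

Local Open Scope fo_scope.

Section RingSentences.
Variable X : language.
Let L := ring_language X.

Inductive ring_axioms : theory L :=
| ax_addA : ring_axioms ('forall 'X_0, 'forall 'X_1, 'forall 'X_2,
    'X_0 + ('X_1 + 'X_2) == ('X_0 + 'X_1) + 'X_2)
| ax_addC : ring_axioms ('forall 'X_0, 'forall 'X_1, 'X_0 + 'X_1 == 'X_1 + 'X_0)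
| ax_add0 : ring_axioms ('forall 'X_0, 0 + 'X_0 == 'X_0)
| ax_addN : ring_axioms ('forall 'X_0, - 'X_0 + 'X_0 == 0)
| ax_mulA : ring_axioms ('forall 'X_0, 'forall 'X_1, 'forall 'X_2,
    'X_0 * ('X_1 * 'X_2) == ('X_0 * 'X_1) * 'X_2)
| ax_mul1l : ring_axioms ('forall 'X_0, 1 * 'X_0 == 'X_0)
| ax_mul1r : ring_axioms ('forall 'X_0, 'X_0 * 1 == 'X_0)
| ax_mulDl : ring_axioms ('forall 'X_0, 'forall 'X_1, 'forall 'X_2,
    ('X_0 + 'X_1) * 'X_2 == 'X_0 * 'X_2 + 'X_1 * 'X_2)
| ax_mulDr : ring_axioms ('forall 'X_0, 'forall 'X_1, 'forall 'X_2,
    'X_0 * ('X_1 + 'X_2) == 'X_0 * 'X_1 + 'X_0 * 'X_2).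

Definition regular_axiom : formula L :=
  ('forall 'X_0, 'exists 'X_1, ('X_0 * 'X_1) * 'X_0 == 'X_0).

(* A formula with one free variable, given as a function of the name of that
   variable. *)
Implicit Type D : nat -> formula L.

Definition centre_formula (i : nat) : formula L :=
  ('forall 'X_i.+1, 'X_i * 'X_i.+1 == 'X_i.+1 * 'X_i).

(* The centre is a field; being a commutative ring is automatic. *)
Definition centre_field_axiom : formula L :=
  (~ (0 == 1) /\
   'forall 'X_0, centre_formula 0 -> ~ ('X_0 == 0) ->
     'exists 'X_1, centre_formula 1 /\ 'X_0 * 'X_1 == 1).

(* The (left) dimension over the field defined by D is m:
   'X_0, ..., 'X_(m-1) is a basis. *)
Definition dimension_axiom D (m : nat) : formula L :=
  Exists_block 0 m
    ( ('forall 'X_(m + m), Exists_block m m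
         ((\conj_(i < m) D (m + i)%N) /\
          'X_(m + m) == \sum_(i < m) ('X_(m + i) * 'X_i)))
   /\ Forall_block m m
         ((\conj_(i < m) D (m + i)%N) ->
          \sum_(i < m) ('X_(m + i) * 'X_i) == 0 ->
          \conj_(i < m) ('X_(m + i) == 0))).

(* The field defined by D is real closed: -1 is not a sum of squares, every
   element is plus or minus a square, and every monic polynomial of odd degree
   has a root. *)
Inductive real_closed_axioms D : theory L :=
| ax_real n : real_closed_axioms D
    (Forall_block 0 n ((\conj_(i < n) D i) ->
       ~ (\sum_(i < n) 'X_i ^+ 2 == topp 1)))
| ax_square : real_closed_axioms D
    ('forall 'X_0, D 0%N ->
       'exists 'X_1, D 1%N /\ ('X_0 == 'X_1 ^+ 2 \/ 'X_0 == - ('X_1 ^+ 2)))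
| ax_odd_root k : let n := k.*2.+1 in real_closed_axioms D
    (Forall_block 0 n ((\conj_(i < n) D i) ->
       'exists 'X_n, D n /\
         'X_n ^+ n + \sum_(i < n) ('X_i * 'X_n ^+ i) == 0)).

End RingSentences.

Inductive CSA (m : nat) : theory L_R :=
| CSA_ring p : ring_axioms p -> CSA m p
| CSA_regular : CSA m (regular_axiom _)
| CSA_centre_field : CSA m (centre_field_axiom _)
| CSA_dimension : CSA m (dimension_axiom (@centre_formula _) m).

Inductive CSA_rcf (m : nat) : theory L_R :=
| CSA_rcf_CSA p : CSA m p -> CSA_rcf m p
| CSA_rcf_rcf p : real_closed_axioms (@centre_formula _) p -> CSA_rcf m p.

Definition tsigma (t : term L_CSAI) : term L_CSAI :=
  @App L_CSAI (inr tt) (args1 t).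
Definition F_formula (i : nat) : formula L_CSAI :=
  @Rel L_CSAI tt (args1 (Var i)).

Inductive involution_axioms : theory L_CSAI :=
| ax_sigmaD : involution_axioms ('forall 'X_0, 'forall 'X_1,
    tsigma ('X_0 + 'X_1) == tsigma 'X_0 + tsigma 'X_1)
| ax_sigmaM : involution_axioms ('forall 'X_0, 'forall 'X_1,
    tsigma ('X_0 * 'X_1) == tsigma 'X_1 * tsigma 'X_0)
| ax_sigmaK : involution_axioms ('forall 'X_0, tsigma (tsigma 'X_0) == 'X_0).

Definition F_axiom : formula L_CSAI :=
  ('forall 'X_0, F_formula 0 <->
     (centre_formula _ 0 /\ tsigma 'X_0 == 'X_0)).

Inductive CSAI (m : nat) : theory L_CSAI :=
| CSAI_ring p : ring_axioms p -> CSAI m p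
| CSAI_regular : CSAI m (regular_axiom _)
| CSAI_centre_field : CSAI m (centre_field_axiom _)
| CSAI_involution p : involution_axioms p -> CSAI m p
| CSAI_F : CSAI m F_axiom
| CSAI_dimension : CSAI m (dimension_axiom F_formula m).

Inductive CSAI_rcf (m : nat) : theory L_CSAI :=
| CSAI_rcf_CSAI p : CSAI m p -> CSAI_rcf m p
| CSAI_rcf_rcf p : real_closed_axioms F_formula p -> CSAI_rcf m p.

Local Close Scope fo_scope.

Section RingStructure.
Variables (X : language) (M : structure (ring_language X)).
Definition rzero : M := finterp M (inl SZero) (@args0 _).
Definition rone : M := finterp M (inl SOne) (@args0 _).
Definition ropp (a : M) : M := finterp M (inl SOpp) (args1 a).
Definition radd (a b : M) : M := finterp M (inl SAdd) (args2 a b).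
Definition rmul (a b : M) : M := finterp M (inl SMul) (args2 a b).

Definition centre (a : M) : Prop := forall b, rmul a b = rmul b a.

(* P is the set of nonnegative elements of a field ordering on the subfield D
   of M. *)
Definition is_ordering (D P : M -> Prop) : Prop :=
  [/\ forall a, P a -> D a,
      forall a b, P a -> P b -> P (radd a b),
      forall a b, P a -> P b -> P (rmul a b),
      forall a, D a -> P a \/ P (ropp a)
    & forall a, (P a /\ P (ropp a)) <-> a = rzero].
End RingStructure.

Definition fixed_field (M : structure L_CSAI) (a : M) : Prop :=
  rinterp M (tt : rsym L_CSAI) (args1 a).

Section ReducedTrace.
Variables (K : fieldType) (A : algType K).

(* The L-algebra T, with pure tensors mu a l, is the tensor product over K of
   A and the field extension h : K -> L. *)
Definition is_scalar_extension (L : fieldType) (h : {rmorphism K -> L})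
    (T : algType L) (mu : A -> L -> T) : Prop :=
  let balanced (V : zmodType) (b : A -> L -> V) :=
    [/\ forall a a' l, b (a + a') l = b a l + b a' l,
        forall a l l', b a (l + l') = b a l + b a l'
      & forall k a l, b (k *: a) l = b a (h k * l)] in
  [/\ balanced T mu,
      mu 1 1 = 1,
      forall a a' l l', mu a l * mu a' l' = mu (a * a') (l * l'),
      forall c a l, c *: mu a l = mu a (c * l)
    & forall (V : zmodType) (b : A -> L -> V), balanced V b ->
        exists g : {additive T -> V}, (forall a l, g (mu a l) = b a l) /\
          forall g' : {additive T -> V},
            (forall a l, g' (mu a l) = b a l) -> g' =1 g].

Definition is_reduced_trace (t : A -> K) : Prop :=
  exists (L : fieldType) (h : {rmorphism K -> L})
         (T : algType L) (mu : A -> L -> T)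
         (r : nat) (f : {lrmorphism T -> 'M[L]_r.+1}),
    [/\ is_scalar_extension h mu, bijective f
      & forall a, h (t a) = \tr (f (mu a 1))].
End ReducedTrace.

(* trd : M -> M is the reduced trace of the ring M over its centre: M is
   identified with an algebra A over a field K that is precisely the centre
   of A. *)
Definition is_Trd X (M : structure (ring_language X)) (trd : M -> M) : Prop :=
  exists (K : fieldType) (A : algType K) (e : M -> A) (t : A -> K),
    [/\ bijective e,
        [/\ e (rone M) = 1, {morph e : a b / radd a b >-> a + b}
          & {morph e : a b / rmul a b >-> a * b}],
        forall a : A, (forall b, a * b = b * a) <-> (exists k, a = k%:A),
        is_reduced_trace t
      & forall a, e (trd a) = (t (e a))%:A].

(* Main.v *)
From HB Require Import structures.
From mathcomp Require Import all_boot all_order all_algebra all_fingroup.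
From mathcomp Require Import all_solvable all_field.
From mathcomp Require Import boolp.
From mathcomp Require Import ring lra.
From mathcomp Require Import ordered_qelim.
From mathcomp Require qe_rcf qe_rcf_th.
Require Import Defs.

Set Implicit Arguments.
Unset Strict Implicit.
Unset Printing Implicit Defensive.

Import Order.TTheory GRing.Theory Num.Theory.
Local Open Scope ring_scope.

(** Let M be a submodel of N, both of dimension m, over the real closed fields K
    and L respectively (their centres, or the interpretations of F).

    The main point is that a basis of M over K is a basis of N over L.  Consider
    the maps obtained from the identity by taking sums, by multiplying on either
    side by elements of M and, if there is an involution, by composing with it.
    They map M to itself, and the same expressions define maps of N that are
    linear over L.  Since M is regular and has no central idempotents besides 0
    and 1, it is a simple ring ([regular_ideal_full]); and an element of M killed
    by all those maps that kill 1 commutes with M, and is fixed by the involution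
    if there is one, so that it belongs to K.  By the argument of the density
    theorem ([density]) there are maps of this kind dual to a given basis of M.
    Applied to a relation between the basis vectors with coefficients in L, they
    show that the coefficients are zero.  So the m basis vectors are independent
    over L in N, which has dimension m ([pair_basis]).

    In coordinates M becomes the m-th power of K, and N the m-th power of L, and
    both are described by the same formulas with parameters in K: structure
    constants for the product, a matrix for the involution, the line through 1
    for F, and the half-line through 1 for P, as the ordering of a real closed
    field is unique ([ordering_unique]).  The reduced trace is linear, hence is
    given by a matrix, and the matrix for M serves for N because the reduced
    trace of N extends that of M: it is determined by the traces of the left
    multiplications ([reduced_trace_formula]), which can be computed in one basis
    for both algebras, the density argument being applied this time over the
    centres ([reduced_trace_restrict]).

    A formula about M or N is thus translated into a formula about K or L, and
    the inclusion of M in N is elementary because that of K in L is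
    ([interprets_elementary]).  The latter is the model completeness of real
    closed fields ([rcf_morph_elementary]), which comes from the fact that
    quantifier elimination commutes with a change of coefficients.  The
    procedure is justified by the intermediate value property for polynomials,
    whereas the axioms only speak of square roots and of roots in odd degree:
    the argument of Artin and Schreier ([dim_splitting_field]) fills this gap.

    Elementarity passes to a smaller language; for the model completeness itself
    it is enough to expand the models by P and, in the place of the trace, by
    the zero map ([pair_elementary_plain]). *)

(** * Model completeness of real closed fields *)

Lemma nth_map_default (T U : Type) (f : T -> U) x s i :
  nth (f x) (map f s) i = f (nth x s i).
Proof. by elim: s i => [|y s IHs] [|i] //=. Qed.

Section MapFormula.
Variables (R S : Type) (h : R -> S).

Fixpoint map_term (t : GRing.term R) : GRing.term S :=
  match t with
  | GRing.Var i => GRing.Var S i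
  | GRing.Const c => GRing.Const (h c)
  | GRing.NatConst n => GRing.NatConst S n
  | GRing.Add t u => GRing.Add (map_term t) (map_term u)
  | GRing.Opp t => GRing.Opp (map_term t)
  | GRing.NatMul t n => GRing.NatMul (map_term t) n
  | GRing.Mul t u => GRing.Mul (map_term t) (map_term u)
  | GRing.Inv t => GRing.Inv (map_term t)
  | GRing.Exp t n => GRing.Exp (map_term t) n
  end.

Fixpoint map_formula (f : ord.formula R) : ord.formula S :=
  match f with
  | ord.Bool b => ord.Bool b
  | ord.Equal t u => ord.Equal (map_term t) (map_term u)
  | ord.Lt t u => ord.Lt (map_term t) (map_term u)
  | ord.Le t u => ord.Le (map_term t) (map_term u)
  | ord.Unit t => ord.Unit (map_term t)
  | ord.And f g => ord.And (map_formula f) (map_formula g)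
  | ord.Or f g => ord.Or (map_formula f) (map_formula g)
  | ord.Implies f g => ord.Implies (map_formula f) (map_formula g)
  | ord.Not f => ord.Not (map_formula f)
  | ord.Exists i f => ord.Exists i (map_formula f)
  | ord.Forall i f => ord.Forall i (map_formula f)
  end.

Fixpoint map_qf_term (t : qe_rcf.term R) : qe_rcf.term S :=
  match t with
  | qe_rcf.Var i => qe_rcf.Var S i
  | qe_rcf.Const c => qe_rcf.Const (h c)
  | qe_rcf.NatConst n => qe_rcf.NatConst S n
  | qe_rcf.Add t u => qe_rcf.Add (map_qf_term t) (map_qf_term u)
  | qe_rcf.Opp t => qe_rcf.Opp (map_qf_term t)
  | qe_rcf.NatMul t n => qe_rcf.NatMul (map_qf_term t) n
  | qe_rcf.Mul t u => qe_rcf.Mul (map_qf_term t) (map_qf_term u)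
  | qe_rcf.Exp t n => qe_rcf.Exp (map_qf_term t) n
  end.

Fixpoint map_qf (f : qe_rcf.formula R) : qe_rcf.formula S :=
  match f with
  | qe_rcf.Bool b => qe_rcf.Bool b
  | qe_rcf.Equal t u => qe_rcf.Equal (map_qf_term t) (map_qf_term u)
  | qe_rcf.Lt t u => qe_rcf.Lt (map_qf_term t) (map_qf_term u)
  | qe_rcf.Le t u => qe_rcf.Le (map_qf_term t) (map_qf_term u)
  | qe_rcf.And f g => qe_rcf.And (map_qf f) (map_qf g)
  | qe_rcf.Or f g => qe_rcf.Or (map_qf f) (map_qf g)
  | qe_rcf.Implies f g => qe_rcf.Implies (map_qf f) (map_qf g)
  | qe_rcf.Not f => qe_rcf.Not (map_qf f)
  end.

Lemma map_qf_term_rterm t :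
  map_term (qe_rcf.rterm_to_term t) = qe_rcf.rterm_to_term (map_qf_term t).
Proof. by elim: t => //= [t -> u ->|t ->|t -> n|t -> u ->|t -> n]. Qed.

Lemma map_to_rterm t :
  map_qf_term (qe_rcf.to_rterm t) = qe_rcf.to_rterm (map_term t).
Proof. by elim: t => //= [t -> u ->|t ->|t -> n|t -> u ->|t -> n]. Qed.

Lemma map_qf_formula f :
  map_formula (qe_rcf.qfr_to_formula f) = qe_rcf.qfr_to_formula (map_qf f).
Proof.
by elim: f => //= [t u|t u|t u|f -> g ->|f -> g ->|f -> g ->|f ->] //;
  rewrite !map_qf_term_rterm.
Qed.

End MapFormula.

Definition wproj (F : realFieldType) n s : ord.formula F :=
  qe_rcf.qfr_to_formula (qe_rcf.wproj n s).

Section Naturality.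
Variables (F G : rcfType) (h : {rmorphism F -> G}).

Local Notation mt := (map_qf_term h).
Local Notation mf := (map_qf h).
Local Notation mp := (map mt).
Local Notation cps F T := ((T -> qe_rcf.formula F) -> qe_rcf.formula F).

(** A test written in continuation passing style produces its answer x only
    inside the continuation; naturality says that transporting the formula
    amounts to running the transported test, whose answer is g x. *)
Definition natural T T' (g : T -> T') (c : cps F T) (c' : cps G T') : Prop :=
  forall k k', (forall x, mf (k x) = k' (g x)) -> mf (c k) = c' k'.

Lemma natural_Size p : natural id (qe_rcf.Size p) (qe_rcf.Size (mp p)).
Proof.
elim: p => [|c p IHp] k k' kk' //=; apply: IHp => -[|n] //=.
by rewrite !kk'.
Qed.

Lemma natural_Isnull p : natural id (qe_rcf.Isnull p) (qe_rcf.Isnull (mp p)).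
Proof. by move=> k k' kk'; apply: natural_Size => n; apply: kk'. Qed.

Lemma natural_LtSize p q :
  natural id (qe_rcf.LtSize p q) (qe_rcf.LtSize (mp p) (mp q)).
Proof.
move=> k k' kk'; apply: natural_Size => n.
by apply: (natural_Size q) => n'; apply: kk'.
Qed.

Lemma natural_LeadCoef p :
  natural mt (qe_rcf.LeadCoef p) (qe_rcf.LeadCoef (mp p)).
Proof.
elim: p => [|c p IHp] k k' kk' /=; first by rewrite kk' /= rmorph0.
by apply: IHp => l /=; rewrite !kk'.
Qed.

Lemma map_AmulXn a n : mp (qe_rcf.AmulXn a n) = qe_rcf.AmulXn (mt a) n.
Proof. by elim: n => //= n ->; rewrite rmorph0. Qed.

Lemma map_AddPoly p q :
  mp (qe_rcf.AddPoly p q) = qe_rcf.AddPoly (mp p) (mp q).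
Proof. by elim: p q => [|a p IHp] [|b q] //=; rewrite IHp. Qed.

Lemma map_ScalPoly c p :
  mp (qe_rcf.ScalPoly c p) = qe_rcf.ScalPoly (mt c) (mp p).
Proof. by rewrite /qe_rcf.ScalPoly -!map_comp. Qed.

Lemma map_MulPoly p q :
  mp (qe_rcf.MulPoly p q) = qe_rcf.MulPoly (mp p) (mp q).
Proof. by elim: p => //= a p IHp; rewrite map_AddPoly map_ScalPoly /= IHp. Qed.

Lemma map_ExpPoly p n : mp (qe_rcf.ExpPoly p n) = qe_rcf.ExpPoly (mp p) n.
Proof.
rewrite /qe_rcf.ExpPoly; case: n => // n; rewrite !iteropS.
by elim: n => //= n IHn; rewrite map_MulPoly IHn.
Qed.

Lemma map_OppPoly p : mp (qe_rcf.OppPoly p) = qe_rcf.OppPoly (mp p).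
Proof. by rewrite /qe_rcf.OppPoly map_ScalPoly /= rmorphN1. Qed.

Lemma map_NatMulPoly n p :
  mp (qe_rcf.NatMulPoly n p) = qe_rcf.NatMulPoly n (mp p).
Proof. by rewrite /qe_rcf.NatMulPoly map_ScalPoly. Qed.

Lemma map_Deriv p : mp (qe_rcf.Deriv p) = qe_rcf.Deriv (mp p).
Proof. by elim: p => //= a p IHp; rewrite map_AddPoly /= IHp. Qed.

Let mdiv (d : nat * qe_rcf.polyF F * qe_rcf.polyF F) :=
  (d.1.1, mp d.1.2, mp d.2).

Lemma natural_Rediv_rec_loop q sq cq c qq r n :
  natural mdiv (qe_rcf.Rediv_rec_loop q sq cq c qq r n)
    (qe_rcf.Rediv_rec_loop (mp q) sq (mt cq) c (mp qq) (mp r) n).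
Proof.
elim: n c qq r => [|n IHn] c qq r k k' kk' /=; apply: natural_Size => sr;
  case: ifP => _ //; apply: natural_LeadCoef => lr.
  by rewrite kk' /mdiv /= !(map_AddPoly, map_MulPoly, map_OppPoly, map_AmulXn).
rewrite (IHn _ _ _ _ k') //.
by rewrite !(map_AddPoly, map_MulPoly, map_OppPoly, map_AmulXn).
Qed.

Lemma natural_Rediv p q :
  natural mdiv (qe_rcf.Rediv p q) (qe_rcf.Rediv (mp p) (mp q)).
Proof.
move=> k k' kk'; apply: (natural_Isnull q) => -[].
  by rewrite kk' /mdiv /= rmorph0.
apply: (natural_Size q) => sq; apply: (natural_Size p) => sp.
apply: (natural_LeadCoef q) => lq.
by rewrite (natural_Rediv_rec_loop _ _ _ _ _ _ _ kk') /= rmorph0.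
Qed.

Lemma natural_Rmod p q :
  natural mp (qe_rcf.Rmod p q) (qe_rcf.Rmod (mp p) (mp q)).
Proof. by move=> k k' kk'; apply: natural_Rediv => d; apply: kk'. Qed.

Lemma natural_Rscal p q :
  natural id (qe_rcf.Rscal p q) (qe_rcf.Rscal (mp p) (mp q)).
Proof. by move=> k k' kk'; apply: natural_Rediv => d; apply: kk'. Qed.

Lemma natural_Rgcd_loop n p q :
  natural mp (qe_rcf.Rgcd_loop n p q) (qe_rcf.Rgcd_loop n (mp p) (mp q)).
Proof.
elim: n p q => [|n IHn] p q k k' kk' /=; apply: natural_Rmod => r;
  apply: natural_Isnull => -[]; rewrite ?kk' //.
exact: IHn.
Qed.

Lemma natural_Rgcd p q :
  natural mp (qe_rcf.Rgcd p q) (qe_rcf.Rgcd (mp p) (mp q)).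
Proof.
move=> k k' kk'; apply: (natural_LtSize p q) => -[].
  apply: (natural_Isnull q) => -[]; first exact: kk'.
  by apply: (natural_Size q) => n; apply: natural_Rgcd_loop.
apply: (natural_Isnull p) => -[]; first exact: kk'.
by apply: (natural_Size p) => n; apply: natural_Rgcd_loop.
Qed.

Lemma natural_BigRgcd ps :
  natural mp (qe_rcf.BigRgcd ps) (qe_rcf.BigRgcd (map mp ps)).
Proof.
elim: ps => [|p ps IHps] k k' kk' /=; first by rewrite kk' /= rmorph0.
by apply: IHps => r; apply: natural_Rgcd.
Qed.

Lemma natural_Changes s : natural id (qe_rcf.Changes s) (qe_rcf.Changes (mp s)).
Proof.
elim: s => [|a s IHs] k k' kk' //=; apply: IHs => v /=.
by rewrite !kk'; case: s.
Qed.

Lemma natural_SeqPInfty ps :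
  natural mp (qe_rcf.SeqPInfty ps) (qe_rcf.SeqPInfty (map mp ps)).
Proof.
elim: ps => [|p ps IHps] k k' kk' //=.
by apply: natural_LeadCoef => lp; apply: IHps => lps; rewrite kk'.
Qed.

Lemma natural_SeqMInfty ps :
  natural mp (qe_rcf.SeqMInfty ps) (qe_rcf.SeqMInfty (map mp ps)).
Proof.
elim: ps => [|p ps IHps] k k' kk' //=.
apply: natural_LeadCoef => lp; apply: natural_Size => sp.
by apply: IHps => lps; rewrite kk' /= rmorphN1.
Qed.

Lemma natural_ChangesPoly ps :
  natural id (qe_rcf.ChangesPoly ps) (qe_rcf.ChangesPoly (map mp ps)).
Proof.
move=> k k' kk'; apply: natural_SeqMInfty => mps.
apply: natural_SeqPInfty => pps; apply: natural_Changes => vm.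
by apply: natural_Changes => vp; apply: kk'.
Qed.

Lemma natural_NextMod p q :
  natural mp (qe_rcf.NextMod p q) (qe_rcf.NextMod (mp p) (mp q)).
Proof.
move=> k k' kk'; apply: natural_LeadCoef => lq; apply: natural_Rscal => spq.
by apply: natural_Rmod => rpq; rewrite kk' map_ScalPoly.
Qed.

Lemma natural_ModsAux p q n :
  natural (map mp) (qe_rcf.ModsAux p q n) (qe_rcf.ModsAux (mp p) (mp q) n).
Proof.
elim: n p q => [|n IHn] p q k k' kk' /=; first by rewrite kk'.
apply: natural_Isnull => -[]; first by rewrite kk'.
by apply: natural_NextMod => npq; apply: IHn => ps; rewrite kk'.
Qed.

Lemma natural_Mods p q :
  natural (map mp) (qe_rcf.Mods p q) (qe_rcf.Mods (mp p) (mp q)).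
Proof.
move=> k k' kk'; apply: natural_Size => sp; apply: (natural_Size q) => sq.
exact: natural_ModsAux.
Qed.

Lemma map_PolyComb sq sc :
  mp (qe_rcf.PolyComb sq sc) = qe_rcf.PolyComb (map mp sq) sc.
Proof.
rewrite /qe_rcf.PolyComb size_map; elim: (iota _ _) => //= i s IHs.
by rewrite map_MulPoly IHs map_ExpPoly -(nth_map_default mp).
Qed.

Lemma map_Pcq sq i : mp (qe_rcf.Pcq sq i) = qe_rcf.Pcq (map mp sq) i.
Proof.
rewrite /qe_rcf.Pcq size_map -(nth_map_default mp) -map_comp; congr nth.
by apply: eq_map => sc /=; rewrite map_PolyComb.
Qed.

Lemma natural_TaqR p q :
  natural id (qe_rcf.TaqR p q) (qe_rcf.TaqR (mp p) (mp q)).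
Proof.
move=> k k' kk'; rewrite /qe_rcf.TaqR -map_Deriv -map_MulPoly.
by apply: natural_Mods => r; apply: natural_ChangesPoly.
Qed.

Lemma natural_TaqsR p sq i :
  natural mt (qe_rcf.TaqsR p sq i) (qe_rcf.TaqsR (mp p) (map mp sq) i).
Proof.
move=> k k' kk'; rewrite /qe_rcf.TaqsR -map_Pcq.
by apply: natural_TaqR => n; rewrite kk' /= rmorph_int.
Qed.

Lemma map_BoundingPoly sq :
  mp (qe_rcf.BoundingPoly sq) = qe_rcf.BoundingPoly (map mp sq).
Proof.
rewrite /qe_rcf.BoundingPoly map_Deriv; congr qe_rcf.Deriv.
by elim: sq => //= q sq IHsq; rewrite map_MulPoly IHsq.
Qed.

Lemma map_coefs n i : h (qe_rcf_th.coefs F n i) = qe_rcf_th.coefs G n i.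
Proof.
rewrite /qe_rcf_th.coefs -(nth_map_default h) rmorph0 -map_comp; congr nth.
apply: eq_map => j /=; rewrite !castmxE /=.
have -> : map_mx intr (qe_rcf_th.ctmat n) =
    map_mx h (map_mx intr (qe_rcf_th.ctmat n)).
  by apply/matrixP => k l; rewrite !mxE rmorph_int.
by rewrite -map_invmx [in RHS]mxE.
Qed.

Lemma map_Coefs n i : mt (qe_rcf.Coefs F n i) = qe_rcf.Coefs G n i.
Proof.
case: n => [|[|n]] /=; congr qe_rcf.Const; first by rewrite rmorph_nat.
  by case: i => [|[|[|i]]] /=; rewrite ?nth_nil ?fmorphV ?rmorph_nat ?rmorph0.
exact: map_coefs.
Qed.

Lemma natural_CcountWeak p sq :
  natural mt (qe_rcf.CcountWeak p sq) (qe_rcf.CcountWeak (mp p) (map mp sq)).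
Proof.
move=> k k' kk'; rewrite /qe_rcf.CcountWeak size_map.
set auxF := (fix aux s i k := match i with 0 => _ | _ => _ end).
set auxG := (fix aux s i k := match i with 0 => _ | _ => _ end).
rewrite -[in RHS]/(mt (qe_rcf.NatConst F 0)).
elim: (3 ^ _)%N (qe_rcf.NatConst F 0) => [|i IHi] s /=; first exact: kk'.
by apply: natural_TaqsR => x; rewrite -map_Coefs; apply: (IHi (qe_rcf.Add _ _)).
Qed.

Lemma map_CcountGt0 sp sq :
  mf (qe_rcf.CcountGt0 sp sq) = qe_rcf.CcountGt0 (map mp sp) (map mp sq).
Proof.
apply: natural_BigRgcd => p; apply: natural_Isnull => -[] /=; last first.
  by apply: natural_CcountWeak.
rewrite -map_BoundingPoly; apply: natural_CcountWeak => cw /=.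
congr (qe_rcf.Or _ (qe_rcf.Or _ _)).
  by elim: sq => //= q sq ->; congr qe_rcf.And; apply: natural_LeadCoef.
elim: sq => //= q sq ->; congr qe_rcf.And.
by apply: natural_Size => n; apply: natural_LeadCoef.
Qed.

Lemma map_abstrX i t : mp (qe_rcf.abstrX i t) = qe_rcf.abstrX i (mt t).
Proof.
elim: t => //= [n|t IHt u IHu|t IHt|t IHt n|t IHt u IHu|t IHt n].
- by case: eqP.
- by rewrite map_AddPoly IHt IHu.
- by rewrite map_OppPoly IHt.
- by rewrite map_NatMulPoly IHt.
- by rewrite map_MulPoly IHt IHu.
- by rewrite map_ExpPoly IHt.
Qed.

Local Notation mgt := (map_term h).
Local Notation mof := (map_formula h).

Lemma map_wproj n s :
  mof (wproj n s) = wproj n (map mgt s.1, map mgt s.2).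
Proof.
rewrite /wproj /qe_rcf.wproj map_qf_formula map_CcountGt0 /= -!map_comp.
by congr (qe_rcf.qfr_to_formula (qe_rcf.CcountGt0 _ _)); apply: eq_map => t /=;
  rewrite map_abstrX map_to_rterm.
Qed.

Definition map_oclause (c : ord.oclause F) : ord.oclause G :=
  let: ord.Oclause a b c d := c in
  ord.Oclause (map mgt a) (map mgt b) (map mgt c) (map mgt d).

Lemma map_and_odnf b1 b2 : map map_oclause (ord.and_odnf b1 b2) =
  ord.and_odnf (map map_oclause b1) (map map_oclause b2).
Proof.
rewrite /ord.and_odnf; elim: b1 => [|c1 b1 IHb]; first by rewrite !big_nil.
rewrite /= !big_cons map_cat IHb -!map_comp; congr (_ ++ _).
by apply: eq_map => c2; case: c1 c2 => ? ? ? ? [? ? ? ?] /=; rewrite !map_cat.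
Qed.

Lemma map_qf_to_odnf f b : map map_oclause (ord.qf_to_odnf f b) =
  ord.qf_to_odnf (mof f) b.
Proof.
elim: f b => //=; try by move=> ? ? [].
- by move=> [] [].
- by move=> ? [].
- by move=> f IHf g IHg [] //; rewrite ?map_and_odnf ?map_cat ?IHf ?IHg.
- by move=> f IHf g IHg [] //; rewrite ?map_and_odnf ?map_cat ?IHf ?IHg.
- by move=> f IHf g IHg [] //; rewrite ?map_and_odnf ?map_cat ?IHf ?IHg.
- by move=> ? ? _ [].
- by move=> ? ? _ [].
Qed.

Lemma map_leq_elim_aux a c d :
  map (fun x => (map mgt x.1, map mgt x.2)) (ord.leq_elim_aux a c d) =
  ord.leq_elim_aux (map mgt a) (map mgt c) (map mgt d).
Proof. by elim: d => //= t d <-; rewrite map_cat -!map_comp. Qed.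

Lemma map_neq_elim_aux c b :
  map (map mgt) (ord.neq_elim_aux c b) =
  ord.neq_elim_aux (map mgt c) (map mgt b).
Proof. by elim: b => //= t b <-; rewrite map_cat -!map_comp. Qed.

Lemma map_oclause_leq_elim c : map map_oclause (ord.oclause_leq_elim c) =
  ord.oclause_leq_elim (map_oclause c).
Proof. by case: c => ? ? ? ? /=; rewrite -map_leq_elim_aux -!map_comp. Qed.

Lemma map_oclause_neq_elim c : map map_oclause (ord.oclause_neq_elim c) =
  ord.oclause_neq_elim (map_oclause c).
Proof. by case: c => ? ? ? ? /=; rewrite -map_neq_elim_aux -!map_comp. Qed.

Lemma map_oclause_to_w c :
  map (fun x => (map mgt x.1, map mgt x.2)) (ord.oclause_to_w c) =
  ord.oclause_to_w (map_oclause c).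
Proof.
rewrite /ord.oclause_to_w /ord.oclause_neq_leq_elim -map_oclause_leq_elim.
have flattenE s : flatten (map (@ord.oclause_neq_elim G) (map map_oclause s)) =
    map map_oclause (flatten (map (@ord.oclause_neq_elim F) s)).
  by elim: s => //= d s ->; rewrite map_cat map_oclause_neq_elim.
rewrite flattenE -!map_comp.
by apply: eq_map => -[].
Qed.

Lemma map_proj n c : mof (ord.proj (@wproj F) n c) =
  ord.proj (@wproj G) n (map_oclause c).
Proof.
rewrite /ord.proj -map_oclause_to_w.
by elim: (ord.oclause_to_w c) => //= w s ->; rewrite map_wproj.
Qed.

Lemma map_quantifier_elim f :
  mof (ord.quantifier_elim (@wproj F) f) =
  ord.quantifier_elim (@wproj G) (mof f).
Proof.
have map_disj n s : mof (foldr (@ord.Or F) (ord.Bool false)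
      (map (ord.proj (@wproj F) n) s)) =
    foldr (@ord.Or G) (ord.Bool false)
      (map (ord.proj (@wproj G) n) (map map_oclause s)).
  by elim: s => //= c s ->; rewrite map_proj.
elim: f => //= [f -> g ->|f -> g ->|f -> g ->|f ->|n f <-|n f IHf] //.
  by rewrite map_disj map_qf_to_odnf.
by rewrite map_disj !map_qf_to_odnf /= IHf.
Qed.

Lemma rcf_morph_le : {mono h : x y / x <= y}.
Proof.
move=> x y; rewrite -subr_ge0 -[RHS]subr_ge0 -rmorphB; move: (y - x) => {x y} z.
have pos t : 0 <= t -> 0 <= h t.
  by move=> t_ge0; rewrite -(sqr_sqrtr t_ge0) rmorphXn sqr_ge0.
have [/pos -> //|z_lt0] := leP 0 z; apply/negbTE; rewrite -ltNge lt_neqAle.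
by rewrite fmorph_eq0 lt_eqF //= -oppr_ge0 -rmorphN pos // oppr_ge0 ltW.
Qed.

Lemma map_eval e t :
  GRing.eval (map h e) (map_term h t) = h (GRing.eval e t).
Proof.
elim: t => //= [i|n|t -> u ->|t ->|t -> n|t -> u ->|t ->|t -> n].
- by rewrite -(nth_map_default h) rmorph0.
- by rewrite rmorph_nat.
- by rewrite rmorphD.
- by rewrite rmorphN.
- by rewrite rmorphMn.
- by rewrite rmorphM.
- by rewrite fmorphV.
- by rewrite rmorphXn.
Qed.

Lemma map_rterm t : GRing.rterm (map_term h t) = GRing.rterm t.
Proof. by elim: t => //= [t -> u ->|t -> u ->]. Qed.

Lemma map_rformula f : ord.rformula (mof f) = ord.rformula f.
Proof.
by elim: f => //= [t u|t u|t u|f -> g ->|f -> g ->|f -> g ->]; rewrite ?map_rterm.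
Qed.

Lemma map_qf_eval e f :
  ord.qf_eval (map h e) (mof f) = ord.qf_eval e f.
Proof.
elim: f => //= [t u|t u|t u|t|f -> g ->|f -> g ->|f -> g ->|f ->] //;
  rewrite !map_eval.
- by rewrite (inj_eq (fmorph_inj h)).
- by rewrite (leW_mono rcf_morph_le).
- by rewrite rcf_morph_le.
- by rewrite !unitfE fmorph_eq0.
Qed.

(** A morphism of real closed fields is elementary: quantifier elimination
    replaces a formula by a quantifier-free one through operations on syntax
    that never inspect the coefficients, so the elimination over F and the one
    over G give the same formula up to h, and h, which preserves nonnegativity
    because nonnegative means square, preserves quantifier-free truth. *)
Theorem rcf_morph_elementary f e : ord.rformula f ->
  ord.holds e f <-> ord.holds (map h e) (mof f).
Proof.
move=> rf; have rhf : ord.rformula (mof f) by rewrite map_rformula.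
have PF := ord.quantifier_elim_rformP (@qe_rcf.wf_QE_wproj F)
  (@qe_rcf.valid_QE_wproj F) e rf.
have PG := ord.quantifier_elim_rformP (@qe_rcf.wf_QE_wproj G)
  (@qe_rcf.valid_QE_wproj G) (map h e) rhf.
rewrite -map_quantifier_elim map_qf_eval in PG.
by split => [/PF/PG|/PG/PF].
Qed.

End Naturality.

(** * Real closed fields from square roots and roots of odd polynomials *)

Lemma irreducible_divisor (F : fieldType) (p : {poly F}) :
  (1 < size p)%N -> exists2 r, irreducible_poly r & r %| p.
Proof.
elim: {p}(size p) {-2}p (leqnn (size p)) => [|n IHn] p; first by case: size.
move=> lepn lt1p; have p0 : p != 0 by rewrite -size_poly_gt0 ltnW.
have [irr|redp] := pselect (irreducible_poly p); first by exists p.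
have [q q1 [dvqp neqp]] : exists2 q : {poly F}, size q != 1 & q %| p /\ ~~ (q %= p).
  apply/not_exists2P => all_q; apply: redp; split=> // q q1 dvqp.
  by apply: contrapT => /negP neq; case: (all_q q) => // -[].
have q0 : q != 0 by apply: contraTneq dvqp => ->; rewrite dvd0p.
have lt1q : (1 < size q)%N by rewrite ltn_neqAle eq_sym q1 size_poly_gt0.
have ltqp : (size q < size p)%N.
  by rewrite ltn_neqAle dvdp_leq // andbT dvdp_size_eqp.
have [r irr dvrq] := IHn q (leq_trans ltqp lepn : (size q <= n)%N) lt1q.
by exists r; rewrite ?(dvdp_trans dvrq).
Qed.

Local Notation "p ^%:A" := (map_poly (in_alg _) p)
  (at level 2, format "p ^%:A") : ring_scope.

Lemma map_polyXsubC (R S : nzRingType) (f : {rmorphism R -> S}) x :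
  map_poly f ('X - x%:P) = 'X - (f x)%:P.
Proof. by rewrite rmorphB /= map_polyX map_polyC. Qed.

(** Roots are adjoined one irreducible factor at a time. *)
Lemma splits_in_extension n (F : fieldType) (p : {poly F}) :
  p != 0 -> (size p <= n)%N ->
  exists (L : fieldExtType F) (zs : seq L),
    p^%:A %= \prod_(z <- zs) ('X - z%:P).
Proof.
elim: n F p => [|n IHn] F p p0 lepn.
  by move: lepn; rewrite leqn0 size_poly_eq0 (negPf p0).
have [lep1|lt1p] := leqP (size p) 1.
  exists F^o, [::]; rewrite big_nil -size_poly_eq1 size_map_poly.
  by rewrite eqn_leq lep1 size_poly_gt0.
have [r irr /dvdpP [s def_p]] := irreducible_divisor lt1p.
have [K _ [x rx _]] := irredp_FAdjoin irr.
have /factor_theorem [q def_q] : root p^%:A x.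
  by rewrite def_p rmorphM rootM rx orbT.
have q0 : q != 0.
  by apply: contraNneq p0 => q0; rewrite -(map_poly_eq0 (in_alg K)) def_q q0 mul0r.
have leqn : (size q <= n)%N.
  rewrite -ltnS (leq_trans _ lepn) // -(size_map_poly (in_alg K)) def_q.
  by rewrite size_mul ?polyXsubC_eq0 // size_XsubC addn2.
have [L [zs def_zs]] := IHn K q q0 leqn.
exists (baseFieldType L), (in_alg L x :: zs).
have -> : map_poly (in_alg (baseFieldType L)) p = (p^%:A : {poly K})^%:A.
  rewrite -map_poly_comp; apply: eq_map_poly => a.
  exact: (baseField_scaleE a 1).
rewrite big_cons def_q rmorphM mulrC /= map_polyXsubC.
exact: (@eqp_mull L _ _ _ def_zs).
Qed.

Definition splitting_pack (F : fieldType) (L : fieldExtType F)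
    (ax : SplittingField.axiom L) : splittingFieldType F :=
  HB.pack_for (splittingFieldType F) (FieldExt.sort L)
    (FieldExt_isSplittingField.Build F L ax).

Lemma splitting_field_exists (F : fieldType) (p : {poly F}) : p != 0 ->
  exists (L : splittingFieldType F) (zs : seq L),
    p^%:A %= \prod_(z <- zs) ('X - z%:P).
Proof.
move=> p0; have [L0 [ys def_ys]] := splits_in_extension p0 (leqnn _).
pose L := subvs_of <<1 & ys>>%AS.
pose up : {lrmorphism L -> L0} := vsval.
pose zs : seq L := map (vsproj _) ys.
have up_zs : map up zs = ys.
  rewrite -map_comp map_id_in // => y ys_y.
  by rewrite /= vsprojK // seqv_sub_adjoin.
have split_p : p^%:A %= \prod_(z <- zs) ('X - z%:P).
  rewrite -(eqp_map up) rmorph_prod -map_poly_comp /=.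
  rewrite (eq_map_poly (g := in_alg L0)) => [|a]; last exact: rmorph_alg.
  suff -> : \prod_(z <- zs) map_poly up ('X - z%:P) =
      \prod_(y <- map up zs) ('X - y%:P) by rewrite up_zs.
  by rewrite big_map; apply: eq_bigr => z _; rewrite map_polyXsubC.
have splitL : SplittingField.axiom L.
  exists p^%:A; first by apply/polyOver1P; exists p.
  exists zs => //; apply/vspaceP => u; rewrite memvf.
  pose upA := linfun_ahom up.
  have : upA u \in (upA @: <<1 & zs>>)%VS.
    rewrite aimg_adjoin_seq aimg1 (eq_map (g := up)); last by move=> z; rewrite lfunE.
    by rewrite up_zs lfunE /= (valP u).
  case/memv_imgP => v zs_v; rewrite !lfunE => /val_inj -> //.
by exists (splitting_pack splitL), zs.
Qed.

Section SquareRootsAndOddRoots.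
Variable R : realFieldType.
Hypothesis sqrtR : forall x : R, 0 <= x -> exists y, x = y ^+ 2.
Hypothesis oddR : forall p : {poly R}, ~~ odd (size p) -> exists x, root p x.

Lemma sqrt_ge0 (x : R) : 0 <= x -> exists2 y, 0 <= y & x = y ^+ 2.
Proof.
move=> /sqrtR [y ->]; exists `|y|; first exact: normr_ge0.
by rewrite real_normK ?num_real.
Qed.

(** The square root of a + b i is obtained from the real square roots of the
    two nonnegative numbers (c + a) / 2 and (c - a) / 2, where c is the modulus
    of a + b i. *)
Lemma complex_sqrt (a b : R) :
  exists x y : R, a = x ^+ 2 - y ^+ 2 /\ b = x * y *+ 2.
Proof.
have [c c0 def_c] : exists2 c, 0 <= c & a ^+ 2 + b ^+ 2 = c ^+ 2.
  by apply: sqrt_ge0; rewrite addr_ge0 ?sqr_ge0.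
have le_ac : `|a| <= c.
  rewrite -(ler_pXn2r (n := 2)) ?nnegrE ?normr_ge0 //.
  by rewrite real_normK ?num_real // -def_c lerDl sqr_ge0.
have [leNca leac] : - c <= a /\ a <= c by apply/andP; rewrite -ler_norml.
have [x x0 def_x] : exists2 x, 0 <= x & (c + a) / 2 = x ^+ 2.
  by apply: sqrt_ge0; lra.
have [y y0 def_y] : exists2 y, 0 <= y & (c - a) / 2 = y ^+ 2.
  by apply: sqrt_ge0; lra.
have def_xy : b ^+ 2 = (x * y *+ 2) ^+ 2.
  rewrite -[x * y *+ 2]mulr_natr !exprMn -def_x -def_y.
  have -> : b ^+ 2 = c ^+ 2 - a ^+ 2 by rewrite -def_c; ring.
  by field.
have def_a : a = x ^+ 2 - y ^+ 2 by rewrite -def_x -def_y; field.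
move/eqP: def_xy; rewrite eqf_sqr => /orP [] /eqP ->.
  by exists x, y.
by exists x, (- y); rewrite sqrrN; split=> //; ring.
Qed.

Lemma odd_degree_trivial (L : fieldExtType R) (z : L) :
  odd (\dim <<1; z>>) -> z \in 1%VS.
Proof.
have -> : \dim <<1; z>> = adjoin_degree 1 z by rewrite adjoin_degreeE dimv1 divn1.
move=> odd_z.
have /polyOver1P [q def_q] := minPolyOver 1 z.
have [] := oddR (p := q).
  by rewrite -(size_map_poly (in_alg L)) -def_q size_minPoly /= negbK.
move=> x /(rmorph_root (in_alg L)); rewrite -def_q -dvdp_XsubCl => dv_min.
have /minPoly_irr := dv_min; rewrite polyOverXsubC memvZ ?mem1v // => /(_ isT).
rewrite -[_ %= 1]size_poly_eq1 size_XsubC orbF => /eqp_size.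
rewrite size_XsubC size_minPoly => deg1.
by rewrite -adjoin_deg_eq1 -eqSS -deg1.
Qed.

(** The argument of Artin and Schreier.  The fixed field of a Sylow 2-subgroup
    of the Galois group has odd degree over R, hence is R; so the Galois group
    is a 2-group.  If its subgroup fixing i were nontrivial it would have a
    subgroup of index two, that is, R(i) would have a quadratic extension,
    although every element of R(i) is a square. *)
Lemma dim_splitting_field (L : splittingFieldType R) (i : L) :
  i ^+ 2 = -1 -> (\dim {:L} <= 2)%N.
Proof.
move=> i2.
have sepL (K E : {subfield L}) : separable K E.
  apply/separableP => u _; apply: pcharf0_separable => p.
  by rewrite pchar_lalg pchar_num.
have galL (K : {subfield L}) : galois K {:L}.
  have [p p1 splitp] := @splittingFieldP _ L.
  rewrite /galois subvf sepL /=; apply/splitting_normalField; first exact: subvf.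
  exists p; first exact: polyOverSv (sub1v K) _ p1.
  exact: splittingFieldForS (sub1v K) (subvf _) splitp.
have dim_1 (E : {subfield L}) : \dim E = \dim_(1%AS : {subfield L}) E.
  by rewrite dimv1 divn1.
have pG : (2.-group 'Gal({:L} / 1))%g.
  have [P sylP] := Sylow_exists 2 'Gal({:L} / 1)%G.
  have sPG : P \subset 'Gal({:L} / 1)%G := pHall_sub sylP.
  have odd_E : odd #|'Gal({:L} / 1)%G : P|%g by rewrite odd_2'nat; case/and3P: sylP.
  rewrite -(dim_fixed_galois (galL 1%AS) sPG) -dim_1 in odd_E.
  have defE := eq_adjoin_separable_generator (sepL 1%AS (fixedField P)) (sub1v _).
  rewrite /= defE in odd_E.
  move/odd_degree_trivial/Fadjoin_idP: odd_E; rewrite -defE => E1.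
  rewrite -(gal_fixedField P) E1 in sylP.
  exact: pHall_pgroup sylP.
have sizeX2_1 (S : nzRingType) : size ('X^2 + 1 : {poly S}) = 3%N.
  by rewrite -polyC1 size_XnaddC.
pose K := <<1; i>>%AS.
have degK : (\dim K <= 2)%N.
  rewrite dim_1 -adjoin_degreeE -ltnS -size_minPoly.
  rewrite -(sizeX2_1 L); apply: dvdp_leq; first by rewrite -size_poly_eq0 sizeX2_1.
  apply: minPoly_dvdp; first by rewrite rpredD ?rpred1 ?rpredX ?polyOverX.
  by rewrite rootE !hornerE i2 addNr.
have sqrtK k : k \in K -> exists2 s, s \in K & k = s ^+ 2.
  case/Fadjoin1_polyP => p def_k.
  have [a [b def_ab]] : exists a b : R, k = a%:A + b%:A * i.
    have m1 : ('X^2 + 1 : {poly R}) != 0 by rewrite -size_poly_eq0 sizeX2_1.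
    have := ltn_modp p ('X^2 + 1); rewrite m1 sizeX2_1 ltnS => le_r.
    exists (p %% ('X^2 + 1))`_0, (p %% ('X^2 + 1))`_1.
    rewrite def_k [in LHS](divp_eq p ('X^2 + 1)) rmorphD rmorphM /= !hornerE.
    rewrite [map_poly _ ('X^2 + 1)]rmorphD /= map_polyXn rmorph1 !hornerE i2.
    rewrite addNr mulr0 add0r (@horner_coef_wide _ 2) ?size_map_poly //.
    by rewrite !big_ord_recl big_ord0 !coef_map /= mulr1 addr0.
  have [x [y [def_a def_b]]] := complex_sqrt a b.
  exists (x%:A + y%:A * i).
    by rewrite rpredD ?rpredM ?memv_adjoin // subvP_adjoin ?rpredZ ?rpred1.
  rewrite def_ab def_a def_b -[(_ - _)%:A]/(in_alg L _).
  rewrite -[(x * y *+ 2)%:A]/(in_alg L _) rmorphB !rmorphXn rmorphMn /=.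
  rewrite -[(x * y)%:A]/(in_alg L _) rmorphM /=.
  move: (x%:A) (y%:A) => X Y; rewrite sqrrD exprMn i2 mulrN1 mulrnAl.
  by rewrite addrAC mulrA.
have [H1|[M maxM _]] := maximal_exists (sub1G 'Gal({:L} / K)%G).
  have := galois_dim (galL K); rewrite /= -H1 cards1 => dimLK.
  have -> : \dim {:L} = (\dim_K {:L} * \dim K)%N.
    by rewrite divnK ?field_dimS ?subvf.
  by rewrite dimLK mul1n.
have sHG : 'Gal({:L} / K)%G \subset 'Gal({:L} / 1)%G by apply/galS/sub1v.
have := p_maximal_index (pgroupS sHG pG) maxM.
rewrite -(dim_fixed_galois (galL K) (proper_sub (maxgroupp maxM))).
set E := fixedField M => dimE; exfalso.
have sKE : (K <= E)%VS.
  by rewrite -galois_connection ?subvf // proper_sub // (maxgroupp maxM).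
have [w Ew K'w] : exists2 w, w \in E & w \notin K.
  apply/subvPn; apply: contra_eqN dimE => sEK.
  by have -> : E = K :> {vspace L}; [apply/eqP; rewrite eqEsubv sEK|
     rewrite divnn adim_gt0].
have deg_w : adjoin_degree K w = 2%N.
  apply/eqP; rewrite eqn_leq; apply/andP; split.
    by rewrite adjoin_degreeE -dimE leq_div2r // dimvS //; apply/FadjoinP.
  by rewrite ltn_neqAle eq_sym adjoin_deg_eq1 K'w.
have [p [Kp pw]] : exists p : {poly L}, p \is a polyOver K /\
    w ^+ 2 + p`_1 * w + p`_0 = 0.
  exists (minPoly K w); split; first exact: minPolyOver.
  have := root_minPoly K w; rewrite rootE horner_coef size_minPoly deg_w.
  rewrite !big_ord_recl big_ord0 /= expr0 expr1 mulr1 addr0 /bump /= => /eqP pw0.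
  have /monicP := monic_minPoly K w; rewrite lead_coefE size_minPoly deg_w.
  by move=> lead1; rewrite lead1 in pw0; rewrite -[RHS]pw0; ring.
have n2 : 2 != 0 :> L by rewrite -(rmorph_nat (in_alg L)) fmorph_eq0 pnatr_eq0.
have Kp_ j : p`_j \in K by apply/polyOverP.
have K2 : 2 \in K by rewrite rpred_nat.
have [|s Ks def_s] := sqrtK ((p`_1 / 2) ^+ 2 - p`_0).
  by rewrite rpredB ?rpredX ?rpred_div.
have : (w + p`_1 / 2) ^+ 2 == s ^+ 2.
  rewrite -def_s -subr_eq0; apply/eqP; rewrite -[RHS]pw.
  by field.
rewrite eqf_sqr => sqr_w; case/negP: K'w.
rewrite -[w](addrK (p`_1 / 2)); case/orP: sqr_w => /eqP ->.
  by rewrite rpredB ?rpred_div.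
by rewrite rpredB ?rpredN ?rpred_div.
Qed.

Lemma factor_of_size_le3 (p : {poly R}) :
  (1 < size p)%N -> exists2 q, q %| p & (1 < size q <= 3)%N.
Proof.
move=> lt1p; have p0 : p != 0 by rewrite -size_poly_gt0 ltnW.
have m1 : ('X^2 + 1 : {poly R}) != 0.
  by rewrite -size_poly_eq0 -polyC1 size_XnaddC.
have [L [zs split_p]] := splitting_field_exists (mulf_neq0 m1 p0).
have root_in (q : {poly R}) : (1 < size q)%N -> q %| ('X^2 + 1) * p ->
    exists z : L, root q^%:A z.
  move=> lt1q dvq; have : q^%:A %| \prod_(z <- zs) ('X - z%:P).
    by rewrite -(eqp_dvdr _ split_p) dvdp_map.
  case/dvdp_prod_XsubC => m qm; have : (1 < size (map_poly (in_alg L) q))%N by rewrite size_map_poly.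
  rewrite (eqp_size qm) size_prod_XsubC; case: (mask m zs) qm => // z s qm _.
  by exists z; rewrite (eqp_root qm) root_prod_XsubC mem_head.
have [i i2] : exists i : L, i ^+ 2 = -1.
  have [||i] := root_in ('X^2 + 1); rewrite ?dvdp_mulr //.
    by rewrite -polyC1 size_XnaddC.
  rewrite rmorphD /= map_polyXn rmorph1 rootE !hornerE addr_eq0 => /eqP.
  by exists i.
have [z pz] := root_in p lt1p (dvdp_mull _ (dvdpp _)).
have /polyOver1P [q def_q] := minPolyOver 1 z.
exists q; first by rewrite -(dvdp_map (in_alg L)) -def_q minPoly_dvdp ?alg_polyOver.
rewrite -(size_map_poly (in_alg L)) -def_q size_minPoly.
rewrite adjoin_degreeE dimv1 divn1 !ltnS adim_gt0 /=.
exact: leq_trans (dimvS (subvf _)) (dim_splitting_field i2).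
Qed.

(** Divide p by a factor q of degree one or two: if q has its roots outside
    the interval, or none, its sign is constant there, and the quotient or its
    opposite still changes sign. *)
Lemma real_closed_poly : Num.real_closed_axiom R.
Proof.
move=> p; elim: {p}(size p) {-2}p (leqnn (size p)) => [|n IHn] p lepn a b leab.
  move: lepn; rewrite leqn0 size_poly_eq0 => /eqP -> _.
  by exists a; rewrite ?lexx // root0.
case/andP=> pa pb; have [le1p|lt1p] := leqP (size p) 1.
  exists a; rewrite ?lexx //; move: pa pb; rewrite (size1_polyC le1p) !hornerC.
  by move=> c0 c1; rewrite rootC; apply/eqP; lra.
have p0 : p != 0 by rewrite -size_poly_gt0 ltnW.
have [q dvq /andP [lt1q leq3]] := factor_of_size_le3 lt1p.
have reduce (r s : {poly R}) : p = r * s -> (1 < size s)%N ->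
    (forall x, a <= x <= b -> 0 < s.[x]) \/ (forall x, a <= x <= b -> s.[x] < 0) ->
    exists2 x, a <= x <= b & root p x.
  move=> def_p lt1s sgn_s.
  have r0 : r != 0 by apply: contraNneq p0 => r0; rewrite def_p r0 mul0r.
  have s0 : s != 0 by rewrite -size_poly_gt0 ltnW.
  have ler_n : (size r <= n)%N.
    rewrite -ltnS (leq_trans _ lepn) // def_p size_mul // -subn1.
    by case: (size s) lt1s => [|[|k]] // _; rewrite !addnS subn1 /= ltnS leq_addr.
  have ha : a <= a <= b by rewrite lexx.
  have hb : a <= b <= b by rewrite lexx andbT.
  move: pa pb; rewrite def_p !hornerM => pa pb.
  case: sgn_s => sgn_s; have sa := sgn_s _ ha; have sb := sgn_s _ hb.
    rewrite pmulr_lle0 // in pa; rewrite pmulr_lge0 // in pb.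
    have [|x ab rx] := IHn r ler_n a b leab; first by rewrite pa.
    by exists x; rewrite // rootM rx.
  rewrite nmulr_lle0 // in pa; rewrite nmulr_lge0 // in pb.
  have [||x ab rx] := IHn (- r) _ a b leab; first by rewrite size_polyN.
    by rewrite !hornerN oppr_le0 oppr_ge0 pa.
  by exists x; rewrite // rootM -rootN rx.
have linear c : root p c -> exists2 x, a <= x <= b & root p x.
  case/factor_theorem => r def_p; have [ab|] := boolP (a <= c <= b).
    by exists c; rewrite // def_p rootM root_XsubC eqxx orbT.
  rewrite negb_and -!ltNge => out; apply: reduce def_p _ _.
    by rewrite size_XsubC.
  case/orP: out => c_out; [left|right] => x /andP [ax xb]; rewrite !hornerE; lra.
have [r def_p] := dvdpP _ _ dvq.
have [odd_q|] := boolP (odd (size q)); last first.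
  case/oddR => c qc; apply: (linear c); by rewrite def_p rootM qc orbT.
have size_q : size q = 3%N by move: (size q) lt1q leq3 odd_q => [|[|[|[|]]]].
have [u [v [w [w0 def_q]]]] : exists u v w : R, w != 0 /\
    forall x, q.[x] = w * ((x - u) ^+ 2 + v).
  have w0 : q`_2 != 0.
    by rewrite -[2%N]/(3.-1) -size_q -lead_coefE lead_coef_eq0 -size_poly_eq0 size_q.
  exists (- (q`_1 / (2 * q`_2))), (q`_0 / q`_2 - (q`_1 / (2 * q`_2)) ^+ 2), q`_2.
  split=> // x; rewrite horner_coef size_q !big_ord_recl big_ord0 /= /bump /=.
  by field.
have [v0|v0] := leP v 0.
  have [|s def_s] := @sqrtR (- v); first by rewrite oppr_ge0.
  apply: (linear (u + s)); rewrite def_p rootM /root def_q.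
  by rewrite [u + s]addrC addrK -def_s addNr mulr0 eqxx orbT.
apply: reduce def_p lt1q _; have [w_neg|w_pos|] := ltrgt0P w; last first.
- by move/eqP: w0.
- right=> x _; rewrite def_q nmulr_rlt0 //; apply: ltr_wpDl => //.
  exact: sqr_ge0.
- left=> x _; rewrite def_q pmulr_rgt0 //; apply: ltr_wpDl => //.
  exact: sqr_ge0.
Qed.

End SquareRootsAndOddRoots.

Section OrderBySquares.
Variable F : fieldType.
Hypothesis realF : forall n (x : 'I_n -> F), \sum_i x i ^+ 2 <> -1.
Hypothesis squareF : forall x : F, exists y, x = y ^+ 2 \/ x = - y ^+ 2.
Hypothesis oddF : forall n (c : 'I_n.*2.+1 -> F),
  exists x, x ^+ n.*2.+1 + \sum_i c i * x ^+ i = 0.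

Definition is_square (x : F) := `[< exists y, x = y ^+ 2 >].

Lemma square_total x : is_square x || is_square (- x).
Proof.
have [y [->|->]] := squareF x; apply/orP; [left|right]; apply/asboolP; exists y => //.
by rewrite opprK.
Qed.

Lemma square_anti x : is_square x -> is_square (- x) -> x = 0.
Proof.
move=> /asboolP [y ->] /asboolP [z def_z]; have [z0|z0] := eqVneq z 0.
  by apply: oppr_inj; rewrite def_z z0 expr0n oppr0.
case: (realF (n := 1) (x := fun _ => y / z)).
by rewrite big_ord1 expr_div_n -[y ^+ 2]opprK def_z mulNr divff ?expf_neq0.
Qed.

Lemma squareD x y : is_square x -> is_square y -> is_square (x + y).
Proof.
move=> /asboolP [u ->] /asboolP [v ->].
have [w [->|def_w]] := squareF (u ^+ 2 + v ^+ 2); first by apply/asboolP; exists w.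
have [w0|w0] := eqVneq w 0; first by apply/asboolP; exists 0; rewrite def_w w0 expr0n oppr0.
case: (realF (n := 2) (x := fun i => if i == ord0 then u / w else v / w)).
rewrite !big_ord_recl big_ord0 /= addr0 !expr_div_n -mulrDl def_w mulNr.
by rewrite divff ?expf_neq0.
Qed.

Lemma squareM x y : is_square x -> is_square y -> is_square (x * y).
Proof.
by move=> /asboolP [u ->] /asboolP [v ->]; apply/asboolP; exists (u * v); rewrite exprMn.
Qed.

Let le x y := is_square (y - x).
Let lt x y := (y != x) && le x y.
Let norm x := if is_square x then x else - x.

Let le0_add x y : le 0 x -> le 0 y -> le 0 (x + y).
Proof. by rewrite /le !subr0; apply: squareD. Qed.

Let le0_mul x y : le 0 x -> le 0 y -> le 0 (x * y).
Proof. by rewrite /le !subr0; apply: squareM. Qed.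

Let le0_anti x : le 0 x -> le x 0 -> x = 0.
Proof. by rewrite /le subr0 sub0r; apply: square_anti. Qed.

Let sub_ge0 x y : le 0 (y - x) = le x y.
Proof. by rewrite /le subr0. Qed.

Let le0_total x : le 0 x || le x 0.
Proof. by rewrite /le subr0 sub0r square_total. Qed.

Let normN x : norm (- x) = norm x.
Proof.
rewrite /norm opprK; have := square_total x.
case: ifPn => [sqNx|_]; case: ifPn => // sqx _.
by rewrite (square_anti sqx sqNx) oppr0.
Qed.

Let ge0_norm x : le 0 x -> norm x = x.
Proof. by rewrite /le subr0 /norm => ->. Qed.

Let lt_def x y : lt x y = (y != x) && le x y. Proof. by []. Qed.

Definition ordered_by_squares : realFieldType :=
  HB.pack_for realFieldType (GRing.Field.sort F)
    (Num.IntegralDomain_isLeReal.Build F le0_add le0_mul le0_anti sub_ge0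
       le0_total normN ge0_norm lt_def).

Let R := ordered_by_squares.

Let sqrtR (x : R) : 0 <= x -> exists y, x = y ^+ 2.
Proof. by move/asboolP; rewrite subr0. Qed.

Let oddR (p : {poly R}) : ~~ odd (size p) -> exists x, root p x.
Proof.
have [-> _|p0] := eqVneq p 0; first by exists 0; apply: root0.
move=> even_p; have [n size_p] : exists n, size p = n.*2.+2.
  exists (size p)./2.-1; rewrite -[LHS]odd_double_half (negPf even_p) add0n.
  by rewrite -doubleS prednK // half_gt0; case: (size p) p0 even_p (size_poly_eq0 p)
    => [|[|s]] //; case: eqP.
pose l := lead_coef p; have l0 : l != 0 by rewrite lead_coef_eq0.
have [x px] := oddF (fun i : 'I_n.*2.+1 => (p`_i / l : F)).
exists x; rewrite rootE horner_coef size_p big_ord_recr /=.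
have -> : p`_(n.*2.+1) = l by rewrite /l lead_coefE size_p.
rewrite addrC; apply/eqP/(mulfI (invr_neq0 l0)); rewrite mulr0 -[RHS]px.
rewrite mulrDr mulKf // mulr_sumr; congr (_ + _).
by apply: eq_bigr => i _; rewrite mulrA [l^-1 * _]mulrC.
Qed.

Definition rcf_by_squares : rcfType :=
  HB.pack_for rcfType (Num.RealField.sort R)
    (Num.RealField_isClosed.Build R (real_closed_poly sqrtR oddR)).

(** Calling the squares nonnegative gives an ordering: a sum of two squares is a
    square, for if it were the opposite of one, -1 would be a sum of squares.
    The intermediate value property is then [real_closed_poly]. *)
Lemma real_closed_field :
  exists (R : rcfType) (g : {rmorphism R -> F}), bijective g.
Proof.
have idA : zmod_morphism (fun x : rcf_by_squares => x : F) by [].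
have idM : monoid_morphism (fun x : rcf_by_squares => x : F) by [].
pose g : {rmorphism rcf_by_squares -> F} := HB.pack (fun x : rcf_by_squares => x : F)
  (GRing.isZmodMorphism.Build _ _ _ idA) (GRing.isMonoidMorphism.Build _ _ _ idM).
by exists rcf_by_squares, g; exists id.
Qed.

End OrderBySquares.

(** * Bases over a subfield *)

Section Basis.
Variables (K : fieldType) (A : nzRingType) (k : {rmorphism K -> A}).
Variables (m : nat).

Definition is_basis (a : 'I_m -> A) (c : A -> 'rV[K]_m) : Prop :=
  (forall x, x = \sum_i k (c x 0 i) * a i) /\
  (forall r : 'rV_m, c (\sum_i k (r 0 i) * a i) = r).

Variables (a : 'I_m -> A) (c : A -> 'rV[K]_m).
Hypothesis basis_a : is_basis a c.

Lemma basisE x : x = \sum_i k (c x 0 i) * a i.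
Proof. by case: basis_a. Qed.

Lemma coord_sum (r : 'I_m -> K) : c (\sum_i k (r i) * a i) = \row_i r i.
Proof.
rewrite -[RHS](basis_a.2); congr c.
by apply: eq_bigr => i _; rewrite mxE.
Qed.

Lemma coordD x y : c (x + y) = c x + c y.
Proof.
rewrite [in LHS](basisE x) [in LHS](basisE y) -big_split /=.
under eq_bigr do rewrite -mulrDl -rmorphD.
by rewrite coord_sum; apply/rowP => i; rewrite !mxE.
Qed.

Lemma coordZ l x : c (k l * x) = l *: c x.
Proof.
rewrite [in LHS](basisE x) mulr_sumr.
under eq_bigr do rewrite mulrA -rmorphM.
by rewrite coord_sum; apply/rowP => i; rewrite !mxE.
Qed.

Lemma coord0 : c 0 = 0.
Proof. by apply: (addrI (c 0)); rewrite -coordD !addr0. Qed.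

Lemma coord_inj : injective c.
Proof. by move=> x y cxy; rewrite (basisE x) (basisE y) cxy. Qed.

Lemma coord_bij : bijective c.
Proof.
exists (fun r : 'rV_m => \sum_i k (r 0 i) * a i); last exact: basis_a.2.
by move=> x; rewrite -basisE.
Qed.

Lemma coord_sumE (I : finType) (F : I -> A) : c (\sum_i F i) = \sum_i c (F i).
Proof. by elim/big_rec2: _ => [|i y x _ <-]; rewrite ?coord0 ?coordD. Qed.

Lemma coord_basis i : c (a i) = delta_mx 0 i.
Proof.
rewrite -[RHS]basis_a.2; congr c; rewrite (bigD1 i) //= big1 => [|j neq_ji].
  by rewrite mxE !eqxx rmorph1 mul1r addr0.
by rewrite mxE (negPf neq_ji) andbF rmorph0 mul0r.
Qed.

Lemma basis_free (r : 'I_m -> K) : \sum_i k (r i) * a i = 0 -> forall i, r i = 0.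
Proof.
move=> r0 i; have := coord_sum r; rewrite r0 coord0 => /rowP /(_ i).
by rewrite !mxE.
Qed.

Lemma coord_linear (p : nat) (t : A -> A) (d : A -> 'rV[K]_p) :
  {morph t : x y / x + y} -> (forall l x, t (k l * x) = k l * t x) ->
  {morph d : x y / x + y} -> (forall l x, d (k l * x) = l *: d x) ->
  forall x, d (t x) = c x *m \matrix_i d (t (a i)).
Proof.
move=> tD tZ dD dZ x.
have dt0 : d (t 0) = 0 by apply: (addrI (d (t 0))); rewrite -dD -tD !addr0.
rewrite {1}(basisE x) mulmx_sum_row.
have -> : d (t (\sum_i k (c x 0 i) * a i)) = \sum_i d (t (k (c x 0 i) * a i)).
  by elim/big_rec2: _ => [//|i y z _ <-]; rewrite tD dD.
by apply: eq_bigr => i _; rewrite tZ dZ rowK.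
Qed.

End Basis.

(** The square matrix of b in the basis a has a trivial left kernel, hence is
    invertible. *)
Lemma free_is_basis (K : fieldType) (A : nzRingType) (k : {rmorphism K -> A}) m
    (a : 'I_m -> A) c (b : 'I_m -> A) :
  is_basis k a c ->
  (forall r : 'I_m -> K, \sum_i k (r i) * b i = 0 -> forall i, r i = 0) ->
  exists d, is_basis k b d.
Proof.
move=> basis_a free_b; pose P := \matrix_i c (b i).
have coord_b (r : 'rV_m) : c (\sum_i k (r 0 i) * b i) = r *m P.
  rewrite (coord_sumE basis_a) mulmx_sum_row; apply: eq_bigr => i _.
  by rewrite (coordZ basis_a) rowK.
have P_unit : P \in unitmx.
  rewrite -row_free_unit -kermx_eq0; apply/eqP/row_matrixP => i.
  have : row i (kermx P) *m P = 0 by rewrite -row_mul mulmx_ker row0.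
  move: (row i _) => r; rewrite -coord_b -(coord0 basis_a).
  move/(coord_inj basis_a)/free_b => r0; rewrite row0.
  by apply/rowP => j; rewrite r0 mxE.
exists (fun x => c x *m invmx P); split=> [x|r].
  by apply: (coord_inj basis_a); rewrite coord_b mulmxKV.
by rewrite coord_b mulmxK.
Qed.

Lemma basis_of_free_span (K : fieldType) (A : nzRingType)
    (k : {rmorphism K -> A}) m (a : 'I_m -> A) :
  (forall x, exists r : 'I_m -> K, x = \sum_i k (r i) * a i) ->
  (forall r : 'I_m -> K, \sum_i k (r i) * a i = 0 -> forall i, r i = 0) ->
  exists c, is_basis k a c.
Proof.
move=> span_a free_a.
have coordP x : exists r : 'rV_m, x = \sum_i k (r 0 i) * a i.
  have [r ->] := span_a x; exists (\row_i r i).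
  by apply: eq_bigr => i _; rewrite mxE.
have [c def_c] := boolp.choice coordP.
exists c; split=> // r; apply/rowP => i.
apply/eqP; rewrite -subr_eq0; apply/eqP; move: i; apply: free_a.
under eq_bigr do rewrite rmorphB mulrBl.
by rewrite sumrB -def_c subrr.
Qed.

(** A spanning family of least size is free: a relation in which the coefficient
    of b j is not zero expresses b j through the others. *)
Lemma basis_of_span (K : fieldType) (A : nzRingType) (k : {rmorphism K -> A}) m
    (a : 'I_m -> A) :
  (forall x, exists r : 'I_m -> K, x = \sum_i k (r i) * a i) ->
  exists n (b : 'I_n -> A) c, is_basis k b c.
Proof.
pose spans n (b : 'I_n -> A) :=
  forall x, exists r : 'I_n -> K, x = \sum_i k (r i) * b i.
pose Q n := `[< exists b : 'I_n -> A, spans n b >].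
move=> span_a; have exQ : exists n, Q n by exists m; apply/asboolP; exists a.
have [n /asboolP [b span_b] n_min] := ex_minnP exQ.
have [r r0 j|c basis_b] := basis_of_free_span span_b; last by exists n, b, c.
apply: contrapT => /eqP rj0; case: n => [|n] in b span_b n_min r r0 j rj0 *.
  by case: j rj0.
suff : Q n by move/n_min; rewrite ltnn.
apply/asboolP; exists (b \o lift j) => x; have [s ->] := span_b x.
rewrite (bigD1_ord j) //=.
have -> : b j = \sum_i k (- (r (lift j i) / r j)) * b (lift j i).
  move: r0; rewrite (bigD1_ord j) //= => /eqP; rewrite addr_eq0 => /eqP r0.
  rewrite -[LHS]mul1r -(rmorph1 k) -(mulVf rj0) rmorphM -mulrA r0 mulrN mulr_sumr.
  rewrite -sumrN; apply: eq_bigr => i _.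
  by rewrite mulrA -rmorphM -mulNr -rmorphN [_^-1 * _]mulrC.
exists (fun i => s (lift j i) - s j * (r (lift j i) / r j)).
rewrite addrC mulr_sumr -big_split /=; apply: eq_bigr => i _.
by rewrite mulrA -rmorphM -mulrDl -rmorphD mulrN.
Qed.

(** * Simplicity of regular rings of finite dimension *)

Section Simple.
Variables (K : fieldType) (A : nzRingType) (k : {rmorphism K -> A}).
Variables (m : nat) (a : 'I_m -> A) (c : A -> 'rV[K]_m).
Hypothesis basis_a : is_basis k a c.
Hypothesis regular : forall x : A, exists y, x * y * x = x.
Hypothesis central_idem : forall e : A,
  (forall x, e * x = x * e) -> e * e = e -> e != 0 -> e = 1.

Variable I : A -> Prop.
Hypothesis ideal_add : forall x y, I x -> I y -> I (x + y).
Hypothesis ideal_mull : forall p x, I x -> I (p * x).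
Hypothesis ideal_mulr : forall p x, I x -> I (x * p).

Let rmx e := \matrix_i c (a i * e).

Let rmxE e x : c (x * e) = c x *m rmx e.
Proof.
apply: (coord_linear basis_a (t := fun x => x * e)).
- by move=> y z; rewrite mulrDl.
- by move=> l y; rewrite mulrA.
- exact: coordD basis_a.
- exact: coordZ basis_a.
Qed.

(** If x is in I but not in A e, regularity yields an idempotent of I orthogonal
    to e, and adding it to e strictly enlarges the left ideal A e. *)
Let ideal_idem_extend e x : I e -> e * e = e -> I x -> x * e != x ->
  exists e', [/\ I e', e' * e' = e' & (\rank (rmx e) < \rank (rmx e'))%N].
Proof.
move=> Ie ee Ix xe; pose y := x - x * e.
have y0 : y != 0 by rewrite subr_eq0 eq_sym.
have ye : y * e = 0 by rewrite mulrBl -mulrA ee subrr.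
have Iy : I y by apply: ideal_add; rewrite // -mulrN; apply: ideal_mulr.
have [f [If ff fe yf]] : exists f, [/\ I f, f * f = f, f * e = 0 & y * f = y].
  have [z yzy] := regular y; exists (z * y); split.
  - exact: ideal_mull.
  - by rewrite -mulrA (mulrA y) yzy.
  - by rewrite -mulrA ye mulr0.
  - by rewrite mulrA.
have [g [Ig gg ge eg yg]] : exists g,
    [/\ I g, g * g = g, g * e = 0, e * g = 0 & y * g = y].
  exists (f - e * f).
  have ge : (f - e * f) * e = 0 by rewrite mulrBl -mulrA fe mulr0 subrr.
  split=> //.
  - by apply: ideal_add => //; rewrite -mulNr; apply: ideal_mull.
  - by rewrite {2}[f - _]/(f - e * f) mulrBr mulrA ge mul0r subr0 mulrBl -mulrA ff.
  - by rewrite mulrBr mulrA ee subrr.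
  - by rewrite mulrBr mulrA ye mul0r subr0.
have g0 : g != 0 by apply: contraNneq y0 => g0; rewrite -yg g0 mulr0.
exists (e + g); split; first exact: ideal_add.
  by rewrite mulrDl !mulrDr ee eg ge gg addr0 add0r.
have sub : (rmx e <= rmx (e + g))%MS.
  suff -> : rmx e = rmx e *m rmx (e + g) by apply: submxMl.
  apply/row_matrixP => i; rewrite row_mul !rowK -rmxE; congr c.
  by rewrite -mulrA mulrDr ee eg addr0.
rewrite ltn_neqAle mxrankS // andbT; apply: contraNneq g0 => eq_rk.
have : (rmx e == rmx (e + g))%MS by rewrite -(mxrank_leqif_eq sub) eq_rk.
case/andP => _ /submxP [D def_D]; have /(coord_inj basis_a) : c ((e + g) * e) = c (e + g).
  rewrite !rmxE -[c (e + g)]mul1mx; have -> : e + g = 1 * (e + g) by rewrite mul1r.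
  rewrite rmxE def_D mul1mx -!mulmxA; congr (_ *m (_ *m _)).
  by apply/row_matrixP => i; rewrite row_mul !rowK -rmxE -mulrA ee.
rewrite mulrDl ee ge addr0 => def_e; apply/eqP/(addrI e).
by rewrite addr0 -def_e.
Qed.

(** An idempotent e of I with A e as large as possible is a right unit of I.
    It is central: y = (1 - e) x e is killed by e on the left, and y z y = y with
    y z = y z e gives y = 0.  So e is 1. *)
Lemma regular_ideal_full b : I b -> b != 0 -> I 1.
Proof.
move=> Ib b0; have I0 : I 0 by rewrite -(mul0r b); apply: ideal_mull.
have [e [Ie ee right_unit]] : exists e, [/\ I e, e * e = e & forall x, I x -> x * e = x].
  suff [e [Ie ee e_max]] : exists e, [/\ I e, e * e = e & forall e', I e' ->
      e' * e' = e' -> (\rank (rmx e') <= \rank (rmx e))%N].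
    exists e; split=> // x Ix; apply/eqP/negP => /negP xe.
    have [e' [Ie' ee' lt_e]] := ideal_idem_extend Ie ee Ix xe.
    by have := e_max e' Ie' ee'; rewrite leqNgt lt_e.
  pose Q n := `[< exists e, [/\ I e, e * e = e & \rank (rmx e) = n] >].
  have exQ : exists n, Q n by exists (\rank (rmx 0)); apply/asboolP; exists 0; rewrite mul0r.
  have ubQ n : Q n -> (n <= m)%N by case/asboolP=> e [_ _ <-]; apply: rank_leq_row.
  have [n /asboolP [e [Ie ee def_n]] n_max] := ex_maxnP exQ ubQ.
  exists e; split=> // e' Ie' ee'; rewrite def_n; apply: n_max.
  by apply/asboolP; exists e'.
suff <- : e = 1 by [].
apply: central_idem => // [x|]; last first.
  by apply: contraNneq b0 => e0; rewrite -(right_unit b Ib) e0 mulr0.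
rewrite -(right_unit (e * x)); last exact: ideal_mulr.
pose y := x * e - e * x * e; suff /eqP : y = 0 by rewrite subr_eq0 => /eqP <-.
have Iy : I y.
  by apply: ideal_add; [apply: ideal_mull|rewrite -mulNr; apply: ideal_mull].
have ey : e * y = 0 by rewrite mulrBr !mulrA ee subrr.
have [z yzy] := regular y.
rewrite -yzy -(right_unit (y * z)); last exact: ideal_mulr.
by rewrite -mulrA ey mulr0.
Qed.

End Simple.

(** * Density *)

Section Density.
Variables (K L : fieldType) (A B : nzRingType).
Variables (kA : {rmorphism K -> A}) (kB : {rmorphism L -> B}).
Variables (iota : {rmorphism A -> B}).

(** A pair consists of the two maps defined by one expression on A and on B.
    The parameters of the expression come from A, and this makes the map on B
    linear over L. *)
Inductive operator (S : (A -> A) -> (B -> B) -> Prop) :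
    (A -> A) -> (B -> B) -> Prop :=
| operator_id : operator S id id
| operator_mull p t t' : operator S t t' ->
    operator S (fun x => p * t x) (fun y => iota p * t' y)
| operator_mulr p t t' : operator S t t' ->
    operator S (fun x => t x * p) (fun y => t' y * iota p)
| operator_add t t' s s' : operator S t t' -> operator S s s' ->
    operator S (fun x => t x + s x) (fun y => t' y + s' y)
| operator_ext s s' t t' : S s s' -> operator S t t' ->
    operator S (fun x => s (t x)) (fun y => s' (t' y)).

Variable S : (A -> A) -> (B -> B) -> Prop.
Hypothesis kB_central : forall l y, kB l * y = y * kB l.
Hypothesis S_add : forall s s', S s s' -> {morph s : x y / x + y}.
Hypothesis S_add' : forall s s', S s s' -> {morph s' : x y / x + y}.
Hypothesis S_lin' : forall s s' l y, S s s' -> s' (kB l * y) = kB l * s' y.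
Hypothesis S_iota : forall s s' x, S s s' -> s' (iota x) = iota (s x).

Lemma operator_comp s s' t t' : operator S s s' -> operator S t t' ->
  operator S (fun x => s (t x)) (fun y => s' (t' y)).
Proof.
move=> op_s op_t; elim: op_s => {s s'} [//|p s s' _ IH|p s s' _ IH|
  s s' r r' _ IHs _ IHr|s s' r r' Ss _ IH].
- exact: (operator_mull p IH).
- exact: (operator_mulr p IH).
- exact: (operator_add IHs IHr).
- exact: (operator_ext Ss IH).
Qed.

Lemma operator_sub t t' s s' : operator S t t' -> operator S s s' ->
  operator S (fun x => t x + (-1) * s x) (fun y => t' y + iota (-1) * s' y).
Proof. by move=> op_t op_s; apply: operator_add => //; apply: operator_mull. Qed.

Lemma operatorD t t' : operator S t t' -> {morph t : x y / x + y}.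
Proof.
elim=> {t t'} [//|p t t' _ IH|p t t' _ IH|t t' s s' _ IHt _ IHs|s s' t t' Ss _ IH]
  x y; rewrite ?IH ?mulrDr ?mulrDl //.
  by rewrite IHt IHs addrACA.
exact: S_add Ss _ _.
Qed.

Lemma operatorD' t t' : operator S t t' -> {morph t' : x y / x + y}.
Proof.
elim=> {t t'} [//|p t t' _ IH|p t t' _ IH|t t' s s' _ IHt _ IHs|s s' t t' Ss _ IH]
  x y; rewrite ?IH ?mulrDr ?mulrDl //.
  by rewrite IHt IHs addrACA.
exact: S_add' Ss _ _.
Qed.

Lemma operator0 t t' : operator S t t' -> t 0 = 0.
Proof. by move/operatorD=> tD; apply: (addrI (t 0)); rewrite -tD !addr0. Qed.

Lemma operator0' t t' : operator S t t' -> t' 0 = 0.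
Proof. by move/operatorD'=> tD; apply: (addrI (t' 0)); rewrite -tD !addr0. Qed.

Lemma operator_iota t t' : operator S t t' -> forall x, t' (iota x) = iota (t x).
Proof.
elim=> {t t'} [//|p t t' _ IH|p t t' _ IH|t t' s s' _ IHt _ IHs|s s' t t' Ss _ IH] x.
- by rewrite IH rmorphM.
- by rewrite IH rmorphM.
- by rewrite IHt IHs rmorphD.
- by rewrite IH (S_iota _ Ss).
Qed.

Lemma operator_lin' t t' : operator S t t' ->
  forall l y, t' (kB l * y) = kB l * t' y.
Proof.
elim=> {t t'} [//|p t t' _ IH|p t t' _ IH|t t' s s' _ IHt _ IHs|s s' t t' Ss _ IH] l y.
- by rewrite IH mulrA -kB_central -mulrA.
- by rewrite IH mulrA.
- by rewrite IHt IHs mulrDr.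
- by rewrite IH (S_lin' _ _ Ss).
Qed.

(* Under the operators A is to be a simple module, with endomorphism ring K: an
   endomorphism is determined by its value at 1, and the possible values are the
   elements killed by the operators that kill 1. *)
Hypothesis detect : forall x,
  (forall t t', operator S t t' -> t 1 = 0 -> t x = 0) -> exists l, x = kA l.
Hypothesis simple : forall b, b != 0 -> exists t t', operator S t t' /\ t b = 1.

(** Independent vectors can be separated by operators.  Given operators dual
    to the first n vectors, consider their values at the next vector v.  If
    they are all scalars, then subtracting from x the combination of the first
    vectors with the values at x as coefficients is an operator that kills
    these vectors but, by independence, not v; if one of them is not, then
    following the corresponding operator by one that kills 1 but not this value
    has the same effect.  By simplicity v can further be sent to 1, and
    subtracting multiples of this new operator from the others corrects them. *)
Lemma density n (a : nat -> A) :
  (forall r : nat -> K, \sum_(i < n) kA (r i) * a i = 0 ->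
     forall i, (i < n)%N -> r i = 0) ->
  exists (t : nat -> A -> A) (t' : nat -> B -> B), forall i, (i < n)%N ->
    operator S (t i) (t' i) /\ forall j, (j < n)%N -> t i (a j) = (i == j)%:R.
Proof.
elim: n => [|n IHn] free_a; first by exists (fun _ => id), (fun _ => id).
have [r r0 i lt_in|t [t' op_t]] := IHn.
  pose r' j := if (j < n)%N then r j else 0.
  have := free_a r'; rewrite big_ord_recr /= {2}/r' ltnn rmorph0 mul0r addr0.
  rewrite (eq_bigr (fun j : 'I_n => kA (r j) * a j)) => [|j _]; last first.
    by rewrite /r' ltn_ord.
  by move=> /(_ r0 i (ltnW lt_in)); rewrite /r' lt_in.
have [u [u' [op_u u_small u_n]]] : exists u u',
    [/\ operator S u u', forall j, (j < n)%N -> u (a j) = 0 & u (a n) != 0].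
  have [scalar|] := pselect (forall i, (i < n)%N -> exists l, t i (a n) = kA l).
    have /boolp.choice [l def_l] i : exists l, (i < n)%N -> t i (a n) = kA l.
      by case: (boolP (i < n)%N) => [/scalar [l]|_]; [exists l|exists 0].
    have [s [s' [op_s def_s]]] : exists s s', operator S s s' /\
        forall x, s x = x - \sum_(i < n) t i x * a i.
      have: forall q, (q <= n)%N -> exists s s', operator S s s' /\
          forall x, s x = x - \sum_(i < q) t i x * a i.
        elim=> [|q IHq] leqn.
          exists id, id; split; first exact: operator_id.
          by move=> x; rewrite big_ord0 subr0.
        have [s [s' [op_s def_s]]] := IHq (ltnW leqn).
        have := operator_sub op_s (operator_mulr (a q) (op_t q leqn).1).
        set s1 := (X in operator _ X _); set s1' := (X in operator _ _ X) => op1.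
        exists s1, s1'; split=> // x.
        by rewrite /s1 def_s big_ord_recr /= mulN1r opprD addrA.
      exact.
    exists s, s'; split=> // [j lt_jn|].
      rewrite def_s (bigD1 (Ordinal lt_jn)) //= big1 => [|i neq_ij].
        by rewrite (op_t j lt_jn).2 // eqxx mul1r addr0 subrr.
      by rewrite (op_t i _).2 // (negPf neq_ij : (i == j :> nat) = false) mul0r.
    rewrite def_s; apply/eqP => s_n.
    pose r i := if i == n then 1 else - l i.
    have r0 : \sum_(i < n.+1) kA (r i) * a i = 0.
      rewrite big_ord_recr /= {2}/r eqxx rmorph1 mul1r addrC -[RHS]s_n -sumrN.
      congr (_ + _); apply: eq_bigr => i _.
      by rewrite /r ltn_eqF // rmorphN mulNr def_l.
    by have /eqP := free_a r r0 n (ltnSn n); rewrite /r eqxx oner_eq0.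
  move/existsNP => [i /not_implyP [lt_in /(contra_not (detect (x := _)))]].
  move/existsNP => [s /existsNP [s' /not_implyP [op_s /not_implyP [s1 s_n]]]].
  exists (fun x => s (t i x)), (fun y => s' (t' i y)); split; last exact/eqP.
    exact: operator_comp op_s (op_t i lt_in).1.
  move=> j lt_jn; rewrite (op_t i lt_in).2 //.
  by case: eqP => _ //; apply: operator0 op_s.
have [w [w' [op_w w_n]]] := simple u_n.
have op_wu := operator_comp op_w op_u.
exists (fun i => if i == n then fun x => w (u x)
  else fun x => t i x + (-1) * (t i (a n) * w (u x))).
exists (fun i => if i == n then fun y => w' (u' y)
  else fun y => t' i y + iota (-1) * (iota (t i (a n)) * w' (u' y))).
move=> i; rewrite ltnS leq_eqVlt; have [-> _|neq_in /= lt_in] := eqVneq i n.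
  split=> // j; rewrite ltnS leq_eqVlt => /orP [/eqP ->|lt_jn]; first by rewrite eqxx.
  by rewrite gtn_eqF // u_small // (operator0 op_w).
split.
  exact: operator_sub (op_t i lt_in).1 (operator_mull (t i (a n)) op_wu).
move=> j; rewrite ltnS leq_eqVlt => /orP [/eqP ->|lt_jn].
  by rewrite w_n mulr1 mulN1r subrr (negPf neq_in).
by rewrite u_small // (operator0 op_w) !mulr0 addr0 (op_t i lt_in).2.
Qed.

(** The operator dual to a i extends to a map of B that is linear over L, and
    extracts l i from the relation. *)
Lemma density_free m (a : 'I_m -> A) :
  (forall r : 'I_m -> K, \sum_i kA (r i) * a i = 0 -> forall i, r i = 0) ->
  forall l : 'I_m -> L, \sum_i kB (l i) * iota (a i) = 0 -> forall i, l i = 0.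
Proof.
move=> free_a l l0 i.
pose a' j := oapp a 0 (insub j).
have a'E (j : 'I_m) : a' j = a j by rewrite /a' valK.
have [r r0 j lt_jm|t [t' op_t]] := @density m a'.
  apply: (free_a (fun j => r j) _ (Ordinal lt_jm)); rewrite -[RHS]r0.
  by apply: eq_bigr => j' _; rewrite a'E.
have [op_i t_i] := op_t i (ltn_ord i).
have : t' i (\sum_i0 kB (l i0) * iota (a i0)) = 0.
  by rewrite l0 (operator0' op_i).
have -> : t' i (\sum_i0 kB (l i0) * iota (a i0)) =
    \sum_i0 kB (l i0) * iota (t i (a i0)).
  transitivity (\sum_i0 t' i (kB (l i0) * iota (a i0))).
    elim/big_rec2: _ => [|j x y _ <-]; first exact: operator0' op_i.
    exact: operatorD' op_i _ _.
  by apply: eq_bigr => j _; rewrite (operator_lin' op_i) (operator_iota op_i).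
rewrite (bigD1 i) //= big1 => [|j neq_ji]; last first.
  by rewrite -a'E t_i // eq_sym (negPf neq_ji : (j == i :> nat) = false) rmorph0 mulr0.
by rewrite -a'E t_i // eqxx rmorph1 mulr1 addr0 => /eqP; rewrite fmorph_eq0 => /eqP.
Qed.

End Density.

(** * Fields inside rings *)

Record central_subfield (A : nzRingType) := CentralSubfield {
  in_subfield :> A -> Prop;
  subfield1 : in_subfield 1;
  subfieldB : forall x y, in_subfield x -> in_subfield y -> in_subfield (x - y);
  subfieldM : forall x y, in_subfield x -> in_subfield y -> in_subfield (x * y);
  subfield_central : forall x y, in_subfield x -> x * y = y * x;
  subfieldV : forall x, in_subfield x -> x != 0 ->
    exists2 y, in_subfield y & x * y = 1 }.

Section FieldOfSubfield.
Variables (A : nzRingType) (D : central_subfield A).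

Definition subfield_mem : {pred A} := fun x => `[< D x >].

Lemma subfield_closed : subring_closed subfield_mem.
Proof.
split; first exact/asboolP/subfield1.
- by move=> x y /asboolP Dx /asboolP Dy; apply/asboolP/subfieldB.
- by move=> x y /asboolP Dx /asboolP Dy; apply/asboolP/subfieldM.
Qed.

HB.instance Definition _ :=
  GRing.isSubringClosed.Build A subfield_mem subfield_closed.

Record subfield_type := SubfieldElement {
  subfield_val : A; _ : subfield_val \in subfield_mem }.

HB.instance Definition _ := [isSub for subfield_val].
HB.instance Definition _ := [Choice of subfield_type by <:].
HB.instance Definition _ := [SubChoice_isSubNzRing of subfield_type by <:].

Lemma subfield_mulC : commutative (@GRing.mul subfield_type).
Proof.
move=> [x Dx] [y Dy]; apply: val_inj => /=; apply: subfield_central.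
exact/asboolP/Dx.
Qed.

HB.instance Definition _ :=
  GRing.PzRing_hasCommutativeMul.Build subfield_type subfield_mulC.

Lemma subfield_inv_exists (x : subfield_type) :
  exists y, if x == 0 then y = 0 else y * x = 1.
Proof.
have [_|x0] := eqVneq x 0; first by exists 0.
have [y Dy xy] : exists2 y, D y & val x * y = 1.
  apply: subfieldV; first by case: x {x0} => x Dx; apply/asboolP.
  by apply: contraNneq x0 => x0; apply/eqP/val_inj; rewrite x0.
have y_mem : y \in subfield_mem by apply/asboolP.
exists (SubfieldElement y_mem); rewrite mulrC; exact: val_inj.
Qed.

Definition subfield_inv x := projT1 (cid (subfield_inv_exists x)).

Lemma subfield_mulV x : x != 0 -> subfield_inv x * x = 1.
Proof. by rewrite /subfield_inv; case: cid => y /= /[swap] /negPf ->. Qed.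

Lemma subfield_inv0 : subfield_inv 0 = 0.
Proof. by rewrite /subfield_inv; case: cid => y /=; rewrite eqxx. Qed.

HB.instance Definition _ :=
  GRing.ComNzRing_isField.Build subfield_type subfield_mulV subfield_inv0.

Lemma subfield_embedding : exists (F : fieldType) (k : {rmorphism F -> A}),
  forall x, D x <-> exists l, x = k l.
Proof.
exists subfield_type, (val : {rmorphism subfield_type -> A}) => x; split=> [Dx|].
  have x_mem : x \in subfield_mem by apply/asboolP.
  by exists (SubfieldElement x_mem).
by case=> -[y Dy] ->; apply/asboolP.
Qed.

End FieldOfSubfield.

(** * Models of the ring axioms as rings *)

Lemma args0_unique T (f : 'I_0 -> T) : f = @args0 T.
Proof. by apply: funext => -[]. Qed.

Lemma args1_unique T (f : 'I_1 -> T) : f = args1 (f ord0).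
Proof. by apply: funext => i; rewrite (ord1 i). Qed.

Lemma args2_unique T (f : 'I_2 -> T) : f = args2 (f ord0) (f ord_max).
Proof.
apply: funext => i; rewrite /args2; case: eqP => [-> //|/eqP i0].
by congr f; apply: val_inj; case: i i0 => -[|[|]].
Qed.

Section EvalSat.
Variables (X : language) (M : structure (ring_language X)).
Implicit Type v : nat -> M.

Lemma eval_zero v : eval v tzero = rzero M.
Proof. by rewrite /rzero /= [X in finterp _ _ X]args0_unique. Qed.

Lemma eval_one v : eval v tone = rone M.
Proof. by rewrite /rone /= [X in finterp _ _ X]args0_unique. Qed.

Lemma eval_opp v t : eval v (topp t) = ropp (eval v t).
Proof. by []. Qed.

Lemma eval_add v s t : eval v (tadd s t) = radd (eval v s) (eval v t).
Proof. by rewrite /radd /= [X in finterp _ _ X]args2_unique. Qed.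

Lemma eval_mul v s t : eval v (tmul s t) = rmul (eval v s) (eval v t).
Proof. by rewrite /rmul /= [X in finterp _ _ X]args2_unique. Qed.

Definition eval_ring := (eval_zero, eval_one, eval_opp, eval_add, eval_mul).

End EvalSat.

Lemma sat_EqE L (M : structure L) (v : nat -> M) s t :
  sat v (Eq s t) = (eval v s = eval v t).
Proof. by []. Qed.

Lemma sat_EqP L (M : structure L) (v : nat -> M) s t :
  sat v (Eq s t) -> eval v s = eval v t.
Proof. by []. Qed.

Lemma sat_conj L (M : structure L) (v : nat -> M) n (p : 'I_n -> formula L) :
  sat v (\big[@And L/Top]_(i < n) p i) <-> forall i, sat v (p i).
Proof.
elim: n p => [|n IHn] p; first by rewrite big_ord0; split=> // _ [].
rewrite big_ord_recl /=; split=> [[p0 /IHn pS] i|p_all].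
  by case: (unliftP ord0 i) => [j ->|->].
by split; [|apply/IHn].
Qed.

(** The values x are indexed by the names of the variables, and not by positions
    in the block, so that consecutive quantifiers need no reindexing. *)
Definition update_block T (v : nat -> T) (i n : nat) (x : nat -> T) : nat -> T :=
  fun j => if (i <= j < i + n)%N then x j else v j.

Lemma update_block0 T (v x : nat -> T) i : update_block v i 0 x = v.
Proof.
apply: funext => j; rewrite /update_block addn0.
by case: ltngtP => //= _; rewrite ?andbF.
Qed.

Lemma update_blockS T (v x : nat -> T) i n :
  update_block v i n.+1 x = update_block (update v i (x i)) i.+1 n x.
Proof.
apply: funext => j; rewrite /update_block /update addnS addSn.
by case: (ltngtP i j) => //= ->; rewrite ltnS leq_addr.
Qed.

Lemma update_block_update T (v x : nat -> T) i n a :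
  update_block (update v i a) i.+1 n x =
  update_block v i n.+1 (update x i a).
Proof.
rewrite update_blockS {3}/update eqxx; apply: funext => j.
by rewrite /update_block /update; case: eqP => // ->; rewrite ltnn.
Qed.

Lemma sat_Exists_block L (M : structure L) (v : nat -> M) i n p :
  sat v (Exists_block i n p) <-> exists x, sat (update_block v i n x) p.
Proof.
elim: n i v => [|n IHn] i v.
  by split=> [pv|[x]]; [exists v|]; rewrite update_block0.
split=> /= [[a /IHn [x px]]|[x px]].
  by exists (update x i a); rewrite -update_block_update.
by exists (x i); apply: (IHn i.+1 _).2; exists x; rewrite -update_blockS.
Qed.

Lemma sat_Forall_block L (M : structure L) (v : nat -> M) i n p :
  sat v (Forall_block i n p) <-> forall x, sat (update_block v i n x) p.
Proof.
elim: n i v => [|n IHn] i v.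
  by split=> [pv x|/(_ v)]; rewrite update_block0.
split=> /= [pv x|pv a]; first by rewrite update_blockS; apply: (IHn i.+1 _).1.
by apply: (IHn i.+1 _).2 => x; rewrite update_block_update.
Qed.

Section RingOfStructure.
Variables (X : language) (M : structure (ring_language X)).

Record ring_structure := RingStructure {
  ring_structure_axioms : models (@ring_axioms X) M;
  ring_structure_nontrivial : rone M <> rzero M }.

(** The carrier under a name that mentions H, by which its ring structure is
    found. *)
Definition ring_of (H : ring_structure) : Type := M.

Variable H : ring_structure.
Local Notation A := (ring_of H).
Local Notation v0 := (fun _ : nat => rzero M).

HB.instance Definition _ := gen_eqMixin A.
HB.instance Definition _ := gen_choiceMixin A.

Let ax p := @ring_structure_axioms H p.

Lemma raddA : associative (@radd X M : A -> A -> A).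
Proof.
by move=> a b c; have := sat_EqP (ax (ax_addA X) v0 a b c); rewrite !eval_ring.
Qed.

Lemma raddC : commutative (@radd X M : A -> A -> A).
Proof.
by move=> a b; have := sat_EqP (ax (ax_addC X) v0 a b); rewrite !eval_ring.
Qed.

Lemma radd0 : left_id (rzero M : A) (@radd X M).
Proof. by move=> a; have := sat_EqP (ax (ax_add0 X) v0 a); rewrite !eval_ring. Qed.

Lemma raddN : left_inverse (rzero M : A) (@ropp X M) (@radd X M).
Proof. by move=> a; have := sat_EqP (ax (ax_addN X) v0 a); rewrite !eval_ring. Qed.

Lemma rmulA : associative (@rmul X M : A -> A -> A).
Proof.
by move=> a b c; have := sat_EqP (ax (ax_mulA X) v0 a b c); rewrite !eval_ring.
Qed.

Lemma rmul1l : left_id (rone M : A) (@rmul X M).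
Proof. by move=> a; have := sat_EqP (ax (ax_mul1l X) v0 a); rewrite !eval_ring. Qed.

Lemma rmul1r : right_id (rone M : A) (@rmul X M).
Proof. by move=> a; have := sat_EqP (ax (ax_mul1r X) v0 a); rewrite !eval_ring. Qed.

Lemma rmulDl : left_distributive (@rmul X M : A -> A -> A) (@radd X M).
Proof.
by move=> a b c; have := sat_EqP (ax (ax_mulDl X) v0 a b c); rewrite !eval_ring.
Qed.

Lemma rmulDr : right_distributive (@rmul X M : A -> A -> A) (@radd X M).
Proof.
by move=> a b c; have := sat_EqP (ax (ax_mulDr X) v0 a b c); rewrite !eval_ring.
Qed.

Lemma rone_neq0 : (rone M : A) != rzero M.
Proof. by apply/eqP; apply: ring_structure_nontrivial. Qed.

HB.instance Definition _ := GRing.isNzRing.Build A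
  raddA raddC radd0 raddN rmulA rmul1l rmul1r rmulDl rmulDr rone_neq0.

Lemma eval_sum (v : nat -> M) n (t : 'I_n -> term (ring_language X)) :
  eval v (\big[@tadd X/tzero]_(i < n) t i) = \sum_i (eval v (t i) : A).
Proof. by apply: (big_morph (fun t => eval v t : A)) => [s u|]; rewrite eval_ring. Qed.

Lemma eval_exp (v : nat -> M) t n : eval v (texp t n) = (eval v t : A) ^+ n.
Proof.
elim: n => [|n IHn]; first by rewrite eval_ring.
by rewrite /texp iterS eval_ring exprS -IHn.
Qed.

Variables (Df : nat -> formula (ring_language X)) (D : central_subfield A).
Hypothesis sat_D : forall v i, sat v (Df i) <-> D (v i).

Variable m : nat.
Hypothesis dim_D : forall v : nat -> M, sat v (dimension_axiom Df m).
Hypothesis rcf_D : models (real_closed_axioms Df) M.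

Lemma block_in (v x : nat -> M) s n i : (i < n)%N ->
  update_block v s n x (s + i)%N = x (s + i)%N.
Proof. by move=> lt_in; rewrite /update_block leq_addr ltn_add2l lt_in. Qed.

Lemma dimension_basis : exists a : 'I_m -> A,
  (forall x, exists2 r : 'I_m -> A, forall i, D (r i) & x = \sum_i r i * a i) /\
  (forall r : 'I_m -> A, (forall i, D (r i)) -> \sum_i r i * a i = 0 ->
     forall i, r i = 0).
Proof.
have [a [span_a free_a]] := (sat_Exists_block _ _ _ _).1 (dim_D v0).
exists (fun i => a i); set v := update_block _ _ _ _ in span_a free_a.
have v_a (i : 'I_m) : v i = a i by rewrite -[in LHS](add0n i) /v block_in ?add0n.
split=> [x|r Dr r0].
  have [z [Dz def_x]] := (sat_Exists_block _ _ _ _).1 (span_a x).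
  set w := update_block _ _ _ _ in Dz def_x.
  have w_z (i : 'I_m) : w (m + i)%N = z (m + i)%N by rewrite /w block_in.
  have w_a (i : 'I_m) : w i = a i.
    rewrite /w /update_block leqNgt ltn_ord /= /update ltn_eqF ?v_a //.
    by rewrite ltn_addr.
  exists (fun i => z (m + i)%N) => [i|].
    by rewrite -w_z; apply/sat_D; move/sat_conj: Dz.
  have {def_x} := sat_EqP def_x; rewrite eval_sum.
  rewrite [X in X = _ -> _](_ : _ = x); last first.
    by rewrite /w /= /update_block ltnn andbF /update eqxx.
  by move=> ->; apply: eq_bigr => i _; rewrite eval_ring /= w_z w_a.
pose z j := if insub (j - m)%N is Some i then r i else rzero M.
have z_r (i : 'I_m) : z (m + i)%N = r i by rewrite /z addKn valK.
have := (sat_Forall_block _ _ _ _).1 free_a z; set w := update_block _ _ _ _.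
have w_r (i : 'I_m) : w (m + i)%N = r i by rewrite /w block_in.
have w_a (i : 'I_m) : w i = a i by rewrite /w /update_block leqNgt ltn_ord v_a.
have D_w : sat w (\big[@And _/Top]_(i < m) Df (m + i)).
  by apply/sat_conj => i; apply/sat_D; rewrite w_r.
have sum_w : eval w (\big[@tadd X/tzero]_(i < m) tmul (Var (m + i)%N) (Var i)) =
    eval w tzero.
  rewrite eval_sum eval_zero -[RHS]r0.
  by apply: eq_bigr => j _; rewrite eval_ring /= w_r w_a.
move=> free_w i; have := sat_EqP ((sat_conj _ _).1 (free_w D_w sum_w) i).
by rewrite eval_ring /= w_r.
Qed.

Lemma real_closed_subfield : exists (R : rcfType) (k : {rmorphism R -> A}),
  forall x, D x <-> exists l, x = k l.
Proof.
have [F [k def_k]] := subfield_embedding D.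
have Dk l : D (k l) by apply/def_k; exists l.
have [|||R [g [g' gK g'K]]] := @real_closed_field F.
- move=> n x sum_x; pose z j : A := if insub j is Some i then k (x i) else 0.
  have := (sat_Forall_block _ _ _ _).1 (rcf_D (ax_real Df n) v0) z.
  set w := update_block _ _ _ _.
  have w_x (i : 'I_n) : w i = k (x i).
    by rewrite /w -[in LHS](add0n i) block_in ?add0n /z ?valK.
  have D_w : sat w (\big[@And _/Top]_(i < n) Df i).
    by apply/sat_conj => i; apply/sat_D; rewrite w_x; apply: Dk.
  move=> real_w; apply: (real_w D_w).
  apply: etrans (_ : _ = - (1 : A)) _; last by rewrite !eval_ring.
  rewrite eval_sum -(rmorph1 k) -rmorphN -sum_x rmorph_sum.
  by apply: eq_bigr => i _; rewrite eval_exp /= w_x rmorphXn.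
- move=> x; have Dx : sat (update v0 0 (k x)) (Df 0%N) by apply/sat_D/Dk.
  have [y []] := rcf_D (ax_square Df) v0 (k x) Dx.
  move=> /sat_D; rewrite {1}/update eqxx => /def_k [l def_y].
  have yl : eval (update (update v0 0 (k x)) 1 y) (texp (Var 1) 2) = k (l ^+ 2).
    by rewrite eval_exp /= rmorphXn -def_y.
  case=> /sat_EqP; [|rewrite eval_opp]; rewrite yl /= => def_x; exists l.
    by left; apply: (fmorph_inj k).
  by right; apply: (fmorph_inj k); rewrite rmorphN.
- move=> n c; pose N := n.*2.+1.
  pose z j : A := if insub j is Some i then k (c i) else 0.
  have := (sat_Forall_block _ _ _ _).1 (rcf_D (ax_odd_root Df n) v0) z.
  rewrite -/N; set w := update_block _ _ _ _.
  have w_c (i : 'I_N) : w i = k (c i).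
    by rewrite /w -[in LHS](add0n i) block_in ?add0n /z ?valK.
  have D_w : sat w (\big[@And _/Top]_(i < N) Df i).
    by apply/sat_conj => i; apply/sat_D; rewrite w_c; apply: Dk.
  move=> root_w; have [y []] := root_w D_w.
  move=> /sat_D; rewrite {1}/update eqxx => /def_k [l def_y] /sat_EqP.
  rewrite eval_add eval_exp eval_sum eval_zero => root_l; exists l; apply: (fmorph_inj k).
  rewrite rmorph0 rmorphD rmorphXn rmorph_sum -[RHS]root_l.
  have y_N : eval (update w N y) (Var N) = k l by rewrite /= /update eqxx.
  rewrite y_N; congr (_ + _); apply: eq_bigr => i _.
  rewrite eval_mul eval_exp y_N rmorphM rmorphXn; congr (_ * _).
  by rewrite /= /update ltn_eqF // w_c.
exists R, (GRing.RMorphism.clone _ _ (k \o g) _) => x; rewrite def_k.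
split=> -[l ->]; last by exists (g l).
by exists (g' l); rewrite /= g'K.
Qed.

Lemma subfield_basis : exists (R : rcfType) (k : {rmorphism R -> A})
    (a : 'I_m -> A) c,
  (forall x, D x <-> exists l, x = k l) /\ is_basis k a c.
Proof.
have [R [k def_k]] := real_closed_subfield.
have [a [span_a free_a]] := dimension_basis.
have [|r r0 i|c basis_a] := @basis_of_free_span _ _ k _ a.
- move=> x; have [r Dr ->] := span_a x.
  have /boolp.choice [l def_l] i : exists l, r i = k l by apply/def_k.
  by exists l; apply: eq_bigr => i _; rewrite def_l.
- apply/eqP; rewrite -(fmorph_eq0 k); apply/eqP; move: i; apply: free_a r0 => i.
  by apply/def_k; exists (r i).
by exists R, k, a, c.
Qed.

End RingOfStructure.

(** * The reduced trace in a basis *)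

Lemma mxtrace_lin_mulmx (L : comNzRingType) r (X : 'M[L]_r) :
  \tr (lin_mulmx X : 'M_(r * r)) = r%:R * \tr X.
Proof.
rewrite /mxtrace (reindex _ (curry_mxvec_bij _ _)) /=.
rewrite (eq_bigr (fun p : 'I_r * 'I_r => X p.1 p.1)) => [|[i j] _] /=.
  rewrite -(pair_bigA _ (fun i j : 'I_r => X i i)) mulr_sumr /=.
  by apply: eq_bigr => i _; rewrite sumr_const card_ord mulr_natl.
have -> : lin_mulmx X (mxvec_index i j) (mxvec_index i j) =
    ((delta_mx 0 (mxvec_index i j) : 'rV_(r * r)) *m lin_mulmx X) 0 (mxvec_index i j).
  by rewrite -rowE [RHS]mxE.
rewrite mul_rV_lin mxvecE vec_mx_delta mxE (bigD1 i) //= big1 => [|k neq_ki].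
  by rewrite mxE !eqxx mulr1 addr0.
by rewrite mxE (negPf neq_ki) mulr0.
Qed.

(** Over a splitting field left multiplication by x becomes left multiplication
    by a square matrix X on matrices of the same size, and the trace of this map
    is the size times the trace of X.  The trace of a linear map can be computed
    before or after the extension of scalars. *)
Lemma reduced_trace_formula (K : fieldType) (A : algType K) (t : A -> K) n
    (b : 'I_n -> A) (c : A -> 'rV[K]_n) :
  is_basis (in_alg A) b c -> is_reduced_trace t ->
  exists r, n = (r.+1 * r.+1)%N /\
    forall x, r.+1%:R * t x = \sum_i c (x * b i) 0 i.
Proof.
move=> basis_b [L [h [T [mu [r [f [tens f_bij t_def]]]]]]].
case: tens => -[muDl muDr muZ] mu1 muM muZl univ.
pose P := \matrix_i mxvec (f (mu (b i) 1)).
pose co i a := c a 0 i.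
have coD i a a' : co i (a + a') = co i a + co i a' by rewrite /co (coordD basis_b) mxE.
have coZ i l a : co i (l *: a) = l * co i a.
  by rewrite /co -mulr_algl (coordZ basis_b) mxE.
have mu0l l : mu 0 l = 0 by apply: (addrI (mu 0 l)); rewrite -muDl !addr0.
have mu_sum (F : 'I_n -> A) l : mu (\sum_i F i) l = \sum_i mu (F i) l.
  by elim/big_rec2: _ => [//|i x y _ <-]; rewrite muDl.
(* the coordinate functions extend to the tensor product *)
have /boolp.choice [g def_g] i : exists g : {additive T -> L},
    forall a l, g (mu a l) = h (co i a) * l.
  have [|g [g_mu _]] := univ L (fun a l => h (co i a) * l); last by exists g.
  split=> [a a' l|a l l'|k a l]; rewrite ?coD ?coZ ?rmorphD ?mulrDl ?mulrDr //.
  by rewrite rmorphM mulrA [_ * h k]mulrC.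
have mu_coord a l : mu a l = \sum_i (h (co i a) * l) *: mu (b i) 1.
  rewrite {1}(basisE basis_b a) mu_sum; apply: eq_bigr => i _.
  by rewrite /= mulr_algl muZ muZl mulr1.
(* both sides are additive and agree on pure tensors *)
have T_coord x : x = \sum_i g i x *: mu (b i) 1.
  pose G x := \sum_i g i x *: mu (b i) 1.
  have GB : zmod_morphism G.
    by move=> u v; rewrite /G -sumrB; apply: eq_bigr => i _; rewrite raddfB scalerBl.
  pose G' : {additive T -> T} := HB.pack G (GRing.isZmodMorphism.Build _ _ _ GB).
  have [|g0 [_ g0_uniq]] := univ T mu; first by [].
  have G_g0 : G' =1 g0.
    apply: g0_uniq => a l; rewrite /= /G mu_coord; apply: eq_bigr => i _.
    by rewrite -mu_coord def_g.
  have id_g0 : (idfun : T -> T) =1 g0 by apply: (g0_uniq idfun).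
  by rewrite -[LHS]/(idfun x) id_g0 -G_g0.
have [f' fK f'K] := f_bij.
have sum_P (l : 'rV_n) : l *m P = mxvec (f (\sum_i l 0 i *: mu (b i) 1)).
  rewrite mulmx_sum_row !raddf_sum /=; apply: eq_bigr => i _.
  by rewrite rowK !linearZ.
have full_P : row_full P.
  apply/row_fullP; exists (\matrix_i \row_j g j (f' (vec_mx (delta_mx 0 i)))).
  apply/row_matrixP => i; rewrite row_mul rowK sum_P row1.
  under eq_bigr do rewrite mxE.
  by rewrite -T_coord f'K vec_mxK.
have free_P : row_free P.
  rewrite -kermx_eq0; apply/eqP/row_matrixP => i.
  have : row i (kermx P) *m P = 0 by rewrite -row_mul mulmx_ker row0.
  move: (row i _) => l; rewrite sum_P row0 -[RHS](raddf0 mxvec) -(raddf0 f).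
  move/(can_inj mxvecK)/(bij_inj f_bij) => l0; apply/rowP => j; rewrite mxE.
  have : g j (\sum_i0 l 0 i0 *: mu (b i0) 1) = 0 by rewrite l0 raddf0.
  rewrite raddf_sum (bigD1 j) //= big1 => [|k neq_kj].
    by rewrite muZl mulr1 def_g /co (coord_basis basis_b) mxE !eqxx rmorph1 mul1r addr0.
  rewrite muZl def_g /co (coord_basis basis_b) mxE eqxx eq_sym (negPf neq_kj).
  by rewrite rmorph0 mul0r.
have def_n : n = (r.+1 * r.+1)%N.
  by rewrite -(eqP full_P) (eqP free_P).
exists r; split=> // x.
pose C := \matrix_(i, j) co j (x * b i).
apply: (fmorph_inj h); rewrite rmorphM rmorph_nat t_def rmorph_sum /=.
have -> : \sum_i h (c (x * b i) 0 i) = \tr (map_mx h C).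
  by apply: eq_bigr => i _; rewrite !mxE.
rewrite -mxtrace_lin_mulmx; set X := f (mu x 1).
have CP : map_mx h C *m P = P *m lin_mulmx X.
  apply/row_matrixP => i; rewrite !row_mul rowK mul_vec_lin /=.
  have -> : X *m f (mu (b i) 1) = f (mu (x * b i) 1).
    by rewrite -[LHS]/(X * f (mu (b i) 1)) -rmorphM muM mulr1.
  rewrite sum_P mu_coord; congr (mxvec (f _)); apply: eq_bigr => j _.
  by rewrite !mxE mulr1.
have [Q QP] := row_fullP full_P; have [Q' PQ'] := row_freeP free_P.
have PQ : P *m Q = 1%:M by rewrite -[P *m Q]mulmx1 -PQ' mulmxA -(mulmxA P) QP mulmx1.
by rewrite -[map_mx h C]mulmx1 -PQ mulmxA CP mxtrace_mulC mulmxA QP mul1mx.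
Qed.

(** * Pairs of algebras *)

Section Pair.
Variables (K L : fieldType) (A B : nzRingType).
Variables (kA : {rmorphism K -> A}) (kB : {rmorphism L -> B}).
Variables (iota : {rmorphism A -> B}).
Hypothesis kB_central : forall l y, kB l * y = y * kB l.

(** The values at x of the operators form a two-sided ideal. *)
Lemma simple_operators (S : (A -> A) -> (B -> B) -> Prop) n (b : 'I_n -> A) c :
  is_basis kA b c ->
  (forall x : A, exists y, x * y * x = x) ->
  (forall e : A, (forall x, e * x = x * e) -> e * e = e -> e != 0 -> e = 1) ->
  forall x, x != 0 -> exists t t', operator iota S t t' /\ t x = 1.
Proof.
move=> basis_b regular central_idem x x0.
pose I y := exists t t', operator iota S t t' /\ t x = y.
apply: (@regular_ideal_full _ _ _ _ _ _ basis_b regular central_idem I) x0.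
- move=> _ _ [t [t' [op_t <-]]] [s [s' [op_s <-]]].
  exists (fun y => t y + s y), (fun y => t' y + s' y).
  by split=> //; apply: operator_add.
- move=> p _ [t [t' [op_t <-]]].
  exists (fun y => p * t y), (fun y => iota p * t' y).
  by split=> //; apply: operator_mull.
- move=> p _ [t [t' [op_t <-]]].
  exists (fun y => t y * p), (fun y => t' y * iota p).
  by split=> //; apply: operator_mulr.
- by exists id, id; split; first exact: operator_id.
Qed.

Lemma scalar_map : (forall l, exists l', iota (kA l) = kB l') ->
  exists h : {rmorphism K -> L}, forall l, iota (kA l) = kB (h l).
Proof.
move=> /boolp.choice [h def_h].
have hB : zmod_morphism h.
  by move=> l l'; apply: (fmorph_inj kB); rewrite -def_h !rmorphB -!def_h.
have hM : monoid_morphism h.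
  split=> [|l l']; apply: (fmorph_inj kB); rewrite -def_h ?rmorph1 //.
  by rewrite !rmorphM -!def_h.
pose h' : {rmorphism K -> L} := HB.pack h (GRing.isZmodMorphism.Build _ _ _ hB)
  (GRing.isMonoidMorphism.Build _ _ _ hM).
by exists h'.
Qed.

Lemma coord_map (h : {rmorphism K -> L}) n (b : 'I_n -> A) c d :
  (forall l, iota (kA l) = kB (h l)) ->
  is_basis kA b c -> is_basis kB (iota \o b) d ->
  forall x, d (iota x) = map_mx h (c x).
Proof.
move=> def_h basis_b basis_ib x; rewrite {1}(basisE basis_b x) rmorph_sum.
under eq_bigr do rewrite rmorphM def_h.
by rewrite (coord_sum basis_ib); apply/rowP => i; rewrite !mxE.
Qed.

(** An element that commutes with L and with A commutes with their span. *)
Lemma centre_map n (a : 'I_n -> A) :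
  (forall y, exists r : 'I_n -> L, y = \sum_i kB (r i) * iota (a i)) ->
  forall x, (forall y, x * y = y * x) -> forall y, iota x * y = y * iota x.
Proof.
move=> span_a x xC y; have [r ->] := span_a y; rewrite mulr_sumr mulr_suml.
apply: eq_bigr => i _.
by rewrite mulrA -kB_central -!mulrA -!rmorphM xC.
Qed.

End Pair.

Lemma reduced_trace_linear (K : fieldType) (A : algType K) (t : A -> K) :
  is_reduced_trace t ->
  (forall x y, t (x + y) = t x + t y) /\ (forall l x, t (l *: x) = l * t x).
Proof.
move=> [L [h [T [mu [r [f [tens _ t_def]]]]]]].
case: tens => -[muDl muDr muZ] _ _ muZl _; split=> [x y|l x]; apply: (fmorph_inj h).
  by rewrite rmorphD !t_def muDl rmorphD raddfD.
by rewrite rmorphM !t_def muZ mulr1 -[h l]mulr1 -muZl !linearZ mulr1.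
Qed.

(** A basis of A over its centre stays a basis of B, so the sums of coordinates
    computing the reduced traces are the same, and so are the degrees, which
    are the square roots of the dimensions. *)
Lemma reduced_trace_restrict (K L : fieldType) (A : algType K) (B : algType L)
    (iota : {rmorphism A -> B}) (tA : A -> K) (tB : B -> L) m (a : 'I_m -> A) :
  (forall x : A, exists y, x * y * x = x) ->
  (forall x : A, (forall y, x * y = y * x) -> exists l, x = l%:A) ->
  (forall y : B, (forall z, y * z = z * y) -> exists l, y = l%:A) ->
  (forall x, exists r : 'I_m -> K, x = \sum_i (r i)%:A * a i) ->
  (forall y, exists r : 'I_m -> L, y = \sum_i (r i)%:A * iota (a i)) ->
  (forall n, n.+1%:R != 0 :> L) ->
  is_reduced_trace tA -> is_reduced_trace tB ->
  forall x, iota (tA x)%:A = (tB (iota x))%:A.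
Proof.
move=> regular centreA centreB span_a span_ia char0 trdA trdB x.
have kA_central l y : in_alg A l * y = y * in_alg A l.
  by rewrite /= mulr_algl mulr_algr.
have kB_central l y : in_alg B l * y = y * in_alg B l.
  by rewrite /= mulr_algl mulr_algr.
have [n [b [c basis_b]]] := basis_of_span (k := in_alg A) span_a.
have central_map := centre_map kB_central span_ia.
have [h def_h] : exists h : {rmorphism K -> L},
    forall l, iota (in_alg A l) = in_alg B (h l).
  apply: scalar_map => l; have [l' def_l] := centreB _ (central_map _ (kA_central l)).
  by exists l'.
have central_idem (e : A) : (forall y, e * y = y * e) -> e * e = e -> e != 0 -> e = 1.
  move=> /centreA [l ->]; rewrite -!in_algE -rmorphM => /(fmorph_inj (in_alg A)) ll.
  rewrite fmorph_eq0 => l0; suff -> : l = 1 by rewrite rmorph1.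
  by apply: (mulfI l0); rewrite ll mulr1.
pose S (s : A -> A) (s' : B -> B) := False.
have simple := simple_operators iota S basis_b regular central_idem.
have detect z : (forall t t', operator iota S t t' -> t 1 = 0 -> t z = 0) ->
    exists l, z = in_alg A l.
  move=> kill_z; apply: centreA => y.
  have := kill_z _ _ (operator_sub (operator_mull y (operator_id iota S))
    (operator_mulr y (operator_id iota S))).
  rewrite mulr1 mul1r !mulN1r subrr => /(_ erefl)/eqP.
  by rewrite subr_eq0 => /eqP.
have free_ib : forall r : 'I_n -> L,
    \sum_i in_alg B (r i) * iota (b i) = 0 -> forall i, r i = 0.
  apply: (density_free kB_central _ _ _ _ detect simple) => //.
  exact: basis_free basis_b.
have span_ib y : exists r : 'I_n -> L, y = \sum_i in_alg B (r i) * iota (b i).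
  have [r ->] := span_ia y.
  exists (fun j => \sum_i r i * h (c (a i) 0 j)).
  under [RHS]eq_bigr do rewrite rmorph_sum mulr_suml.
  rewrite exchange_big; apply: eq_bigr => i _.
  rewrite [in LHS](basisE basis_b (a i)) rmorph_sum mulr_sumr; apply: eq_bigr => j _.
  by rewrite !rmorphM def_h mulrA.
have [d basis_ib] := basis_of_free_span span_ib free_ib.
have [r [n_r tA_r]] := reduced_trace_formula basis_b trdA.
have [s [n_s tB_s]] := reduced_trace_formula basis_ib trdB.
have eq_rs : r = s.
  by apply/eqP; rewrite -eqSS -eqn_sqr; apply/eqP; rewrite -!mulnn -n_r -n_s.
have def_t : h (tA x) = tB (iota x).
  apply: (mulfI (char0 s)); rewrite tB_s -{1}eq_rs -(rmorph_nat h) -rmorphM tA_r.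
  rewrite rmorph_sum; apply: eq_bigr => i _.
  by rewrite -rmorphM (coord_map def_h basis_b basis_ib) mxE.
by rewrite -def_t; apply: def_h.
Qed.

(** * Interpretation in a power of a real closed field *)

Record interpretation (L : language) (R0 : Type) (m : nat) := Interpretation {
  int_fun : forall f : fsym L,
    ('I_(farity f) -> 'I_m -> GRing.term R0) -> 'I_m -> GRing.term R0;
  int_rel : forall r : rsym L,
    ('I_(rarity r) -> 'I_m -> GRing.term R0) -> ord.formula R0 }.

Arguments int_fun {L R0 m} i f x.
Arguments int_rel {L R0 m} i r x.

Definition ring_interpretation L (R0 : realDomainType) m
    (J : interpretation L R0 m) : Prop :=
  (forall f x, (forall k j, GRing.rterm (x k j)) ->
     forall j, GRing.rterm (int_fun J f x j)) /\
  (forall r x, (forall k j, GRing.rterm (x k j)) ->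
     ord.rformula (int_rel J r x)).

(** The coefficients of J are taken to R by g, so that one J serves for two
    fields.  The x k are any terms whose values are the coordinates of the
    arguments, and not just variables, as an interpreted symbol has to be
    applied to translated terms. *)
Definition interprets L (R0 : Type) m (J : interpretation L R0 m)
    (R : realDomainType) (g : R0 -> R) (M : structure L) (c : M -> 'rV[R]_m) : Prop :=
  (forall f args (e : seq R) x,
     (forall k j, GRing.eval e (map_term g (x k j)) = c (args k) 0 j) ->
     forall j, GRing.eval e (map_term g (int_fun J f x j)) = c (finterp M f args) 0 j) /\
  (forall r args (e : seq R) x,
     (forall k j, GRing.eval e (map_term g (x k j)) = c (args k) 0 j) ->
     (ord.holds e (map_formula g (int_rel J r x)) <-> rinterp M r args)).

Section Translation.
Variables (L : language) (R0 : realDomainType) (m : nat).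
Variable J : interpretation L R0 m.

Fixpoint translate_term (t : term L) : 'I_m -> GRing.term R0 :=
  match t with
  | Var i => fun j => GRing.Var R0 (i * m + j)
  | App f args => int_fun J f (fun k => translate_term (args k))
  end.

Definition conj_formula (f : 'I_m -> ord.formula R0) : ord.formula R0 :=
  foldr (fun j p => ord.And (f j) p) (ord.Bool true) (enum 'I_m).

Fixpoint translate (p : formula L) : ord.formula R0 :=
  match p with
  | Bot => ord.Bool false
  | Eq s t => conj_formula (fun j => ord.Equal (translate_term s j) (translate_term t j))
  | Rel r args => int_rel J r (fun k => translate_term (args k))
  | And p q => ord.And (translate p) (translate q)
  | Or p q => ord.Or (translate p) (translate q)
  | Imp p q => ord.Implies (translate p) (translate q)
  | Forall i p => foldr (@ord.Forall R0) (translate p) (iota (i * m) m)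
  | Exists i p => foldr (@ord.Exists R0) (translate p) (iota (i * m) m)
  end.

Lemma conj_formula_rformula f :
  (forall j, ord.rformula (f j)) -> ord.rformula (conj_formula f).
Proof. by rewrite /conj_formula => rf; elim: (enum _) => //= j s ->; rewrite rf. Qed.

Lemma translate_rformula p : ring_interpretation J -> ord.rformula (translate p).
Proof.
case=> rfun rrel; have rt t : forall j, GRing.rterm (translate_term t j).
  by elim: t => // f args IH; apply: rfun.
elim: p => //= [s t|r args|p -> q|p -> q|p -> q|i p|i p] //.
- by apply: conj_formula_rformula => j /=; rewrite !rt.
- exact: rrel.
- by elim: (iota _ _).
- by elim: (iota _ _).
Qed.

End Translation.

Fixpoint term_bound L (t : term L) : nat :=
  match t with
  | Var i => i.+1
  | App f args => \max_k term_bound (args k)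
  end.

Fixpoint formula_bound L (p : formula L) : nat :=
  match p with
  | Bot => 0
  | Eq s t => maxn (term_bound s) (term_bound t)
  | Rel r args => \max_k term_bound (args k)
  | And p q | Or p q | Imp p q => maxn (formula_bound p) (formula_bound q)
  | Forall i p | Exists i p => maxn i.+1 (formula_bound p)
  end.

Lemma map_formula_id R (f : ord.formula R) : map_formula id f = f.
Proof.
have mt (t : GRing.term R) : map_term id t = t.
  by elim: t => //= [t -> u ->|t ->|t -> n|t -> u ->|t ->|t -> n].
by elim: f => //= [t u|t u|t u|t|f -> g ->|f -> g ->|f -> g ->|f ->|n f ->|n f ->];
  rewrite ?mt.
Qed.

Section Blocks.
Variable R : realDomainType.
Implicit Type e : seq R.

Definition agree_outside s n e e' :=
  forall i, ~~ (s <= i < s + n)%N -> e'`_i = e`_i.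

Lemma agree_outside0 s e e' : agree_outside s 0 e e' -> GRing.same_env e e'.
Proof.
by move=> ee' i /=; rewrite ee' // addn0 negb_and -leqNgt -ltnNge orbC; case: leqP.
Qed.

Lemma agree_outsideS s n e e' :
  agree_outside s n.+1 e e' <-> agree_outside s.+1 n (set_nth 0 e s e'`_s) e'.
Proof.
split=> ee' i out; last first.
  rewrite ee' ?nth_set_nth /=; last by apply: contra out => /andP [/ltnW ->]; rewrite addSnnS.
  by case: eqP out => // ->; rewrite leqnn addnS ltnS leq_addr.
rewrite nth_set_nth /=; case: eqP => [-> //|/eqP neq_is]; apply: ee'.
by apply: contra out => /andP [le_si lt_i]; rewrite ltn_neqAle eq_sym neq_is le_si addSnnS.
Qed.

Lemma agree_outside_set s n e e' x :
  agree_outside s.+1 n (set_nth 0 e s x) e' -> e'`_s = x.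
Proof. by move=> ee'; rewrite ee' ?ltnn // nth_set_nth /= eqxx. Qed.

Lemma holds_Exists_block e s n f :
  ord.holds e (foldr (@ord.Exists R) f (iota s n)) <->
  exists2 e', agree_outside s n e e' & ord.holds e' f.
Proof.
elim: n s e => [|n IHn] s e /=.
  split=> [ef|[e' /agree_outside0 ee']]; first by exists e.
  exact/ord.eq_holds/GRing.same_env_sym.
split=> [[x /IHn [e' ee' e'f]]|[e' ee' e'f]].
  by exists e' => //; apply/agree_outsideS; rewrite (agree_outside_set ee').
by exists e'`_s; apply/IHn; exists e' => //; apply/agree_outsideS.
Qed.

Lemma holds_Forall_block e s n f :
  ord.holds e (foldr (@ord.Forall R) f (iota s n)) <->
  forall e', agree_outside s n e e' -> ord.holds e' f.
Proof.
elim: n s e => [|n IHn] s e /=.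
  split=> [ef e' /agree_outside0 ee'|]; last by apply.
  exact: ord.eq_holds ee' ef.
split=> [all_x e' ee'|all_e x]; last first.
  apply/IHn => e' ee'; apply: all_e; apply/agree_outsideS.
  by rewrite (agree_outside_set ee').
by move/IHn: (all_x e'`_s); apply; apply/agree_outsideS.
Qed.

Lemma fill_block n s e (x : 'rV[R]_n) :
  exists2 e', agree_outside s n e e' & forall j : 'I_n, e'`_(s + j) = x 0 j.
Proof.
pose y i := if insub (i - s)%N is Some j then x 0 j else 0.
exists (mkseq (fun i => if (s <= i < s + n)%N then y i else e`_i) (maxn (size e) (s + n))).
  move=> i out; have [lt_i|le_i] := ltnP i (maxn (size e) (s + n)).
    by rewrite nth_mkseq // (negPf out).
  by rewrite !nth_default ?size_mkseq // (leq_trans (leq_maxl _ _) le_i).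
move=> j; rewrite nth_mkseq.
  by rewrite leq_addr ltn_add2l ltn_ord /y addKn valK.
by rewrite leq_max ltn_add2l ltn_ord orbT.
Qed.

End Blocks.

Section TranslationCorrect.
Variables (L : language) (R0 R : realDomainType) (m : nat) (g : R0 -> R).
Variables (J : interpretation L R0 m) (M : structure L) (c : M -> 'rV[R]_m).
Hypothesis c_bij : bijective c.
Hypothesis J_M : interprets J g c.

Local Notation gt := (map_term g).
Local Notation gf := (map_formula g).

Definition codes B (v : nat -> M) (e : seq R) :=
  forall i (j : 'I_m), (i < B)%N -> e`_(i * m + j) = c (v i) 0 j.

Lemma translate_termP B v e t : (term_bound t <= B)%N -> codes B v e ->
  forall j, GRing.eval e (gt (translate_term J t j)) = c (eval v t) 0 j.
Proof.
move=> + ev; elim: t => [i lt_iB j|f args IH /bigmax_leqP leB] /=; first exact: ev.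
by apply: J_M.1 => k; apply: IH; apply: leB.
Qed.

Lemma holds_conj e (f : 'I_m -> ord.formula R0) :
  ord.holds e (gf (conj_formula f)) <-> forall j, ord.holds e (gf (f j)).
Proof.
rewrite /conj_formula; split=> [|ef]; last by elim: (enum _) => //= j s IHs; split.
move=> + j; have := mem_enum 'I_m j; rewrite inE.
by elim: (enum _) => //= i s IHs; rewrite inE => /orP [/eqP -> []|/IHs s_j [_ /s_j]].
Qed.

Lemma gf_foldr Q (f : ord.formula R0) s :
  (Q = @ord.Forall) \/ (Q = @ord.Exists) ->
  gf (foldr (Q R0) f s) = foldr (Q R) (gf f) s.
Proof. by case=> ->; elim: s => //= i s ->. Qed.

Lemma codes_update B v e i a e' : codes B v e ->
  agree_outside (i * m) m e e' -> (forall j : 'I_m, e'`_(i * m + j) = c a 0 j) ->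
  codes B (update v i a) e'.
Proof.
move=> ev ee' e'a k j lt_kB; rewrite /update; case: eqP => [-> //|/eqP neq_ki].
rewrite ee' ?ev //; apply: contra neq_ki => /andP [le_i lt_i].
have m_gt0 : (0 < m)%N by apply: leq_ltn_trans (ltn_ord j).
move: lt_i; rewrite -mulSnr => lt_i; rewrite eqn_leq -ltnS -[(i <= k)%N]ltnS.
rewrite -[(k < _)%N](ltn_pmul2r m_gt0) -[(i < _)%N](ltn_pmul2r m_gt0).
rewrite (leq_ltn_trans (leq_addr _ _) lt_i) (leq_ltn_trans le_i) //.
by rewrite mulSnr ltn_add2l.
Qed.

Lemma codes_agree B v e i e' : codes B v e ->
  agree_outside (i * m) m e e' ->
  exists a, codes B (update v i a) e'.
Proof.
move=> ev ee'; have [c' _ c'K] := c_bij.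
exists (c' (\row_j e'`_(i * m + j))); apply: codes_update ev ee' _ => j.
by rewrite c'K mxE.
Qed.

Lemma translateP p B v e : (formula_bound p <= B)%N -> codes B v e ->
  sat v p <-> ord.holds e (gf (translate J p)).
Proof.
elim: p v e => [|s t|r args|p IHp q IHq|p IHp q IHq|p IHp q IHq|i p IHp|i p IHp]
  v e //=; rewrite ?geq_max.
- move=> /andP [sB tB] ev; rewrite holds_conj; split=> [est j|st].
    by rewrite /= !(translate_termP _ ev) // est.
  by apply: (bij_inj c_bij); apply/rowP => j; rewrite -!(translate_termP _ ev) //; apply: st.
- move=> /bigmax_leqP leB ev; apply: iff_sym; apply: J_M.2 => k.
  by apply: translate_termP ev; apply: leB.
- by move=> /andP [pB qB] ev; rewrite (IHp _ _ pB ev) (IHq _ _ qB ev).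
- by move=> /andP [pB qB] ev; rewrite (IHp _ _ pB ev) (IHq _ _ qB ev).
- by move=> /andP [pB qB] ev; rewrite (IHp _ _ pB ev) (IHq _ _ qB ev).
- move=> /andP [_ pB] ev; rewrite gf_foldr ?holds_Forall_block; last by left.
  split=> [all_p e' ee'|all_e a].
    have [a ea] := codes_agree ev ee'; exact/(IHp _ _ pB ea)/all_p.
  have [e' ee' e'a] := fill_block (i * m) e (c a).
  by apply/(IHp _ _ pB (codes_update ev ee' e'a))/all_e.
- move=> /andP [_ pB] ev; rewrite gf_foldr ?holds_Exists_block; last by right.
  split=> [[a pa]|[e' ee' pe']].
    have [e' ee' e'a] := fill_block (i * m) e (c a).
    by exists e' => //; apply/(IHp _ _ pB (codes_update ev ee' e'a)).
  have [a ea] := codes_agree ev ee'.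
  by exists a; apply/(IHp _ _ pB ea).
Qed.

Lemma codes_exists B v : exists e, codes B v e.
Proof.
elim: B => [|B [e ev]]; first by exists [::].
have [e' ee' e'B] := fill_block (B * m) e (c (v B)).
exists e' => i j; rewrite ltnS leq_eqVlt => /predU1P [-> //|lt_iB].
have := codes_update ev ee' e'B j lt_iB; rewrite /update; case: eqP => // i_B.
by rewrite i_B ltnn in lt_iB.
Qed.

End TranslationCorrect.

(** Satisfaction in M and in N is decided by one and the same translated formula,
    over R and, with its coefficients mapped by h, over S; and h is elementary. *)
Lemma interprets_elementary L (R S : rcfType) (h : {rmorphism R -> S}) m
    (J : interpretation L R m) (M N : structure L) (f : M -> N)
    (c : M -> 'rV[R]_m) (d : N -> 'rV[S]_m) :
  ring_interpretation J -> bijective c -> bijective d ->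
  interprets J id c -> interprets J h d ->
  (forall x, d (f x) = map_mx h (c x)) ->
  elementary f.
Proof.
move=> rJ c_bij d_bij J_M J_N df p v.
have [e ev] := codes_exists c (formula_bound p) v.
rewrite (translateP c_bij J_M (leqnn _) ev) map_formula_id.
rewrite (rcf_morph_elementary h e (translate_rformula p rJ)).
apply: iff_sym; apply: (translateP d_bij J_N (leqnn _)) => i j lt_i.
by rewrite -{1}(rmorph0 h) (nth_map_default h) ev //= df mxE.
Qed.

(** * Formulas in coordinates *)

Section CoordinateFormulas.
Variables (R0 R : rcfType) (g : {rmorphism R0 -> R}) (m : nat).
Implicit Type x : 'I_m -> GRing.term R0.

Local Notation evalg e t := (GRing.eval e (map_term g t)).

Definition sum_term (x : 'I_m -> GRing.term R0) : GRing.term R0 :=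
  foldr (fun j t => GRing.Add (x j) t) (GRing.NatConst R0 0) (enum 'I_m).

Definition linear_term (T : 'M[R0]_m) (x : 'I_m -> GRing.term R0) (j : 'I_m) :=
  sum_term (fun i => GRing.Mul (x i) (GRing.Const (T i j))).

Definition bilinear_term (s : 'I_m -> 'I_m -> 'rV[R0]_m)
    (x y : 'I_m -> GRing.term R0) (j : 'I_m) :=
  sum_term (fun p => sum_term (fun q =>
    GRing.Mul (GRing.Mul (x p) (y q)) (GRing.Const (s p q 0 j)))).

(** The line spanned by u, by comparison with a nonzero entry of u. *)
Definition line_formula (u : 'rV[R0]_m) (k : 'I_m) (x : 'I_m -> GRing.term R0) :=
  conj_formula (fun j => ord.Equal (GRing.Mul (GRing.Const (u 0 k)) (x j))
                                   (GRing.Mul (GRing.Const (u 0 j)) (x k))).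

Definition halfline_formula (u : 'rV_m) k x :=
  ord.And (line_formula u k x)
    (ord.Le (GRing.NatConst R0 0) (GRing.Mul (GRing.Const (u 0 k)) (x k))).

Lemma rterm_sum x : (forall j, GRing.rterm (x j)) -> GRing.rterm (sum_term x).
Proof. by rewrite /sum_term => rx; elim: (enum _) => //= j s ->; rewrite rx. Qed.

Lemma rterm_linear T x : (forall j, GRing.rterm (x j)) ->
  forall j, GRing.rterm (linear_term T x j).
Proof. by move=> rx j; apply: rterm_sum => i /=; rewrite rx. Qed.

Lemma rterm_bilinear s x y : (forall j, GRing.rterm (x j)) ->
  (forall j, GRing.rterm (y j)) -> forall j, GRing.rterm (bilinear_term s x y j).
Proof.
move=> rx ry j; apply: rterm_sum => p; apply: rterm_sum => q /=.
by rewrite rx ry.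
Qed.

Lemma rformula_line u k x : (forall j, GRing.rterm (x j)) ->
  ord.rformula (line_formula u k x).
Proof. by move=> rx; apply: conj_formula_rformula => j /=; rewrite !rx. Qed.

Lemma eval_sum_term e x : evalg e (sum_term x) = \sum_j evalg e (x j).
Proof.
rewrite /sum_term -[RHS]big_enum /=.
by elim: (enum _) => [|j s IHs] /=; rewrite ?big_nil ?big_cons -?IHs.
Qed.

Lemma eval_linear_term e T x (a : 'rV[R]_m) :
  (forall j, evalg e (x j) = a 0 j) ->
  forall j, evalg e (linear_term T x j) = (a *m map_mx g T) 0 j.
Proof.
move=> xa j; rewrite eval_sum_term mxE; apply: eq_bigr => i _.
by rewrite /= xa mxE.
Qed.

Lemma eval_bilinear_term e s x y (a b : 'rV[R]_m) :
  (forall j, evalg e (x j) = a 0 j) -> (forall j, evalg e (y j) = b 0 j) ->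
  forall j, evalg e (bilinear_term s x y j) =
    (\sum_p \sum_q (a 0 p * b 0 q) *: map_mx g (s p q)) 0 j.
Proof.
move=> xa yb j; rewrite eval_sum_term summxE; apply: eq_bigr => p _.
rewrite eval_sum_term summxE; apply: eq_bigr => q _.
by rewrite /= xa yb !mxE.
Qed.

Lemma holds_line (u : 'rV_m) k e x (a : 'rV[R]_m) : u 0 k != 0 ->
  (forall j, evalg e (x j) = a 0 j) ->
  (ord.holds e (map_formula g (line_formula u k x)) <->
     exists l, a = l *: map_mx g u).
Proof.
move=> uk xa; rewrite holds_conj; split=> [line_a|[l def_a] j] /=.
  exists (a 0 k / g (u 0 k)); apply/rowP => j; have := line_a j.
  rewrite /= !xa !mxE => line_j; have guk : g (u 0 k) != 0 by rewrite fmorph_eq0.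
  by apply: (mulfI guk); rewrite line_j mulrA [g _ * (_ / _)]mulrC divfK // mulrC.
by rewrite !xa def_a !mxE mulrCA [RHS]mulrCA [g (u 0 k) * _]mulrC.
Qed.

Lemma holds_halfline (u : 'rV_m) k e x (a : 'rV[R]_m) : u 0 k != 0 ->
  (forall j, evalg e (x j) = a 0 j) ->
  (ord.holds e (map_formula g (halfline_formula u k x)) <->
     exists l, 0 <= l /\ a = l *: map_mx g u).
Proof.
move=> uk xa; have guk : g (u 0 k) != 0 by rewrite fmorph_eq0.
have sgn l : a = l *: map_mx g u -> (0 <= g (u 0 k) * evalg e (x k)) = (0 <= l).
  move=> def_a; rewrite xa def_a !mxE mulrCA -expr2 pmulr_lge0 //.
  by rewrite lt_neqAle sqr_ge0 eq_sym expf_neq0.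
split=> /= [[/(holds_line uk xa) [l def_a]]|[l [l0 def_a]]].
  by rewrite (sgn l def_a); exists l.
split; first by apply/(holds_line uk xa); exists l.
by rewrite (sgn l def_a).
Qed.

End CoordinateFormulas.

Section Interpretations.
Variables (R0 : rcfType) (m : nat).

Definition empty_interpretation : interpretation L_empty R0 m :=
  @Interpretation L_empty R0 m
    (fun f => match f return ('I_0 -> 'I_m -> GRing.term R0) -> 'I_m -> GRing.term R0
              with end)
    (fun r => match r return ('I_0 -> 'I_m -> GRing.term R0) -> ord.formula R0
              with end).

Definition inv_interpretation (T : 'M[R0]_m) u k : interpretation L_inv R0 m :=
  @Interpretation L_inv R0 m
    (fun _ x => linear_term T (x ord0))
    (fun _ x => line_formula u k (x ord0)).

Definition ring_language_interpretation X (J : interpretation X R0 m)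
    (u : 'rV[R0]_m) s : interpretation (ring_language X) R0 m :=
  @Interpretation (ring_language X) R0 m
    (fun f => match f return
         ('I_(@farity (ring_language X) f) -> 'I_m -> GRing.term R0) ->
         'I_m -> GRing.term R0 with
       | inl SZero => fun _ _ => GRing.NatConst R0 0
       | inl SOne => fun _ j => GRing.Const (u 0 j)
       | inl SOpp => fun x j => GRing.Opp (x ord0 j)
       | inl SAdd => fun x j => GRing.Add (x ord0 j) (x ord_max j)
       | inl SMul => fun x => bilinear_term s (x ord0) (x ord_max)
       | inr f => int_fun J f
       end)
    (fun r => int_rel J r).

Definition P_Trd_interpretation L (J : interpretation L R0 m) u k T :
    interpretation (add_P_Trd L) R0 m :=
  @Interpretation (add_P_Trd L) R0 m
    (fun f => match f return
         ('I_(@farity (add_P_Trd L) f) -> 'I_m -> GRing.term R0) ->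
         'I_m -> GRing.term R0 with
       | inl f => int_fun J f
       | inr _ => fun x => linear_term T (x ord0)
       end)
    (fun r => match r return
         ('I_(@rarity (add_P_Trd L) r) -> 'I_m -> GRing.term R0) ->
         ord.formula R0 with
       | inl r => int_rel J r
       | inr _ => fun x => halfline_formula u k (x ord0)
       end).

Lemma empty_ring_interpretation : ring_interpretation empty_interpretation.
Proof. by split=> -[]. Qed.

Lemma inv_ring_interpretation T u k : ring_interpretation (inv_interpretation T u k).
Proof.
split=> -[] x rx; first by apply: rterm_linear => j; apply: rx.
by apply: rformula_line => j; apply: rx.
Qed.

Lemma ring_language_ring_interpretation X (J : interpretation X R0 m) u s :
  ring_interpretation J ->
  ring_interpretation (ring_language_interpretation J u s).
Proof.
case=> rf rr; split=> //= -[[]|f] x rx j //=; last exact: rf.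
  by rewrite !rx.
by apply: rterm_bilinear => i; apply: rx.
Qed.

Lemma P_Trd_ring_interpretation L (J : interpretation L R0 m) u k T :
  ring_interpretation J -> ring_interpretation (P_Trd_interpretation J u k T).
Proof.
case=> rf rr; split=> -[f|[]] x rx /=.
- exact: rf.
- by apply: rterm_linear => j; apply: rx.
- exact: rr.
- by rewrite rformula_line //= rx.
Qed.

Variables (R : rcfType) (g : {rmorphism R0 -> R}).

Definition reduct X (M : structure (ring_language X)) : structure X :=
  @Structure X M (fun f => finterp M (inr f)) (fun r => rinterp M r).

Lemma interprets_empty (M : structure L_empty) (c : M -> 'rV[R]_m) :
  interprets empty_interpretation g c.
Proof. by split=> -[]. Qed.

Lemma interprets_ring_language X (J : interpretation X R0 m) u s
    (M : structure (ring_language X)) (c : M -> 'rV[R]_m) :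
  interprets J g (c : reduct M -> 'rV[R]_m) ->
  c (rzero M) = 0 -> c (rone M) = map_mx g u ->
  (forall a, c (ropp a) = - c a) -> (forall a b, c (radd a b) = c a + c b) ->
  (forall a b, c (rmul a b) = \sum_p \sum_q (c a 0 p * c b 0 q) *: map_mx g (s p q)) ->
  interprets (ring_language_interpretation J u s) g c.
Proof.
move=> [J_f J_r] c0 c1 cN cD cM; split=> [[[]|f] args e x xa j|]; last exact: J_r.
- by rewrite (args0_unique args) -/(rzero M) c0 mxE.
- by rewrite (args0_unique args) -/(rone M) c1 mxE.
- by rewrite (args1_unique args) -/(ropp _) cN mxE -xa.
- by rewrite (args2_unique args) -/(radd _ _) cD mxE -!xa.
- rewrite (args2_unique args) -/(rmul _ _) cM; apply: eval_bilinear_term => k.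
    exact: xa.
  exact: xa.
- exact: J_f.
Qed.

Lemma interprets_inv T (u : 'rV_m) k (M : structure L_inv) (c : M -> 'rV[R]_m) :
  u 0 k != 0 ->
  (forall a, c (finterp M tt (args1 a)) = c a *m map_mx g T) ->
  (forall a, rinterp M tt (args1 a) <-> exists l, c a = l *: map_mx g u) ->
  interprets (inv_interpretation T u k) g c.
Proof.
move=> uk cT cF; split=> -[] args e x xa.
  move=> j; rewrite (args1_unique args) cT.
  by apply: eval_linear_term => i; apply: xa.
by rewrite (args1_unique args) cF; apply: holds_line => // i; apply: xa.
Qed.

Lemma interprets_P_Trd L (J : interpretation L R0 m) (u : 'rV_m) k T (M : structure L)
    (P : M -> Prop) (trd : M -> M) (c : M -> 'rV[R]_m) :
  u 0 k != 0 -> interprets J g c ->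
  (forall a, c (trd a) = c a *m map_mx g T) ->
  (forall a, P a <-> exists l, 0 <= l /\ c a = l *: map_mx g u) ->
  interprets (P_Trd_interpretation J u k T) g (c : expand_P_Trd P trd -> 'rV[R]_m).
Proof.
move=> uk [J_f J_r] cT cP; split=> -[f|[]] args e x xa.
- exact: J_f.
- by move=> j; rewrite /= cT; apply: eval_linear_term => i; apply: xa.
- exact: J_r.
- by rewrite /= cP; apply: holds_halfline => // i; apply: xa.
Qed.

End Interpretations.

(** * Elementary extensions of algebras *)

Section ExtendedCoordinates.
Variables (K L : fieldType) (A B : nzRingType).
Variables (kA : {rmorphism K -> A}) (kB : {rmorphism L -> B}).
Variables (iota : {rmorphism A -> B}) (h : {rmorphism K -> L}).
Variables (m : nat) (a : 'I_m -> A) (c : A -> 'rV[K]_m) (d : B -> 'rV[L]_m).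
Hypothesis kB_central : forall l y, kB l * y = y * kB l.
Hypothesis def_h : forall l, iota (kA l) = kB (h l).
Hypothesis basis_a : is_basis kA a c.
Hypothesis basis_ia : is_basis kB (iota \o a) d.

Lemma coord_mul x y : d (x * y) =
  \sum_p \sum_q (d x 0 p * d y 0 q) *: map_mx h (c (a p * a q)).
Proof.
rewrite {1}(basisE basis_ia x) mulr_suml (coord_sumE basis_ia).
apply: eq_bigr => p _; rewrite -mulrA (coordZ basis_ia).
rewrite {1}(basisE basis_ia y) mulr_sumr (coord_sumE basis_ia) scaler_sumr.
apply: eq_bigr => q _; rewrite mulrA -kB_central -mulrA (coordZ basis_ia) scalerA.
by rewrite -rmorphM (coord_map def_h basis_a basis_ia).
Qed.

Lemma coord_linear_map (s : A -> A) (s' : B -> B) :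
  {morph s' : x y / x + y} -> (forall l y, s' (kB l * y) = kB l * s' y) ->
  (forall x, s' (iota x) = iota (s x)) ->
  forall y, d (s' y) = d y *m map_mx h (\matrix_i c (s (a i))).
Proof.
move=> s'D s'Z s's y.
rewrite (coord_linear basis_ia s'D s'Z (coordD basis_ia) (coordZ basis_ia)).
congr (_ *m _); apply/row_matrixP => i; rewrite -map_row !rowK /= s's.
exact: coord_map def_h basis_a basis_ia _.
Qed.

End ExtendedCoordinates.

(** A formula of the smaller language is also one of the larger. *)
Lemma elementary_reduct L (M N : structure L) (f : M -> N) PM PN trdM trdN :
  @elementary (add_P_Trd L) (expand_P_Trd PM trdM) (expand_P_Trd PN trdN) f ->
  elementary f.
Proof.
pose fix up_term (t : term L) : term (add_P_Trd L) := match t with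
  | Var i => Var i
  | App g args => @App (add_P_Trd L) (inl g) (fun k => up_term (args k)) end.
pose fix up (p : formula L) : formula (add_P_Trd L) := match p with
  | Bot => Bot
  | Eq s t => Eq (up_term s) (up_term t)
  | Rel r args => @Rel (add_P_Trd L) (inl r) (fun k => up_term (args k))
  | And p q => And (up p) (up q)
  | Or p q => Or (up p) (up q)
  | Imp p q => Imp (up p) (up q)
  | Forall i p => Forall i (up p)
  | Exists i p => Exists i (up p) end.
have eval_up (Q : structure L) P trd (v : nat -> Q) t :
    @eval _ (expand_P_Trd P trd) v (up_term t) = eval v t.
  by elim: t => //= g args IH; congr (finterp _ _ _); apply: funext => k; apply: IH.
have sat_up (Q : structure L) P trd (p : formula L) :
    forall v : nat -> Q, @sat _ (expand_P_Trd P trd) v (up p) <-> sat v p.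
  elim: p => //= [s t|r args|p IHp q IHq|p IHp q IHq|p IHp q IHq|i p IHp|i p IHp] v.
  - by rewrite !eval_up.
  - by under eq_fun do rewrite eval_up.
  - by rewrite IHp IHq.
  - by rewrite IHp IHq.
  - by rewrite IHp IHq.
  - by split=> pv a; apply/IHp.
  - by split=> -[a pv]; exists a; apply/IHp.
by move=> el p v; rewrite -(sat_up M PM trdM) (el (up p)) (sat_up N).
Qed.

Lemma coord1_neq0 (K : fieldType) (A : nzRingType) (k : {rmorphism K -> A}) m
    (a : 'I_m -> A) c : is_basis k a c -> exists i, (c 1) 0 i != 0.
Proof.
move=> basis_a; apply: contrapT => /forallNP u0; case/negP: (oner_neq0 A).
apply/eqP/(coord_inj basis_a)/rowP => i; rewrite (coord0 basis_a) mxE.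
by apply/eqP/negPn/negP/u0.
Qed.

Section PairElementary.
Variables (X : language) (M N : structure (ring_language X)).
Variables (HM : ring_structure M) (HN : ring_structure N).
Local Notation A := (ring_of HM).
Local Notation B := (ring_of HN).
Variables (R S : rcfType) (kA : {rmorphism R -> A}) (kB : {rmorphism S -> B}).
Variables (iota : {rmorphism A -> B}) (h : {rmorphism R -> S}).
Variables (m : nat) (a : 'I_m -> A) (c : A -> 'rV[R]_m) (d : B -> 'rV[S]_m).
Hypothesis kA_central : forall l x, kA l * x = x * kA l.
Hypothesis kB_central : forall l y, kB l * y = y * kB l.
Hypothesis def_h : forall l, iota (kA l) = kB (h l).
Hypothesis basis_a : is_basis kA a c.
Hypothesis basis_ia : is_basis kB (iota \o a) d.
Variable J : interpretation X R m.
Hypothesis ring_J : ring_interpretation J.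
Hypothesis J_M : interprets J id (c : reduct M -> _).
Hypothesis J_N : interprets J h (d : reduct N -> _).
Variables (PM : A -> Prop) (PN : B -> Prop) (trdM : A -> A) (trdN : B -> B).
Hypothesis PM_pos : forall x, PM x <-> exists l, 0 <= l /\ x = kA l.
Hypothesis PN_pos : forall x, PN x <-> exists l, 0 <= l /\ x = kB l.
Hypothesis trdMD : {morph trdM : x y / x + y}.
Hypothesis trdND : {morph trdN : x y / x + y}.
Hypothesis trdMZ : forall l x, trdM (kA l * x) = kA l * trdM x.
Hypothesis trdNZ : forall l x, trdN (kB l * x) = kB l * trdN x.
Hypothesis trd_iota : forall x, trdN (iota x) = iota (trdM x).

Lemma pair_elementary : @elementary (add_P_Trd (ring_language X))
  (expand_P_Trd PM trdM) (expand_P_Trd PN trdN) iota.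
Proof.
have [k uk] := coord1_neq0 basis_a.
have d_iota := coord_map def_h basis_a basis_ia.
pose id_iota : {rmorphism A -> A} := idfun; pose id_h : {rmorphism R -> R} := idfun.
have def_id l : id_iota (kA l) = kA (id_h l) by [].
pose T := \matrix_i c (trdM (a i)).
apply: (@interprets_elementary (add_P_Trd (ring_language X)) R S h m
  (P_Trd_interpretation (ring_language_interpretation J (c 1)
     (fun p q => c (a p * a q))) (c 1) k T)
  (@expand_P_Trd (ring_language X) M PM trdM) (@expand_P_Trd (ring_language X) N PN trdN)
  iota c d).
- exact/P_Trd_ring_interpretation/ring_language_ring_interpretation.
- exact: coord_bij basis_a.
- exact: coord_bij basis_ia.
- apply: (interprets_P_Trd (g := id_h)) => //.
  + apply: (interprets_ring_language (g := id_h)) => //.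
    * exact: coord0 basis_a.
    * by rewrite map_mx_id.
    * move=> x; rewrite -[ropp x]/(- (x : A)) -mulN1r -(rmorph1 kA) -rmorphN.
      by rewrite (coordZ basis_a) scaleN1r.
    * exact: coordD basis_a.
    * exact: (coord_mul (iota := id_iota) kA_central def_id basis_a basis_a).
  + exact: (coord_linear_map (iota := id_iota) def_id basis_a basis_a).
  + move=> x; rewrite PM_pos; split=> -[l [l0 def_x]]; exists l; split=> //.
      by rewrite def_x -[kA l]mulr1 (coordZ basis_a) map_mx_id.
    apply: (coord_inj basis_a); rewrite def_x -[kA l]mulr1 (coordZ basis_a).
    by rewrite map_mx_id.
- apply: interprets_P_Trd => //.
  + apply: interprets_ring_language => //.
    * exact: coord0 basis_ia.
    * by rewrite -d_iota rmorph1.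
    * move=> x; rewrite -[ropp x]/(- (x : B)) -mulN1r -(rmorph1 kB) -rmorphN.
      by rewrite (coordZ basis_ia) scaleN1r.
    * exact: coordD basis_ia.
    * exact: coord_mul kB_central def_h basis_a basis_ia.
  + exact: coord_linear_map def_h basis_a basis_ia _ _ trdND trdNZ trd_iota.
  + move=> x; rewrite PN_pos -d_iota rmorph1; split=> -[l [l0 def_x]]; exists l; split=> //.
      by rewrite def_x -[kB l]mulr1 (coordZ basis_ia).
    by apply: (coord_inj basis_ia); rewrite def_x -[kB l]mulr1 (coordZ basis_ia).
- exact: d_iota.
Qed.

End PairElementary.

(** * Models as algebras over real closed fields *)

Section CentralModel.
Variables (X : language) (M : structure (ring_language X)).
Hypothesis ax : models (@ring_axioms X) M.
Hypothesis sat_regular : forall v : nat -> M, sat v (regular_axiom X).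
Hypothesis sat_centre_field : forall v : nat -> M, sat v (centre_field_axiom X).
Local Notation v0 := (fun _ : nat => rzero M).

Lemma one_neq_zero : rone M <> rzero M.
Proof.
move=> one_zero; have [neq _] := sat_centre_field v0.
suff eq01 : sat v0 (Eq tzero tone) by exact: neq eq01.
by rewrite sat_EqE eval_zero eval_one.
Qed.

Definition model_ring : ring_structure M := RingStructure ax one_neq_zero.
Local Notation A := (ring_of model_ring).

Lemma sat_centre (v : nat -> M) i :
  sat v (centre_formula X i) <-> forall y : A, (v i : A) * y = y * (v i : A).
Proof.
have E y : update v i.+1 y i = v i by rewrite /update ltn_eqF.
have E' y : update v i.+1 y i.+1 = y by rewrite /update eqxx.
suff eqE (y : A) : sat (update v i.+1 y) (Eq (tmul (Var i) (Var i.+1)) (tmul (Var i.+1) (Var i)))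
    = ((v i : A) * y = y * (v i : A)).
  split=> [vi y|vi]; first by rewrite -eqE; apply: vi.
  suff all_eq : forall y : A, sat (update v i.+1 y)
      (Eq (tmul (Var i) (Var i.+1)) (tmul (Var i.+1) (Var i))) by exact: all_eq.
  by move=> y; rewrite eqE.
by rewrite sat_EqE !eval_mul [eval _ _]E [eval _ (Var i.+1)]E'.
Qed.

Lemma model_regular (x : A) : exists y, x * y * x = x.
Proof.
have [y xyx] := sat_regular v0 x; exists y.
by have := sat_EqP xyx; rewrite !eval_mul.
Qed.

Lemma centre_inverse (x : A) : (forall y, x * y = y * x) -> x != 0 ->
  exists2 y, (forall z, y * z = z * y) & x * y = 1.
Proof.
move=> xC /eqP x0; have [_ inv] := sat_centre_field v0.
have xC' : sat (update v0 0 x) (centre_formula X 0) by apply/sat_centre.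
have [|y [/sat_centre yC xy]] := inv x xC'.
  by move=> x00; apply: x0; have := sat_EqP x00; rewrite eval_zero.
exists y; first exact: yC.
by have := sat_EqP xy; rewrite eval_mul eval_one.
Qed.

Lemma centre_idempotent (e : A) :
  (forall x, e * x = x * e) -> e * e = e -> e != 0 -> e = 1.
Proof.
move=> eC ee e0; have [y _ ey] := centre_inverse eC e0.
by rewrite -ey -[in RHS]ee -mulrA ey mulr1.
Qed.

Definition centre_subfield : central_subfield A.
Proof.
exists (fun x : A => forall y, x * y = y * x).
- by move=> y; rewrite mul1r mulr1.
- by move=> x y xC yC z; rewrite mulrBl mulrBr xC yC.
- by move=> x y xC yC z; rewrite -mulrA yC mulrA xC mulrA.
- by move=> x y xC; apply: xC.
- exact: centre_inverse.
Defined.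

End CentralModel.

Lemma embedding_rmorphism X (M N : structure (ring_language X))
    (HM : ring_structure M) (HN : ring_structure N) (iota : M -> N) :
  embedding iota ->
  exists f : {rmorphism ring_of HM -> ring_of HN}, (f : M -> N) = iota.
Proof.
case=> _ iota_f _; pose f : ring_of HM -> ring_of HN := iota.
have f1 : f 1 = 1.
  rewrite /f -[1 in LHS]/(rone M) /rone iota_f.
  by rewrite [X in finterp _ _ X]args0_unique.
have fN x : f (- x) = - f x.
  rewrite /f -[- x]/(ropp x) /ropp iota_f.
  by rewrite [X in finterp _ _ X]args1_unique.
have fD x y : f (x + y) = f x + f y.
  rewrite /f -[x + y]/(radd x y) /radd iota_f.
  by rewrite [X in finterp _ _ X]args2_unique.
have fM x y : f (x * y) = f x * f y.
  rewrite /f -[x * y]/(rmul x y) /rmul iota_f.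
  by rewrite [X in finterp _ _ X]args2_unique.
have fB : zmod_morphism f by move=> x y; rewrite fD fN.
have fmon : monoid_morphism f by split.
pose f' : {rmorphism ring_of HM -> ring_of HN} :=
  HB.pack f (GRing.isZmodMorphism.Build _ _ _ fB) (GRing.isMonoidMorphism.Build _ _ _ fmon).
by exists f'.
Qed.

(** Squares are nonnegative for every ordering, and in a real closed field each
    element is a square or the opposite of one. *)
Lemma ordering_unique X (M : structure (ring_language X)) (H : ring_structure M)
    (D P : M -> Prop) (R : rcfType) (k : {rmorphism R -> ring_of H}) :
  (forall x, D x <-> exists l, x = k l) -> is_ordering D P ->
  forall x, P x <-> exists l, 0 <= l /\ x = k l.
Proof.
move=> def_k [PD _ PM Ptot Panti] x.
have P_sqr l : P (k (l ^+ 2)).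
  rewrite rmorphXn expr2; have [|Pl|Pl] := Ptot (k l); first by apply/def_k; exists l.
    exact: PM.
  by rewrite -mulrNN; apply: PM.
split=> [Px|[l [l0 ->]]]; last by rewrite -(sqr_sqrtr l0).
have [l def_x] := (def_k x).1 (PD x Px); exists l; split=> //.
rewrite leNgt; apply/negP => l_lt0; suff l0 : l = 0 by rewrite l0 ltxx in l_lt0.
apply: (fmorph_inj k); rewrite rmorph0 -def_x; apply/(Panti x).1; split=> //.
have -> : ropp x = k (Num.sqrt (- l) ^+ 2).
  by rewrite sqr_sqrtr ?oppr_ge0 ?ltW // rmorphN -def_x.
exact: P_sqr.
Qed.

Section PairBasis.
Variables (X : language) (M N : structure (ring_language X)).
Variables (HM : ring_structure M) (HN : ring_structure N).
Local Notation A := (ring_of HM).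
Local Notation B := (ring_of HN).
Variables (Df : nat -> formula (ring_language X)) (m : nat).
Variables (DA : central_subfield A) (DB : central_subfield B).
Hypothesis sat_DA : forall v i, sat v (Df i) <-> DA (v i).
Hypothesis sat_DB : forall v i, sat v (Df i) <-> DB (v i).
Hypothesis dimM : forall v : nat -> M, sat v (dimension_axiom Df m).
Hypothesis dimN : forall v : nat -> N, sat v (dimension_axiom Df m).
Hypothesis rcfM : models (real_closed_axioms Df) M.
Hypothesis rcfN : models (real_closed_axioms Df) N.
Hypothesis regularA : forall x : A, exists y, x * y * x = x.
Hypothesis idemA : forall e : A,
  (forall x, e * x = x * e) -> e * e = e -> e != 0 -> e = 1.

Variables (f : {rmorphism A -> B}) (S : (A -> A) -> (B -> B) -> Prop).
Hypothesis S_add : forall s s', S s s' -> {morph s : x y / x + y}.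
Hypothesis S_add' : forall s s', S s s' -> {morph s' : x y / x + y}.
Hypothesis S_lin' : forall s s' z y, S s s' -> DB z -> s' (z * y) = z * s' y.
Hypothesis S_map : forall s s' x, S s s' -> s' (f x) = f (s x).
Hypothesis detect : forall x,
  (forall t t', operator f S t t' -> t 1 = 0 -> t x = 0) -> DA x.

(** M and N have the same dimension m, so the independence over the field of N
    of a basis of M is enough. *)
Lemma pair_basis : exists (R Q : rcfType) (kA : {rmorphism R -> A})
    (kB : {rmorphism Q -> B}) (a : 'I_m -> A) c d,
  [/\ forall x, DA x <-> exists l, x = kA l,
      forall y, DB y <-> exists l, y = kB l,
      is_basis kA a c & is_basis kB (f \o a) d].
Proof.
have [R [kA [a [c [def_A basis_a]]]]] := subfield_basis sat_DA dimM rcfM.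
have [Q [kB [b [d [def_B basis_b]]]]] := subfield_basis sat_DB dimN rcfN.
have kB_central l y : kB l * y = y * kB l.
  by apply: (subfield_central (c := DB)); apply/def_B; exists l.
have detect' x : (forall t t', operator f S t t' -> t 1 = 0 -> t x = 0) ->
    exists l, x = kA l by move/detect/def_A.
have S_linB s s' l y : S s s' -> s' (kB l * y) = kB l * s' y.
  by move=> Ss; apply: (S_lin' _ Ss); apply/def_B; exists l.
have simple := simple_operators f S basis_a regularA idemA.
have free_fa := density_free kB_central S_add S_add' S_linB S_map detect' simple
  (basis_free basis_a).
have [d' basis_fa] := free_is_basis basis_b free_fa.
by exists R, Q, kA, kB, a, c, d'.
Qed.

End PairBasis.

Section ReducedTraceOfModel.
Variables (X : language) (M : structure (ring_language X)) (H : ring_structure M).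
Local Notation A := (ring_of H).

Lemma Trd_iso (trd : A -> A) : is_Trd (M := M) trd ->
  exists (K : fieldType) (A' : algType K) (e : A -> A') (e' : A' -> A) (t : A' -> K),
  [/\ cancel e e' /\ cancel e' e,
      [/\ e 1 = 1, {morph e : x y / x + y} & {morph e : x y / x * y}],
      forall x : A', (forall y, x * y = y * x) <-> (exists k, x = k%:A),
      is_reduced_trace t & forall x, e (trd x) = (t (e x))%:A].
Proof.
case=> K [A' [e [t [[e' eK e'K] [e1 eD eM] centreA' trd_t e_trd]]]].
by exists K, A', e, e', t.
Qed.

Lemma Trd_linear (trd : A -> A) : is_Trd (M := M) trd ->
  {morph trd : x y / x + y} /\
  (forall z, (forall x, z * x = x * z) -> forall x, trd (z * x) = z * trd x).
Proof.
case/Trd_iso=> K [A' [e [e' [t [[eK e'K] [e1 eD eM] centreA' trd_t e_trd]]]]].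
have [tD tZ] := reduced_trace_linear trd_t.
split=> [x y|z zC x]; apply: (can_inj eK).
  by rewrite e_trd !eD tD scalerDl !e_trd.
have [k ez] : exists k, e z = k%:A.
  by apply/centreA' => w; rewrite -(e'K w) -!eM zC.
by rewrite e_trd !eM ez e_trd !mulr_algl tZ scalerA.
Qed.

End ReducedTraceOfModel.

Section ReducedTraceOfPair.
Variables (X : language) (M N : structure (ring_language X)).
Variables (HM : ring_structure M) (HN : ring_structure N).
Local Notation A := (ring_of HM).
Local Notation B := (ring_of HN).
Variables (f : {rmorphism A -> B}) (m : nat) (a : 'I_m -> A).
Hypothesis regularA : forall x : A, exists y, x * y * x = x.
Hypothesis span_a : forall x, exists r : 'I_m -> A,
  (forall i y, r i * y = y * r i) /\ x = \sum_i r i * a i.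
Hypothesis span_fa : forall x, exists r : 'I_m -> B,
  (forall i y, r i * y = y * r i) /\ x = \sum_i r i * f (a i).
Hypothesis char0 : forall n, n.+1%:R != 0 :> B.

(** [reduced_trace_restrict] is transported along the identifications of M and N
    with algebras over their centres. *)
Lemma Trd_restrict (trdM : A -> A) (trdN : B -> B) :
  is_Trd (M := M) trdM -> is_Trd (M := N) trdN ->
  forall x, trdN (f x) = f (trdM x).
Proof.
case/Trd_iso=> K [A' [e [e' [t [[eK e'K] [e1 eD eM] centreA' trd_t e_trd]]]]].
case/Trd_iso=> L [B' [g [g' [s [[gK g'K] [g1 gD gM] centreB' trd_s g_trd]]]]].
have e'D x y : e' (x + y) = e' x + e' y by apply: (can_inj eK); rewrite eD !e'K.
have e'M x y : e' (x * y) = e' x * e' y by apply: (can_inj eK); rewrite eM !e'K.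
have e'1 : e' 1 = 1 by apply: (can_inj eK); rewrite e1 e'K.
have gS (I : finType) (F : I -> B) : g (\sum_i F i) = \sum_i g (F i).
  apply: (big_morph g gD); apply: (addrI (g 0)); rewrite -gD.
  by rewrite (addr0 (0 : B)) addr0.
have eS (I : finType) (F : I -> A) : e (\sum_i F i) = \sum_i e (F i).
  apply: (big_morph e eD); apply: (addrI (e 0)); rewrite -eD.
  by rewrite (addr0 (0 : A)) addr0.
pose i0 (x : A') : B' := g (f (e' x)).
have i0D x y : i0 (x + y) = i0 x + i0 y by rewrite /i0 e'D rmorphD gD.
have i0B : zmod_morphism i0.
  by move=> x y; apply: (addIr (i0 y)); rewrite -i0D !subrK.
have i0M : monoid_morphism i0.
  by split=> [|x y]; rewrite /i0 ?e'1 ?rmorph1 // e'M rmorphM gM.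
pose iota : {rmorphism A' -> B'} := HB.pack i0
  (GRing.isZmodMorphism.Build _ _ _ i0B) (GRing.isMonoidMorphism.Build _ _ _ i0M).
have centreA z : (forall y, z * y = y * z) -> exists k, e z = k%:A.
  by move=> zC; apply/centreA' => w; rewrite -(e'K w) -!eM zC.
have centreB z : (forall y, z * y = y * z) -> exists k, g z = k%:A.
  by move=> zC; apply/centreB' => w; rewrite -(g'K w) -!gM zC.
have g0 : g (0 : B) = 0 by apply: (addrI (g (0 : B))); rewrite -gD !addr0.
have gn n : g (n%:R : B) = n%:R.
  by elim: n => // n IHn; rewrite -natr1 gD IHn -[RHS]natr1 -g1.
have iota_trd := @reduced_trace_restrict K L A' B' iota t s m (e \o a).
move=> x; apply: (can_inj gK); rewrite g_trd -[x in f x](eK x).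
rewrite -[g (f _)]/(iota (e x)) -iota_trd //.
- by rewrite -e_trd /= /i0 eK.
- move=> z; have [y zyz] := regularA (e' z); exists (e y).
  by rewrite -[z]e'K -!eM zyz.
- by move=> z; move/centreA'.
- by move=> z; move/centreB'.
- move=> z; have [r [rC def_z]] := span_a (e' z).
  have /boolp.choice [k def_k] i := centreA _ (rC i).
  exists k; rewrite -[LHS]e'K def_z eS; apply: eq_bigr => i _.
  by rewrite eM def_k.
- move=> z; have [r [rC def_z]] := span_fa (g' z).
  have /boolp.choice [k def_k] i := centreB _ (rC i).
  exists k; rewrite -[LHS]g'K def_z gS; apply: eq_bigr => i _.
  by rewrite gM def_k /= /i0 eK.
- move=> n; apply: contra_neq (char0 n) => n0; apply: (can_inj gK).
  by rewrite g0 gn -(rmorph_nat (in_alg B')) n0 rmorph0.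
Qed.

End ReducedTraceOfPair.

Section PairConclusions.
Variables (X : language) (M N : structure (ring_language X)).
Variables (HM : ring_structure M) (HN : ring_structure N).
Local Notation A := (ring_of HM).
Local Notation B := (ring_of HN).
Variables (DM : M -> Prop) (DN : N -> Prop).
Variables (R S : rcfType) (kA : {rmorphism R -> A}) (kB : {rmorphism S -> B}).
Variables (f : {rmorphism A -> B}) (h : {rmorphism R -> S}).
Variables (m : nat) (a : 'I_m -> A) (c : A -> 'rV[R]_m) (d : B -> 'rV[S]_m).
Hypothesis def_A : forall x, DM x <-> exists l, x = kA l.
Hypothesis def_B : forall y, DN y <-> exists l, y = kB l.
Hypothesis kA_central : forall l x, kA l * x = x * kA l.
Hypothesis kB_central : forall l y, kB l * y = y * kB l.
Hypothesis def_h : forall l, f (kA l) = kB (h l).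
Hypothesis basis_a : is_basis kA a c.
Hypothesis basis_fa : is_basis kB (f \o a) d.
Hypothesis regularA : forall x : A, exists y, x * y * x = x.
Variable J : interpretation X R m.
Hypothesis ring_J : ring_interpretation J.
Hypothesis J_M : interprets J id (c : reduct M -> _).
Hypothesis J_N : interprets J h (d : reduct N -> _).

Lemma pair_elementary_P_Trd PM PN (TrdM : M -> M) (TrdN : N -> N) :
  is_ordering DM PM -> is_Trd TrdM -> is_ordering DN PN -> is_Trd TrdN ->
  @elementary (add_P_Trd (ring_language X))
    (expand_P_Trd PM TrdM) (expand_P_Trd PN TrdN) f.
Proof.
move=> ordM trdM ordN trdN.
have [trdMD trdMZ] := Trd_linear (H := HM) trdM.
have [trdND trdNZ] := Trd_linear (H := HN) trdN.
apply: (pair_elementary kA_central kB_central def_h basis_a basis_fa ring_J J_M J_N).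
- exact: ordering_unique def_A ordM.
- exact: ordering_unique def_B ordN.
- exact: trdMD.
- exact: trdND.
- by move=> l; apply: trdMZ.
- by move=> l; apply: trdNZ.
apply: (Trd_restrict (a := a)) trdM trdN => //.
- move=> x; exists (fun i => kA (c x 0 i)); split; last exact: basisE basis_a x.
  by move=> i; apply: kA_central.
- move=> y; exists (fun i => kB (d y 0 i)); split; last exact: basisE basis_fa y.
  by move=> i; apply: kB_central.
- by move=> n; rewrite -(rmorph_nat kB) fmorph_eq0 pnatr_eq0.
Qed.

(** The language is expanded by the orderings and by the zero maps, which are
    compatible in the same way as the reduced traces. *)
Lemma pair_elementary_plain : elementary (f : M -> N).
Proof.
apply: (elementary_reduct (PM := fun x => exists l, 0 <= l /\ x = kA l)
  (PN := fun x => exists l, 0 <= l /\ x = kB l) (trdM := fun _ => 0 : A)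
  (trdN := fun _ => 0 : B)).
apply: (pair_elementary kA_central kB_central def_h basis_a basis_fa ring_J J_M J_N) => //.
- by move=> x y; rewrite addr0.
- by move=> x y; rewrite addr0.
- by move=> l x; rewrite mulr0.
- by move=> l x; rewrite mulr0.
- by move=> x; rewrite rmorph0.
Qed.

End PairConclusions.

(** * Algebras without involution *)

Lemma CSA_axioms (m : nat) (Q : structure L_R) : models (CSA_rcf m) Q ->
  [/\ models (@ring_axioms L_empty) Q,
      forall v : nat -> Q, sat v (regular_axiom L_empty),
      forall v : nat -> Q, sat v (centre_field_axiom L_empty),
      forall v : nat -> Q, sat v (dimension_axiom (@centre_formula L_empty) m)
    & models (real_closed_axioms (@centre_formula L_empty)) Q].
Proof.
move=> Q_CSA; split=> [p ax||||p ax]; apply: Q_CSA; do ?[exact: CSA_rcf_rcf].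
- exact/CSA_rcf_CSA/CSA_ring.
- exact/CSA_rcf_CSA/CSA_regular.
- exact/CSA_rcf_CSA/CSA_centre_field.
- exact/CSA_rcf_CSA/CSA_dimension.
Qed.

Lemma CSA_elementary (m : nat) (M N : structure L_R) (iota : M -> N) :
  models (CSA_rcf m) M -> models (CSA_rcf m) N -> embedding iota ->
  elementary iota /\
  forall PM TrdM PN TrdN,
    is_ordering (@centre _ M) PM -> is_Trd TrdM ->
    is_ordering (@centre _ N) PN -> is_Trd TrdN ->
    @elementary (add_P_Trd L_R)
      (expand_P_Trd PM TrdM) (expand_P_Trd PN TrdN) iota.
Proof.
move=> /CSA_axioms [axM regM cfM dimM rcfM] /CSA_axioms [axN regN cfN dimN rcfN] emb.
pose HM := model_ring axM cfM; pose HN := model_ring axN cfN.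
have [f f_iota] := embedding_rmorphism HM HN emb.
pose S (s : ring_of HM -> ring_of HM) (s' : ring_of HN -> ring_of HN) := False.
have detect x : (forall t t', operator f S t t' -> t 1 = 0 -> t x = 0) ->
    centre_subfield axM cfM x.
  (* the commutator with y kills 1 *)
  move=> kill_x y; have := kill_x _ _ (operator_sub
    (operator_mulr y (operator_id f S)) (operator_mull y (operator_id f S))).
  rewrite mulr1 mul1r !mulN1r subrr => /(_ erefl)/eqP.
  by rewrite subr_eq0 => /eqP.
have [R [Q [kA [kB [a [c [d [def_A def_B basis_a basis_fa]]]]]]]] :=
  pair_basis (sat_centre axM cfM : forall v i, _ <-> centre_subfield axM cfM (v i))
    (sat_centre axN cfN : forall v i, _ <-> centre_subfield axN cfN (v i))
    dimM dimN rcfM rcfN (@model_regular _ _ axM regM cfM) (@centre_idempotent _ _ axM cfM)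
    (fun s s' => @False_ind _) (fun s s' => @False_ind _)
    (fun s s' z y => @False_ind _) (fun s s' x => @False_ind _) detect.
have kA_central l x : kA l * x = x * kA l.
  by apply: (subfield_central (c := centre_subfield axM cfM)); apply/def_A; exists l.
have kB_central l y : kB l * y = y * kB l.
  by apply: (subfield_central (c := centre_subfield axN cfN)); apply/def_B; exists l.
have [h def_h] : exists h : {rmorphism R -> Q}, forall l, f (kA l) = kB (h l).
  apply: scalar_map => l; apply/def_B.
  apply: (centre_map kB_central (a := a)); last exact: kA_central.
  by move=> y; exists (fun i => d y 0 i); apply: basisE basis_fa y.
have J_M := interprets_empty (R0 := R) idfun (c : reduct M -> _).
have J_N := interprets_empty (R0 := R) h (d : reduct N -> _).
have ring_J := empty_ring_interpretation R m.
rewrite -f_iota; split.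
  exact: (pair_elementary_plain kA_central kB_central def_h basis_a basis_fa ring_J J_M J_N).
move=> PM TrdM PN TrdN.
exact: (pair_elementary_P_Trd def_A def_B kA_central kB_central def_h basis_a basis_fa
  (@model_regular _ _ axM regM cfM) ring_J J_M J_N).
Qed.

(** * Algebras with involution *)

Section InvolutionModel.
Variables (M : structure L_CSAI).
Hypothesis ax : models (@ring_axioms L_inv) M.
Hypothesis sat_centre_field : forall v : nat -> M, sat v (centre_field_axiom L_inv).
Hypothesis ax_inv : models involution_axioms M.
Hypothesis sat_F : forall v : nat -> M, sat v F_axiom.
Local Notation H := (model_ring ax sat_centre_field).
Local Notation A := (ring_of H).
Local Notation v0 := (fun _ : nat => rzero M).

Definition involution (x : A) : A := finterp M (inr tt) (args1 (x : M)).

Lemma eval_sigma (v : nat -> M) t : eval v (tsigma t) = involution (eval v t).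
Proof. by []. Qed.

Lemma involutionD : {morph involution : x y / x + y}.
Proof.
move=> x y; have := sat_EqP (ax_inv ax_sigmaD v0 x y).
by rewrite eval_sigma !eval_add !eval_sigma.
Qed.

Lemma involutionM x y : involution (x * y) = involution y * involution x.
Proof.
have := sat_EqP (ax_inv ax_sigmaM v0 x y).
by rewrite eval_sigma !eval_mul !eval_sigma.
Qed.

Lemma involutionK : cancel involution involution.
Proof. by move=> x; have := sat_EqP (ax_inv ax_sigmaK v0 x); rewrite !eval_sigma. Qed.

Lemma involution1 : involution 1 = 1.
Proof. by rewrite -[LHS]mulr1 -{2}(involutionK 1) -involutionM mulr1 involutionK. Qed.

Lemma involutionB : {morph involution : x y / x - y}.
Proof.
move=> x y; apply: (addIr (involution y)).
by rewrite -involutionD !subrK.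
Qed.

Lemma fixed_fieldE (x : A) :
  fixed_field (x : M) <-> (forall y, x * y = y * x) /\ involution x = x.
Proof.
pose v := update v0 0 (x : M).
have F_x : sat v (F_formula 0) <-> fixed_field (x : M).
  by rewrite /= /fixed_field [X in rinterp _ _ X]args1_unique.
have C_x := sat_centre ax sat_centre_field v 0.
rewrite -F_x; have [to_C of_C] := sat_F v0 x; split.
  by case/to_C=> /C_x xC /sat_EqP.
by case=> xC x_inv; apply: of_C; split; [apply/C_x|].
Qed.

Definition fixed_subfield : central_subfield A.
Proof.
exists (fun x : A => fixed_field (x : M)).
- by apply/fixed_fieldE; split; [move=> y; rewrite mul1r mulr1|exact: involution1].
- move=> x y /fixed_fieldE [xC x_inv] /fixed_fieldE [yC y_inv]; apply/fixed_fieldE.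
  by split=> [z|]; rewrite ?mulrBl ?mulrBr ?xC ?yC // involutionB x_inv y_inv.
- move=> x y /fixed_fieldE [xC x_inv] /fixed_fieldE [yC y_inv]; apply/fixed_fieldE.
  split=> [z|]; first by rewrite -mulrA yC mulrA xC mulrA.
  by rewrite involutionM x_inv y_inv yC.
- by move=> x y /fixed_fieldE [xC _].
- move=> x /fixed_fieldE [xC x_inv] x0; have [y yC xy] := centre_inverse xC x0.
  exists y => //; apply/fixed_fieldE; split=> //.
  have yx : y * x = 1 by rewrite yC.
  rewrite -[LHS]mul1r -{1}yx -mulrA -{1}x_inv -involutionM yx.
  by rewrite involution1 mulr1.
Defined.

Lemma sat_fixed (v : nat -> M) i : sat v (F_formula i) <-> fixed_subfield (v i).
Proof. by rewrite /= /fixed_field [X in rinterp _ _ X]args1_unique. Qed.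

End InvolutionModel.

Lemma CSAI_axioms (m : nat) (Q : structure L_CSAI) : models (CSAI_rcf m) Q ->
  [/\ models (@ring_axioms L_inv) Q,
      forall v : nat -> Q, sat v (regular_axiom L_inv),
      forall v : nat -> Q, sat v (centre_field_axiom L_inv),
      forall v : nat -> Q, sat v (dimension_axiom F_formula m)
    & models (real_closed_axioms F_formula) Q] /\
  models involution_axioms Q /\ forall v : nat -> Q, sat v F_axiom.
Proof.
move=> Q_CSAI; split; [split=> [p ax||||p ax]|split=> [p ax|]]; apply: Q_CSAI;
  do ?[exact: CSAI_rcf_rcf]; apply: CSAI_rcf_CSAI.
- exact: CSAI_ring.
- exact: CSAI_regular.
- exact: CSAI_centre_field.
- exact: CSAI_dimension.
- exact: CSAI_involution.
- exact: CSAI_F.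
Qed.

Lemma CSAI_elementary (m : nat) (M N : structure L_CSAI) (iota : M -> N) :
  models (CSAI_rcf m) M -> models (CSAI_rcf m) N -> embedding iota ->
  elementary iota /\
  forall PM TrdM PN TrdN,
    is_ordering (@fixed_field M) PM -> is_Trd TrdM ->
    is_ordering (@fixed_field N) PN -> is_Trd TrdN ->
    @elementary (add_P_Trd L_CSAI)
      (expand_P_Trd PM TrdM) (expand_P_Trd PN TrdN) iota.
Proof.
case/CSAI_axioms=> -[axM regM cfM dimM rcfM] [invM FM].
case/CSAI_axioms=> -[axN regN cfN dimN rcfN] [invN FN] emb.
pose HM := model_ring axM cfM; pose HN := model_ring axN cfN.
pose sM := @involution _ axM cfM; pose sN := @involution _ axN cfN.
pose DM := fixed_subfield axM cfM invM FM; pose DN := fixed_subfield axN cfN invN FN.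
have [f f_iota] := embedding_rmorphism HM HN emb.
have f_inv x : sN (f x) = f (sM x).
  have [_ emb_f _] := emb; rewrite /sN /sM /involution f_iota emb_f.
  by rewrite [X in _ = finterp _ _ X]args1_unique.
have f_fixed x : DM x -> DN (f x).
  have [_ _ emb_r] := emb; rewrite /= /fixed_field emb_r f_iota.
  by rewrite [X in rinterp _ _ X -> _]args1_unique.
have sND := @involutionD _ axN cfN invN; have sMD := @involutionD _ axM cfM invM.
have sMZ z y : DM z -> sM (z * y) = z * sM y.
  case/(fixed_fieldE FM)=> zC z_inv; rewrite /sM (@involutionM _ axM cfM invM).
  by rewrite [involution z]z_inv zC.
have sNZ z y : DN z -> sN (z * y) = z * sN y.
  case/(fixed_fieldE FN)=> zC z_inv; rewrite /sN (@involutionM _ axN cfN invN).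
  by rewrite [involution z]z_inv zC.
pose S (s : ring_of HM -> ring_of HM) (s' : ring_of HN -> ring_of HN) :=
  s = sM /\ s' = sN.
have detect x : (forall t t', operator f S t t' -> t 1 = 0 -> t x = 0) -> DM x.
  move=> kill_x; apply/(fixed_fieldE FM); split=> [y|].
    (* the commutator with y kills 1 *)
    have := kill_x _ _ (operator_sub
      (operator_mulr y (operator_id f S)) (operator_mull y (operator_id f S))).
    rewrite mulr1 mul1r !mulN1r subrr => /(_ erefl)/eqP.
    by rewrite subr_eq0 => /eqP.
  (* and so does the difference of the involution and the identity *)
  have op_s := operator_ext (conj erefl erefl : S sM sN) (operator_id f S).
  have := kill_x _ _ (operator_sub op_s (operator_id f S)).
  rewrite !mulN1r {1}/sM (@involution1 _ axM cfM invM) subrr => /(_ erefl)/eqP.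
  by rewrite subr_eq0 => /eqP.
have S_add s s' : S s s' -> {morph s : x y / x + y} by case=> -> _.
have S_add' s s' : S s s' -> {morph s' : x y / x + y} by case=> _ ->.
have S_lin s s' z y : S s s' -> DN z -> s' (z * y) = z * s' y.
  by case=> _ ->; apply: sNZ.
have S_map s s' x : S s s' -> s' (f x) = f (s x) by case=> -> ->.
have [R [Q [kA [kB [a [c [d [def_A def_B basis_a basis_fa]]]]]]]] :=
  pair_basis (sat_fixed axM cfM invM FM) (sat_fixed axN cfN invN FN)
    dimM dimN rcfM rcfN (@model_regular _ _ axM regM cfM)
    (@centre_idempotent _ _ axM cfM) S_add S_add' S_lin S_map detect.
have kA_central l x : kA l * x = x * kA l.
  by apply: (subfield_central (c := DM)); apply/def_A; exists l.
have kB_central l y : kB l * y = y * kB l.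
  by apply: (subfield_central (c := DN)); apply/def_B; exists l.
have [h def_h] : exists h : {rmorphism R -> Q}, forall l, f (kA l) = kB (h l).
  by apply: scalar_map => l; apply/def_B/f_fixed/def_A; exists l.
have [k uk] := coord1_neq0 basis_a.
pose T := \matrix_i c (sM (a i)).
pose J := inv_interpretation T (c 1) k.
have d1 : d 1 = map_mx h (c 1) by rewrite -(coord_map def_h basis_a basis_fa) rmorph1.
have J_M : interprets J id (c : reduct M -> _).
  apply: (interprets_inv (g := idfun)) => // [|x].
    apply: (coord_linear_map (iota := idfun) (h := idfun) _ basis_a basis_a) => //.
    by move=> l y; apply: sMZ; apply/def_A; exists l.
  rewrite map_mx_id //; apply: (iff_trans (B := exists l, x = kA l)); first exact: def_A.
  split=> -[l def_x]; exists l.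
    by rewrite def_x -[kA l]mulr1 (coordZ basis_a).
  by apply: (coord_inj basis_a); rewrite def_x -[kA l]mulr1 (coordZ basis_a).
have J_N : interprets J h (d : reduct N -> _).
  apply: interprets_inv => // [|x].
    apply: (coord_linear_map def_h basis_a basis_fa) => // l y.
    by apply: sNZ; apply/def_B; exists l.
  rewrite -d1; apply: (iff_trans (B := exists l, x = kB l)); first exact: def_B.
  split=> -[l def_x]; exists l.
    by rewrite def_x -[kB l]mulr1 (coordZ basis_fa).
  by apply: (coord_inj basis_fa); rewrite def_x -[kB l]mulr1 (coordZ basis_fa).
have ring_J : ring_interpretation J := inv_ring_interpretation T (c 1) k.
rewrite -f_iota; split.
  exact: (pair_elementary_plain kA_central kB_central def_h basis_a basis_fa ring_J J_M J_N).
move=> PM TrdM PN TrdN.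
exact: (pair_elementary_P_Trd def_A def_B kA_central kB_central def_h basis_a basis_fa
  (@model_regular _ _ axM regM cfM) ring_J J_M J_N).
Qed.

Theorem proposition2p6 (m : nat) :
  (model_complete (CSA_rcf m) /\ model_complete (CSAI_rcf m)) /\
  (forall (M N : structure L_R) (iota : M -> N)
     (PM : M -> Prop) (TrdM : M -> M) (PN : N -> Prop) (TrdN : N -> N),
     models (CSA_rcf m) M -> models (CSA_rcf m) N -> embedding iota ->
     is_ordering (@centre _ M) PM -> is_Trd TrdM ->
     is_ordering (@centre _ N) PN -> is_Trd TrdN ->
     @elementary (add_P_Trd L_R)
       (expand_P_Trd PM TrdM) (expand_P_Trd PN TrdN) iota) /\
  (forall (M N : structure L_CSAI) (iota : M -> N)
     (PM : M -> Prop) (TrdM : M -> M) (PN : N -> Prop) (TrdN : N -> N),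
     models (CSAI_rcf m) M -> models (CSAI_rcf m) N -> embedding iota ->
     is_ordering (@fixed_field M) PM -> is_Trd TrdM ->
     is_ordering (@fixed_field N) PN -> is_Trd TrdN ->
     @elementary (add_P_Trd L_CSAI)
       (expand_P_Trd PM TrdM) (expand_P_Trd PN TrdN) iota).
Proof.
split; first by split=> M N iota mM mN emb; [case: (CSA_elementary mM mN emb)|
  case: (CSAI_elementary mM mN emb)].
split=> M N iota PM TrdM PN TrdN mM mN emb.
  by case: (CSA_elementary mM mN emb) => _; apply.
by case: (CSAI_elementary mM mN emb) => _; apply.
Qed.
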